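(* Let $n,N,M\ge 1$ be integers with $M\ge N$. Let $A_0,A_1,\ldots,A_n\in M_N(\mathbb C)$ be Hermitian with $A_i\succeq 0$ for $i=1,\ldots,n$. Let $G_1,\ldots,G_n$ be independent $M\times M$ GUE matrices and put $$H_M=A_0\otimes I_M+\frac1{\sqrt M}\sum_{i=1}^n A_i\otimes G_i .$$ Then $$\mathbb E\lambda_{\min}(H_M)\ge \rho_--6\sqrt{\frac{nN}{M}}\,\Bigl\|\sum_{i=1}^n A_i^2\Bigr\|_{\mathrm{op}}^{1/2}.$$
   Context: GUE normalization: $G_i$ is a random Hermitian $M\times M$ matrix with independent centered Gaussian entries on and above the diagonal; diagonal entries are real standard Gaussians $N(0,1)$, and the real and imaginary parts of the off-diagonal entries are independent $N(0,1/2)$. Here $\|\cdot\|_{\mathrm{op}}$ is the operator norm, $Z\prec0$ means Hermitian negative definite, $\succeq 0$ means Hermitian positive semidefinite, and $\lambda_{\min}$ denotes the smallest eigenvalue. Define $$\rho_-=\sup_{Z\prec0}\lambda_{\min}\Bigl(A_0+Z+\sum_{i=1}^n A_iZ^{-1}A_i\Bigr),$$ with $Z$ ranging over $M_N(\mathbb C)$. *)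

(* Defs.v *)
From HB Require Import structures.
From mathcomp Require Import all_boot all_order all_algebra.
From mathcomp Require Import all_classical all_reals all_analysis.
From mathcomp Require Import complex mxtens.

Set Implicit Arguments.
Unset Strict Implicit.
Unset Printing Implicit Defensive.

Import Order.TTheory GRing.Theory Num.Theory.

Local Open Scope classical_set_scope.
Local Open Scope ring_scope.
Local Open Scope complex_scope.
Local Open Scope sesquilinear_scope.

Section HermitianMatrices.
Variable R : realType.

Definition possemidefmx (n : nat) (A : 'M[R[i]]_n) : Prop :=
  A \is hermsymmx /\ forall v : 'cV[R[i]]_n, 0 <= (v^t* *m A *m v) 0 0.

Definition negdefmx (n : nat) (A : 'M[R[i]]_n) : Prop :=
  A \is hermsymmx /\
  forall v : 'cV[R[i]]_n, v != 0 -> (v^t* *m A *m v) 0 0 < 0.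

(* When A is Hermitian and n > 0, the set is finite and nonempty, so the
   infimum is attained. *)
Definition lambda_min (n : nat) (A : 'M[R[i]]_n) : R :=
  inf [set x : R | eigenvalue A x%:C].

Definition l2norm (n : nat) (v : 'cV[R[i]]_n) : R :=
  Num.sqrt (\sum_i (complex.Re (v i 0) ^+ 2 + complex.Im (v i 0) ^+ 2)).

Definition opnorm (m n : nat) (A : 'M[R[i]]_(m, n)) : R :=
  sup [set l2norm (A *m v) | v in [set v : 'cV[R[i]]_n | l2norm v <= 1]].

(* Taken in \bar R so that no convention about suprema of unbounded sets is
   involved; it is finite when the A i are positive semidefinite and N > 0. *)
Definition rho_minus (n N : nat) (A0 : 'M[R[i]]_N) (A : 'I_n -> 'M[R[i]]_N) :
    \bar R :=
  ereal_sup
    [set (lambda_min (A0 + Z + \sum_(i < n) A i *m invmx Z *m A i))%:E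
    | Z in @negdefmx N].

End HermitianMatrices.

Section Probability.
Context (d : measure_display) (T : measurableType d) (R : realType).
Variable P : probability T R.

Definition sigma_real (X : T -> R) : set_system T :=
  preimage_set_system setT X measurable.

Definition sigma_complex (Z : T -> R[i]) : set_system T :=
  <<s sigma_real (fun w => complex.Re (Z w)) `|`
      sigma_real (fun w => complex.Im (Z w)) >>.

Definition sigma_matrix (m n : nat) (W : T -> 'M[R[i]]_(m, n)) :
    set_system T :=
  <<s \bigcup_(p in [set: 'I_m * 'I_n])
        sigma_complex (fun w => W w p.1 p.2) >>.

Definition independent (I : finType) (F : I -> set_system T) : Prop :=
  forall (J : {set I}) (E : I -> set T), (forall i, i \in J -> F i (E i)) ->
    P (\bigcap_(i in [set` J]) E i) = (\prod_(i in J) P (E i))%E.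

(* As in normal_prob, s is the standard deviation. *)
Definition normal_law (X : T -> R) (m s : R) : Prop :=
  measurable_fun setT X /\
  forall B : set R, measurable B -> P (X @^-1` B) = normal_prob m s B.

Record is_GUE (M : nat) (W : T -> 'M[R[i]]_M) : Prop := IsGUE {
  GUE_hermitian : forall w, W w \is hermsymmx ;
  GUE_independent_entries :
    independent (fun p : {p : 'I_M * 'I_M | (p.1 <= p.2)%N} =>
      sigma_complex (fun w => W w (val p).1 (val p).2)) ;
  GUE_diagonal : forall i, normal_law (fun w => complex.Re (W w i i)) 0 1 ;
  GUE_off_diagonal_Re : forall i j : 'I_M, (i < j)%N ->
    normal_law (fun w => complex.Re (W w i j)) 0 (Num.sqrt 2^-1) ;
  GUE_off_diagonal_Im : forall i j : 'I_M, (i < j)%N ->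
    normal_law (fun w => complex.Im (W w i j)) 0 (Num.sqrt 2^-1) ;
  GUE_off_diagonal_independent : forall i j : 'I_M, (i < j)%N ->
    independent (fun b : bool =>
      sigma_real (fun w => (if b then @complex.Re R else @complex.Im R)
                             (W w i j)))
}.

Definition HM (n N M : nat) (A0 : 'M[R[i]]_N) (A : 'I_n -> 'M[R[i]]_N)
    (G : 'I_n -> T -> 'M[R[i]]_M) (w : T) : 'M[R[i]]_(N * M) :=
  tensmx A0 1%:M
  + ((Num.sqrt M%:R)^-1)%:C *: \sum_(i < n) tensmx (A i) (G i w).

End Probability.

(* Main.v *)
(** Identify a unit vector of [C^N (x) C^M] with an N x M matrix [X] of
    Frobenius norm 1. Then [<X, H_M X>] is [tr (X^* A_0 X)] plus
    [M^(-1/2) sum_i tr (G_i^T X^* A_i X)], a Gaussian process indexed by the sphere.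
    Pick [S] with [S S^* = X X^*]. The minimum of this process has at least the
    expectation of the minimum of
      [tr (X^* A_0 X) + 2 M^(-1/2) Re sum_i tr (W_i^* S^* A_i X)],
    where the [W_i] are independent complex Gaussian N x M matrices: by the
    Sudakov-Fernique inequality it suffices to compare increments, and with
    [A_i = B_i^* B_i], [P = B_i X], [L = B_i S] the comparison follows from the
    identity
      [2 |L^*P - L'^*P'|^2 - |P^*P - P'^*P'|^2 = |L^*L - L'^*L'|^2 + 2 |L L'^* - P P'^*|^2],
    valid whenever [P P^* = L L^*] and [P' P'^* = L' L'^*].
    If [s] bounds the norm of the real 2nN x M Gaussian matrix made of the real and
    imaginary parts of the [W_i], then for [Z] negative definite the inequality
    [2 |Re tr (U V)| <= c |U|^2 + |V|^2 / c], applied once with the square root of [-Z]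
    and once with the identity, bounds the second process from below by
    [lambda_min (A_0 + Z + sum_i A_i Z^-1 A_i)] minus
    [2 |sum_i A_i^2|^(1/2) (s - sqrt M) / sqrt M].
    A Chevet-type bound gives [E s - sqrt M <= sqrt (2nN) + 5/4 <= 3 sqrt (nN)] for the
    best [s >= sqrt M].
    Suprema over spheres are replaced by minima over finite nets. *)

Require Import Defs.
From HB Require Import structures.
From mathcomp Require Import all_boot all_order all_algebra.
From mathcomp Require Import all_classical all_reals all_analysis.
From mathcomp Require Import measurable_realfun complex mxtens ring lra.

Set Implicit Arguments.
Unset Strict Implicit.
Unset Printing Implicit Defensive.

Import Order.TTheory GRing.Theory Num.Theory.
Import numFieldNormedType.Exports.

Local Open Scope classical_set_scope.
Local Open Scope ring_scope.

(** * Standard Gaussian averages on the line *)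

(** The matrix [S] is there for dimension reasons. Since [X^* A_i X] is M x M, a direct comparison
    would involve M x M Gaussian matrices; with [S] of size N x N the [W_i] have only N rows, and
    the excess of the norm of the stacked matrix over sqrt M is of order sqrt (nN). At [s = sqrt M]
    the bound with the square root of [-Z] gives exactly the matrix defining [rho_minus]; the bound
    with the identity pays for [s - sqrt M]. Hence [s] is truncated from below at sqrt M, and
    controlling the truncated norm produces 5/4. Gaussian vectors are handled as iterated
    one-dimensional integrals of functions that are Lipschitz along every line, a class closed under
    minima and averaging on which averages commute and can be rotated. Independence enters once, to
    identify such averages with integrals over the probability space. Measurability of the smallest
    eigenvalue is bypassed: it is bounded below by a function of finitely many coordinates, and
    integrals of nonnegative functions are monotone for arbitrary functions. *)

Section Gauss1.
Variable R : realType.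
Local Notation mu := (@lebesgue_measure R).
Local Notation gamma := (@normal_prob R 0 1).

(** The Radon-Nikodym derivative of [normal_prob] has the same integral as the density over every
    measurable set, so the two agree almost everywhere. *)
Lemma ge0_integral_normal_prob (m s : R) (f : _ -> \bar R) :
  s != 0 -> measurable_fun setT f -> (forall x, (0 <= f x)%E) ->
  (\int[normal_prob m s]_x f x = \int[mu]_x (f x * (normal_pdf m s x)%:E))%E.
Proof.
move=> s0 mf f0.
have dom := normal_prob_dominates m s.
rewrite -(Radon_Nikodym_SigmaFinite.change_of_variables dom)//.
have mpdf : measurable_fun setT (fun x => (normal_pdf m s x)%:E : \bar R).
  by apply/measurable_EFinP; exact: measurable_normal_pdf.
apply: ae_eq_integral => //.
- apply: emeasurable_funM => //; apply: (measurable_int mu).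
  exact: Radon_Nikodym_SigmaFinite.f_integrable.
- exact: emeasurable_funM.
- apply: ae_eqe_mul2l; apply: integral_ae_eq => //.
    exact: Radon_Nikodym_SigmaFinite.f_integrable.
  by move=> E _ mE; rewrite -Radon_Nikodym_SigmaFinite.f_integral.
Qed.

(** Completing the square: [expR (c * x)] times the standard density is [expR (c ^+ 2 / 2)] times
    the density centred at [c]. All moments below are extracted from this formula. *)
Lemma normal_mgf (c : R) :
  (\int[gamma]_x (expR (c * x))%:E = (expR (c ^+ 2 / 2))%:E)%E.
Proof.
have mexp : measurable_fun setT (fun x : R => expR (c * x)).
  apply: continuous_measurable_fun => x; apply: continuous_comp.
    by apply: mulrl_continuous.
  exact: continuous_expR.
rewrite ge0_integral_normal_prob ?oner_eq0//; first last.
- exact/measurable_EFinP.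
transitivity (\int[mu]_x ((expR (c ^+ 2 / 2))%:E * (normal_pdf c 1 x)%:E))%E.
    apply: eq_integral => x _; rewrite -!EFinM; congr EFin.
    rewrite !normal_pdfE ?oner_eq0//= /normal_fun.
    rewrite mulrCA [RHS]mulrCA; congr (_ * _); rewrite -!expRD; congr expR.
    by field.
  rewrite ge0_integralZl ?integral_normal_pdf ?mule1//.
  - by apply/measurable_EFinP; exact: measurable_normal_pdf.
  - by move=> x _; rewrite lee_fin normal_pdf_ge0.
Qed.

(** At most exponential growth: stable under sums and products, satisfied by polynomials and
    Lipschitz functions, and integrable by [normal_mgf] alone. *)
Definition tame (f : R -> R) := measurable_fun setT f /\
  exists C c : R, forall x, `|f x| <= C * expR (c * `|x|).

Lemma measurable_expM (c : R) : measurable_fun setT (fun x : R => expR (c * x)).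
Proof.
apply: continuous_measurable_fun => x; apply: continuous_comp.
  by apply: mulrl_continuous.
exact: continuous_expR.
Qed.

Lemma integrable_expM (c : R) : gamma.-integrable setT (EFin \o (fun x => expR (c * x))).
Proof.
apply/integrableP; split; first by apply/measurable_EFinP; exact: measurable_expM.
under eq_integral do rewrite /= ger0_norm ?expR_ge0//.
by rewrite normal_mgf ltry.
Qed.

Lemma tame_integrable f : tame f -> gamma.-integrable setT (EFin \o f).
Proof.
move=> [mf [C [c fC]]].
have := integrableD measurableT (integrable_expM c) (integrable_expM (- c)).
move=> /(integrableZl measurableT `|C|).
apply: le_integrable => //; first exact/measurable_EFinP.
move=> x _ /=; rewrite lee_fin (le_trans (fC x))//.
rewrite normrM normr_id; apply: ler_pM; rewrite ?expR_ge0 ?ler_norm//.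
  by have := le_trans (normr_ge0 _) (fC x); rewrite pmulr_lge0 ?expR_gt0.
rewrite ger0_norm ?addr_ge0 ?expR_ge0//.
have [x0|x0] := leP 0 x.
  by rewrite ger0_norm// lerDl expR_ge0.
by rewrite ltr0_norm// mulNr mulrN lerDr expR_ge0.
Qed.

Lemma tameP f : tame f <-> measurable_fun setT f /\
  exists C c : R, [/\ 0 <= C, 0 <= c & forall x, `|f x| <= C * expR (c * `|x|)].
Proof.
split=> [[mf [C [c fC]]]|[mf [C [c [C0 c0 fC]]]]]; split => //; last by exists C, c.
have C0 : 0 <= C.
  by have := le_trans (normr_ge0 _) (fC 0); rewrite pmulr_lge0 ?expR_gt0.
exists C, `|c|; split => // x; rewrite (le_trans (fC x))// ler_wpM2l// ler_expR.
by rewrite ler_wpM2r// ler_norm.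
Qed.

Lemma tameD f g : tame f -> tame g -> tame (fun x => f x + g x).
Proof.
move=> /tameP[mf [C [c [C0 c0 fC]]]] /tameP[mg [D [d [D0 d0 gD]]]].
split; first exact: measurable_funD.
exists (C + D), (c + d) => x; rewrite (le_trans (ler_normD _ _))// mulrDl.
by apply: lerD; [apply: (le_trans (fC x))|apply: (le_trans (gD x))];
  rewrite ler_wpM2l// ler_expR ler_wpM2r// ?lerDl ?lerDr.
Qed.

Lemma tameM f g : tame f -> tame g -> tame (fun x => f x * g x).
Proof.
move=> /tameP[mf [C [c [C0 c0 fC]]]] /tameP[mg [D [d [D0 d0 gD]]]].
split; first exact: measurable_funM.
exists (C * D), (c + d) => x; rewrite normrM mulrDl expRD mulrACA.
exact: ler_pM.
Qed.

Lemma tame_cst a : tame (fun=> a).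
Proof.
split => //; exists `|a|, 0 => x.
by rewrite mul0r expR0 mulr1.
Qed.

Lemma tame_id : tame (fun x => x).
Proof.
split; first exact: measurable_id.
exists 1, 1 => x; rewrite !mul1r.
by rewrite (le_trans _ (expR_ge1Dx _))// lerDr.
Qed.

Lemma tame_norm f : tame f -> tame (fun x => `|f x|).
Proof.
move=> [mf [C [c fC]]]; split; first exact: measurableT_comp.
by exists C, c => x; rewrite normr_id.
Qed.

Lemma tame_exp c : tame (fun x => expR (c * x)).
Proof.
split; first exact: measurable_expM.
exists 1, `|c| => x.
by rewrite mul1r ger0_norm ?expR_ge0// ler_expR -normrM ler_norm.
Qed.

Lemma tame_expn : tame (fun x => expR `|x|).
Proof.
split; first by apply: measurableT_comp => //; exact: measurable_expR.
by exists 1, 1 => x; rewrite !mul1r ger0_norm ?expR_ge0.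
Qed.

Lemma tameX f n : tame f -> tame (fun x => f x ^+ n).
Proof.
move=> tf; elim: n => [|n IHn]; first exact: tame_cst.
under eq_fun do rewrite exprS.
exact: tameM.
Qed.

Definition lip (C : R) (f : R -> R) := forall x y, `|f x - f y| <= C * `|x - y|.

Lemma lip_continuous C f : lip C f -> continuous f.
Proof.
move=> fC x; apply/cvgrPdist_lt => e e0.
have C0 : 0 <= C by have := le_trans (normr_ge0 _) (fC 1 0); rewrite subr0 normr1 mulr1.
near=> y; rewrite (le_lt_trans (fC _ _))//.
have : `|x - y| < e / (C + 1) by near: y; apply: (@cvgr_dist_lt _ R^o); [exact: cvg_id|rewrite divr_gt0// ltr_wpDl].
rewrite ltr_pdivlMr ?ltr_wpDl// => h; rewrite (le_lt_trans _ h)// mulrC ler_wpM2l// lerDl//.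
Unshelve. all: by end_near.
Qed.

Lemma lip_tame C f : lip C f -> tame f.
Proof.
move=> fC; have C0 : 0 <= C by have := le_trans (normr_ge0 _) (fC 1 0); rewrite subr0 normr1 mulr1.
split; first by apply: continuous_measurable_fun; exact: lip_continuous fC.
exists (`|f 0| + C), 1 => x; rewrite mul1r mulrDl.
have -> : f x = f 0 + (f x - f 0) by rewrite addrC subrK.
rewrite (le_trans (ler_normD _ _))// lerD//.
  by rewrite ler_peMr// (le_trans _ (expR_ge1Dx _))// lerDl.
rewrite (le_trans (fC _ _))// subr0 ler_wpM2l//.
by rewrite (le_trans _ (expR_ge1Dx _))// lerDr.
Qed.

Definition E1 (f : R -> R) : R := \int[gamma]_x f x.

Lemma E1D f g : tame f -> tame g -> E1 (fun x => f x + g x) = E1 f + E1 g.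
Proof. by move=> tf tg; rewrite /E1 RintegralD//; exact: tame_integrable. Qed.

Lemma E1Z a f : tame f -> E1 (fun x => a * f x) = a * E1 f.
Proof. by move=> tf; rewrite /E1 RintegralZl//; exact: tame_integrable. Qed.

Lemma E1_cst a : E1 (fun=> a) = a.
Proof. by rewrite /E1 Rintegral_cst// [X in fine X]probability_setT mulr1. Qed.

Lemma E1_le f g : tame f -> tame g -> (forall x, f x <= g x) -> E1 f <= E1 g.
Proof. by move=> tf tg fg; apply: le_Rintegral => //; exact: tame_integrable. Qed.

Lemma E1_norm f : tame f -> `|E1 f| <= E1 (fun x => `|f x|).
Proof. by move=> tf; apply: le_normr_Rintegral => //; exact: tame_integrable. Qed.

Lemma E1_exp c : E1 (fun x => expR (c * x)) = expR (c ^+ 2 / 2).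
Proof. by rewrite /E1 /Rintegral normal_mgf. Qed.

Lemma EFin_E1 f : tame f -> (\int[gamma]_x (f x)%:E = (E1 f)%:E)%E.
Proof.
move=> tf; rewrite /E1 /Rintegral fineK//.
by apply: integrable_fin_num => //; exact: tame_integrable.
Qed.
End Gauss1.

(** * Moments and rotation invariance of the standard Gaussian *)

Section Gauss2.
Variable R : realType.
Local Notation mu := (@lebesgue_measure R).
Local Notation gamma := (@normal_prob R 0 1).

Lemma mvt_real (f df : R -> R) (a b : R) : a < b ->
  (forall x, is_derive x (1 : R) f (df x)) ->
  exists2 c, a < c < b & f b - f a = df c * (b - a).
Proof.
move=> ab dfx; have [|c] := @MVT R f df a b ab (fun x _ => dfx x).
  apply: continuous_subspaceT => x.
  by apply/differentiable_continuous/derivable1_diffP; exact: ex_derive.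
by rewrite in_itv /=; exists c.
Qed.

Lemma mvt_lip (f df : R -> R) (K : R) : 
  (forall x, is_derive x (1 : R) f (df x)) -> (forall x, `|df x| <= K) -> lip K f.
Proof.
move=> dfx dfK.
have H a b : a < b -> `|f b - f a| <= K * `|b - a|.
  by move=> ab; have [c _ ->] := mvt_real ab dfx; rewrite normrM ler_wpM2r.
move=> x y; have [xy|xy|->] := ltgtP x y; last by rewrite !subrr normr0 mulr0.
- by rewrite distrC (distrC x); exact: H.
- exact: H.
Qed.

Lemma expR_sinh_ge (z : R) : 0 <= z -> 2 * z <= expR z - expR (- z).
Proof.
rewrite le_eqVlt => /predU1P[<-|z0]; first by rewrite oppr0 subrr mulr0.
have dfx (x : R) : is_derive x (1 : R) (fun z => expR z - expR (- z) - 2 * z)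
    (expR x + expR (- x) - 2).
  by apply: is_derive_eq; rewrite /GRing.scale /=; ring.
have [c _] := mvt_real z0 dfx.
rewrite !subr0 oppr0 expR0 mulr0 !subrr !subr0 => h.
rewrite -subr_ge0 h; apply: mulr_ge0; last exact: ltW.
rewrite expRN.
have e0 := expR_gt0 c; set u := expR c in e0 *.
have : 0 <= (u - 1) ^+ 2 / u by rewrite mulr_ge0 ?sqr_ge0// invr_ge0 ltW.
suff -> : (u - 1) ^+ 2 / u = u + u^-1 - 2 by [].
by field; rewrite gt_eqF.
Qed.

(** Square [expR_sinh_ge] at [y / 2]. *)
Lemma cosh_ge (y : R) : 1 + y ^+ 2 / 2 <= (expR y + expR (- y)) / 2.
Proof.
wlog y0 : y / 0 <= y.
  move=> H; have [/H//|/ltW y0] := leP 0 y.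
  by have := H (- y); rewrite sqrrN opprK (addrC (expR (- y))) oppr_ge0; apply.
have := @expR_sinh_ge (y / 2) (divr_ge0 y0 (ler0n _ _)).
set u := expR (y / 2) - _ => h.
have : y ^+ 2 <= u ^+ 2.
  by rewrite ler_sqr ?nnegrE// (le_trans _ h)//; lra.
have -> : u ^+ 2 = expR y + expR (- y) - 2.
  rewrite /u sqrrB -!expRM_natl -expRD subrr expR0.
  by rewrite !mulrN (mulrCA 2) divff ?mulr1 ?pnatr_eq0//; ring.
by lra.
Qed.

(** With [u = expR y] and [v = u^-1], the excess over 1 is [(u - 1) ^+ 2 * v / 2], and
    [u - 1 <= y * u] for [y >= 0]; the loss against [cosh_ge] is of third order. *)
Lemma cosh_le (y : R) :
  (expR y + expR (- y)) / 2 <= 1 + y ^+ 2 / 2 + `|y| ^+ 3 / 2 * expR `|y|.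
Proof.
wlog y0 : y / 0 <= y.
  move=> H; have [/H//|/ltW y0] := leP 0 y.
  by have := H (- y); rewrite sqrrN opprK (addrC (expR (- y))) normrN oppr_ge0; apply.
rewrite ger0_norm//.
have eN : expR y - 1 <= y * expR y.
  have := expR_ge1Dx (- y); rewrite -(ler_pM2r (expR_gt0 y)) -expRD addNr expR0.
  by lra.
have uv : expR y * expR (- y) = 1 by rewrite -expRD subrr expR0.
have u1 : 1 <= expR y by rewrite -expR0 ler_expR.
set u := expR y in eN uv u1 *; set v := expR (- y) in uv *.
have v0 : 0 <= v by exact: expR_ge0.
have -> : (u + v) / 2 = 1 + (u - 1) ^+ 2 * v / 2.
  have -> : (u - 1) ^+ 2 * v = u * (u * v) - 2 * (u * v) + v by ring.
  by rewrite uv; field.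
have : (u - 1) ^+ 2 * v <= y ^+ 2 * u.
  have -> : y ^+ 2 * u = (y * u) ^+ 2 * v by rewrite exprMn -[LHS]mulr1 -uv; ring.
  by rewrite ler_wpM2r// ler_sqr ?nnegrE ?subr_ge0 ?mulr_ge0// (le_trans _ u1).
have y2 : 0 <= y ^+ 2 by exact: sqr_ge0.
have : y ^+ 2 * u <= y ^+ 2 * (1 + y * u) by rewrite ler_wpM2l//; lra.
have -> : y ^+ 2 * (1 + y * u) = y ^+ 2 + y ^+ 3 * u by ring.
by lra.
Qed.

Lemma pow4_le (y : R) : y ^+ 4 <= 24 * (expR y + expR (- y)).
Proof.
have h : `|y| ^+ 4 <= 24 * expR `|y|.
  have := @expR_ge1Dxn R `|y| 3 (normr_ge0 y); rewrite (_ : 4`! = 24)%N//.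
  by move=> h; rewrite mulrC -ler_pdivrMr// (le_trans _ h)// lerDr.
have -> : y ^+ 4 = `|y| ^+ 4 by rewrite -normrX ger0_norm// exprn_even_ge0.
rewrite (le_trans h)// ler_wpM2l//.
have [y0|y0] := leP 0 y; first by rewrite ger0_norm// lerDl expR_ge0.
by rewrite ltr0_norm// lerDr expR_ge0.
Qed.

Lemma expR_le_inv (t : R) : t < 1 -> expR t <= (1 - t)^-1.
Proof.
move=> t1; have := expR_ge1Dx (- t); rewrite expRN => h.
by rewrite -[leLHS]invrK lef_pV2 ?posrE ?invr_gt0 ?expR_gt0 ?subr_gt0.
Qed.

Lemma le_of_eps (a b K : R) : (forall e, 0 < e -> e < 1 -> a <= b + K * e) -> a <= b.
Proof.
move=> H; apply/ler_addgt0Pr => e e0.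
have K1 : 0 < `|K| + 1 by rewrite ltr_wpDl.
pose d := Num.min (1 / 2) (e / (`|K| + 1)).
have d0 : 0 < d by rewrite /d lt_min divr_gt0//= divr_gt0.
have d1 : d < 1 by rewrite /d gt_min; apply/orP; left; lra.
rewrite (le_trans (H d d0 d1))// lerD2l.
rewrite (@le_trans _ _ ((`|K| + 1) * d))// ?ler_wpM2r ?(ltW d0)//.
  by rewrite (le_trans (ler_norm _))// lerDl.
by rewrite mulrC -ler_pdivlMr// /d ge_min lexx orbT.
Qed.

(** From [1 + c * x <= expR (c * x)], [c] times the mean is at most [expR (c ^+ 2 / 2) - 1], itself
    at most [c ^+ 2] for small [c]; divide by [c] of either sign and let it tend to 0. *)
Lemma E1_id : E1 (fun x : R => x) = 0.
Proof.
have H c : c * E1 (fun x : R => x) <= expR (c ^+ 2 / 2) - 1.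
  rewrite lerBrDl -E1_exp -E1Z; last exact: tame_id.
  rewrite -[X in X + _ <= _](@E1_cst R) -E1D; last exact: tameM (tame_cst _) (@tame_id R).
    apply: E1_le => [||x]; last exact: expR_ge1Dx.
      by apply: tameD; [exact: tame_cst|apply: tameM (tame_cst _) (@tame_id R)].
    exact: tame_exp.
  exact: tame_cst.
have H2 (c : R) : 0 < c -> c < 1 -> expR (c ^+ 2 / 2) - 1 <= c ^+ 2.
  move=> c0 c1; have c2 : c ^+ 2 < 1 by rewrite expr_lt1// ltW.
  have c20 : 0 < c ^+ 2 by rewrite exprn_gt0.
  have := @expR_le_inv (c ^+ 2 / 2); set t := c ^+ 2 in c2 c20 *.
  move=> /(_ ltac:(lra)) h; rewrite lerBlDl (le_trans h)//.
  rewrite -div1r ler_pdivrMr; last lra.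
  nra.
apply/eqP; rewrite eq_le; apply/andP; split.
  apply: (@le_of_eps _ _ 1) => c c0 c1; rewrite add0r mul1r.
  by rewrite -(ler_pM2l c0) -expr2 (le_trans (H c))// H2.
apply: (@le_of_eps _ _ 1) => c c0 c1; rewrite mul1r -lerBlDr sub0r.
have := H (- c); rewrite mulNr sqrrN => h.
by rewrite -(ler_pM2l c0) mulrN lerNl -expr2 (le_trans h)// H2.
Qed.

(** [cosh (c * x)] has mean [expR (c ^+ 2 / 2)]. Comparing terms of order [c ^+ 2], [cosh_ge] gives
    one inequality and [cosh_le], whose remainder has mean at most of order [c ^+ 3], gives the
    other. *)
Lemma E1_sqr : E1 (fun x : R => x ^+ 2) = 1.
Proof.
pose K := E1 (fun x : R => `|x| ^+ 3 / 2 * expR `|x|).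
have tid := @tame_id R.
have tabs := tame_norm tid.
have texpn : tame (fun x : R => expR `|x|) by exact: tame_expn.
have t3 : tame (fun x : R => `|x| ^+ 3 / 2 * expR `|x|).
  by apply: tameM => //; apply: tameM; [exact: tameX|exact: tame_cst].
have Hc c : E1 (fun x : R => (expR (c * x) + expR (- (c * x))) / 2) = expR (c ^+ 2 / 2).
  under [X in E1 X]eq_fun do rewrite mulrC mulrDr -mulNr.
  rewrite E1D ?E1Z ?E1_exp ?sqrrN//; try exact: tame_exp.
  - by field.
  - by apply: tameM; [exact: tame_cst|exact: tame_exp].
  - by apply: tameM; [exact: tame_cst|exact: tame_exp].
have tc c : tame (fun x : R => (expR (c * x) + expR (- (c * x))) / 2).
  under eq_fun do rewrite -mulNr.
  by apply: tameM; [apply: tameD; exact: tame_exp|exact: tame_cst].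
have t2 := tameX 2 tid.
set m := E1 _.
have E2 c : E1 (fun x : R => 1 + c ^+ 2 / 2 * x ^+ 2) = 1 + c ^+ 2 / 2 * m.
  rewrite E1D ?E1_cst ?E1Z//; first exact: tame_cst.
  by apply: tameM => //; exact: tame_cst.
have t2c c : tame (fun x : R => 1 + c ^+ 2 / 2 * x ^+ 2).
  by apply: tameD; [exact: tame_cst|apply: tameM => //; exact: tame_cst].
apply/eqP; rewrite eq_le; apply/andP; split.
  apply: (@le_of_eps _ _ 1) => c c0 c1.
  have c2 : c ^+ 2 < c by rewrite expr2 gtr_pMr.
  have c20 : 0 < c ^+ 2 by rewrite exprn_gt0.
  have : 1 + c ^+ 2 / 2 * m <= expR (c ^+ 2 / 2).
    rewrite -E2 -Hc; apply: E1_le => // x.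
    by have := cosh_ge (c * x); rewrite exprMn; lra.
  have := @expR_le_inv (c ^+ 2 / 2); set t := c ^+ 2 in c2 c20 *.
  move=> /(_ ltac:(lra)) h1 /le_trans/(_ h1).
  rewrite -[leRHS]div1r ler_pdivlMr; last lra.
  have -> : (1 + t / 2 * m) * (1 - t / 2) = 1 + t / 2 * (m * (1 - t / 2) - 1) by ring.
  rewrite gerDl pmulr_rle0; last lra.
  rewrite subr_le0 -ler_pdivlMr; last lra.
  move=> h; rewrite (le_trans h)// ler_pdivrMr; last lra.
  by nra.
apply: (@le_of_eps _ _ (2 * K)) => c c0 c1.
have c20 : 0 < c ^+ 2 by rewrite exprn_gt0.
have : 1 + c ^+ 2 / 2 <= 1 + c ^+ 2 / 2 * m + c ^+ 3 * K.
  rewrite (le_trans (expR_ge1Dx _))// -Hc -E2 /K -E1Z// -E1D//; last exact: tameM (tame_cst _) t3.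
  apply: E1_le => //; first by apply: tameD => //; exact: tameM (tame_cst _) t3.
  move=> x; rewrite (le_trans (cosh_le _))// exprMn -addrA -[leRHS]addrA lerD2l.
  rewrite [_ ^+ 2 * _ / _]mulrAC lerD2l normrM exprMn (ger0_norm (ltW c0)).
  have he : expR (c * `|x|) <= expR `|x| by rewrite ler_expR ler_piMl// ltW.
  have ab : 0 <= c ^+ 3 * `|x| ^+ 3 / 2 by rewrite !mulr_ge0// ltW.
  rewrite [leRHS](_ : _ = c ^+ 3 * `|x| ^+ 3 / 2 * expR `|x|); last by ring.
  exact: ler_wpM2l.
rewrite -addrA lerD2l exprS -mulrA mulrCA => h.
have {}h : c ^+ 2 * (1 / 2) <= c ^+ 2 * (m / 2 + c * K) by lra.
rewrite ler_pM2l// in h.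
by lra.
Qed.

(** Crude (the true value is 3): integrate [pow4_le] at [2 * x]. *)
Lemma E1_pow4 : E1 (fun x : R => x ^+ 4) <= 3 * expR 2.
Proof.
have t4 := tameX 4 (@tame_id R).
have te c : tame (fun x : R => 3 / 2 * expR (c * x)) by apply: tameM; [exact: tame_cst|exact: tame_exp].
have -> : 3 * expR 2 = E1 (fun x : R => 3 / 2 * expR (2 * x) + 3 / 2 * expR (- 2 * x)).
  rewrite E1D// !E1Z; try exact: tame_exp.
  by rewrite !E1_exp sqrrN (_ : 2 ^+ 2 / 2 = 2 :> R); field.
apply: E1_le => //; first exact: tameD.
by move=> x; have := pow4_le (2 * x); rewrite exprMn mulNr; lra.
Qed.

Lemma E1B (f g : R -> R) : tame f -> tame g -> E1 (fun x => f x - g x) = E1 f - E1 g.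
Proof.
move=> tf tg; rewrite -[in RHS]mulN1r -E1Z// -E1D//; last by apply: tameM => //; exact: tame_cst.
by congr E1; apply/funext => x; rewrite mulN1r.
Qed.

Lemma lip_ge0 (C : R) f : lip C f -> 0 <= C.
Proof. by move=> fC; have := le_trans (normr_ge0 _) (fC 1 0); rewrite subr0 normr1 mulr1. Qed.

Lemma lip_affine (C a b : R) f : lip C f -> lip (C * `|a|) (fun x => f (a * x + b)).
Proof.
move=> fC x y; rewrite (le_trans (fC _ _))// -mulrA -normrM.
by rewrite mulrBr opprD addrACA subrr addr0.
Qed.

Lemma E1_dist_le (f g : R -> R) (K : R) : tame f -> tame g ->
  (forall x, `|f x - g x| <= K) -> `|E1 f - E1 g| <= K.
Proof.
move=> tf tg H; rewrite -E1B//.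
have tfg : tame (fun x => f x - g x).
  have := tameD tf (tameM (@tame_cst R (-1)) tg).
  by under eq_fun do rewrite mulN1r.
rewrite (le_trans (E1_norm tfg))// -[leRHS](@E1_cst R) E1_le//; first exact: tame_norm.
exact: tame_cst.
Qed.

Lemma lip_E1_affine (C a b : R) f : lip C f ->
  lip (C * `|b|) (fun y => E1 (fun x => f (a * x + b * y))).
Proof.
move=> fC y y'; apply: E1_dist_le => [||x].
- exact: lip_tame (lip_affine _ _ fC).
- exact: lip_tame (lip_affine _ _ fC).
rewrite (le_trans (fC _ _))// -mulrA -normrM.
by rewrite mulrBr opprD addrACA subrr add0r.
Qed.

Lemma integral_affine_normal (C a c : R) (f : R -> R) : 0 < a ->
  lip C f -> (forall x, 0 <= f x) ->
  (\int[gamma]_x (f (a * x + c))%:E = \int[mu]_u (f u * normal_pdf c a u)%:E)%E.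
Proof.
move=> a0 fC f0.
have cf := lip_continuous fC.
have cfa : continuous (fun x => f (a * x + c)) := lip_continuous (lip_affine a c fC).
rewrite [LHS](@ge0_integral_normal_prob R 0 1 (fun x => (f (a * x + c))%:E) (oner_neq0 R)); first last.
- by move=> x; rewrite lee_fin.
- by apply/measurable_EFinP; exact: continuous_measurable_fun.
under eq_integral do rewrite -EFinM.
pose F := fun u : R => a^-1 * (u - c).
have dF x : is_derive x (1 : R) F a^-1.
  by apply: is_derive_eq; rewrite /GRing.scale /=; ring.
have F' : (F^`())%classic = cst a^-1 by apply/funext => x; rewrite derive1E; have [_ ->] := dF x.
rewrite (@increasing_ge0_integration_by_substitutionT R F); first last.
- by move=> x; rewrite mulr_ge0// normal_pdf_ge0.
- by move=> x; apply: cvgM; [exact: cfa|apply: continuous_normal_pdf; exact: oner_neq0].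
- rewrite /F; apply: gt0_cvgMry; first by rewrite invr_gt0.
  exact: cvg_addrr.
- rewrite /F; apply: gt0_cvgMrNy; first by rewrite invr_gt0.
  exact: cvg_addrr_Ny.
- by move=> x; apply: ex_derive.
- by rewrite F'; exact: is_cvg_cst.
- by rewrite F'; exact: is_cvg_cst.
- by rewrite F' => x; exact: cvg_cst.
- by move=> x y xy; rewrite /F ltr_pM2l ?invr_gt0// ltrD2r.
apply: eq_integral => u _; congr EFin; rewrite F'.
change (f (a * (a^-1 * (u - c)) + c) * normal_pdf 0 1 (a^-1 * (u - c)) * a^-1 =
  f u * normal_pdf c a u).
rewrite [_ * (a^-1 * _)]mulrA divff ?gt_eqF// mul1r subrK -mulrA; congr (_ * _).
rewrite !normal_pdfE ?oner_eq0 ?gt_eqF//= /normal_peak /normal_fun.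
rewrite mulrAC; congr (_ * expR _); last by field; rewrite gt_eqF.
rewrite expr1n mul1r -[a ^+ 2 * pi *+ 2]mulrnAr [Num.sqrt (a ^+ 2 * _)]sqrtrM ?sqr_ge0//.
by rewrite sqrtr_sqr gtr0_norm// invfM mulrC.
Qed.

(** Integrate the joint density of [y] and [u = a x + b y] in the other order: [u] is standard, and
    given [u] the variable [y] is normal with mean [b * u] and deviation [a]. Nonnegativity allows
    Tonelli; signed functions are reached later through [pos] and [neg]. *)
Lemma rot_E1_ge0 (C a b : R) (f : R -> R) : 0 < a -> a ^+ 2 + b ^+ 2 = 1 ->
  lip C f -> (forall x, 0 <= f x) ->
  E1 (fun y => E1 (fun x => f (a * x + b * y))) = E1 f.
Proof.
move=> a0 ab fC f0; apply: EFin_inj.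
have mf : measurable_fun setT f by apply: continuous_measurable_fun; exact: lip_continuous fC.
have lE := lip_E1_affine a b fC.
have mE : measurable_fun setT (fun y => E1 (fun x => f (a * x + b * y))).
  by apply: continuous_measurable_fun; exact: lip_continuous lE.
rewrite -!EFin_E1; [|exact: lip_tame fC|exact: lip_tame lE].
rewrite !ge0_integral_normal_prob ?oner_eq0//.
all: try exact/measurable_EFinP.
all: try by move=> x; rewrite lee_fin Rintegral_ge0.
pose g := fun z : R * R => (f z.1 * normal_pdf 0 1 z.1 * normal_pdf (b * z.1) a z.2)%:E.
have an0 : a != 0 by rewrite gt_eqF.
have swap u y : normal_pdf (b * y) a u * normal_pdf 0 1 y = normal_pdf 0 1 u * normal_pdf (b * u) a y.
  rewrite !normal_pdfE ?oner_eq0//= /normal_fun [LHS]mulrACA [RHS]mulrACA -!expRD.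
  rewrite [normal_peak a * _]mulrC; congr (_ * expR _).
  have key : (u - b * y) ^+ 2 + y ^+ 2 * a ^+ 2 = u ^+ 2 * a ^+ 2 + (y - b * u) ^+ 2.
    apply/eqP; rewrite -subr_eq0.
    rewrite [X in X == _](_ : _ = (y ^+ 2 - u ^+ 2) * (a ^+ 2 + b ^+ 2 - 1)); last by ring.
    by rewrite ab subrr mulr0.
  rewrite !subr0 expr1n.
  transitivity (- ((u - b * y) ^+ 2 + y ^+ 2 * a ^+ 2) / (2 * a ^+ 2)); first by field.
  by rewrite key; field.
transitivity (\int[mu]_y \int[mu]_u g (u, y))%E.
  apply: eq_integral => y _.
  rewrite -EFin_E1; last exact: lip_tame (lip_affine _ _ fC).
  rewrite [X in (X * _)%E](integral_affine_normal (b * y) a0 fC f0) -ge0_integralZr; first last.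
  - by rewrite lee_fin normal_pdf_ge0.
  - by move=> u _; rewrite lee_fin mulr_ge0// normal_pdf_ge0.
  - by apply/measurable_EFinP; apply: measurable_funM => //; exact: measurable_normal_pdf.
  - exact: measurableT.
  by apply: eq_integral => u _; rewrite /g -EFinM /= -!mulrA swap.
have mg : measurable_fun setT g.
  apply/measurable_EFinP; apply: measurable_funM.
    apply: measurable_funM; first exact: measurableT_comp.
    by apply: measurableT_comp => //; exact: measurable_normal_pdf.
  under eq_fun do rewrite normal_pdfE//=.
  apply: measurable_funM => //; apply: measurableT_comp; first exact: measurable_expR.
  apply: measurable_funM => //; apply: measurableT_comp => //.
  apply: measurable_funX; apply: measurable_funB => //.
  exact: measurable_funM.
have g0 z : (0 <= g z)%E by rewrite lee_fin !mulr_ge0 ?normal_pdf_ge0.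
have := @fubini_tonelli _ _ _ _ R mu mu g mg g0.
rewrite /fubini_F /fubini_G => <-.
apply: eq_integral => u _; rewrite /g /=.
under eq_integral do rewrite EFinM.
rewrite ge0_integralZl//; first last.
- by rewrite lee_fin mulr_ge0// normal_pdf_ge0.
- by move=> y _; rewrite lee_fin normal_pdf_ge0.
- by apply/measurable_EFinP; exact: measurable_normal_pdf.
by rewrite integral_normal_pdf mule1 EFinM.
Qed.
End Gauss2.

(** * Gaussian averages of functions that are Lipschitz along lines *)

Section Operators.
Variables (R : realType) (V : lmodType R).
Local Notation gamma := (@normal_prob R 0 1).
Implicit Types (F G : V -> R) (v w y : V) (vs ws : seq V).

(* No norm on [V] is involved: the constant may depend on the direction [v], but
   not on the base point. *)
Definition dirlip F := forall v, exists C : R, forall y (x : R),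
  `|F (y + x *: v) - F y| <= C * `|x|.

Lemma dirlip_line F v : dirlip F -> exists C : R,
  forall y, lip C (fun x : R => F (y + x *: v)).
Proof.
move=> /(_ v)[C FC]; exists C => y x x'.
have -> : y + x *: v = (y + x' *: v) + (x - x') *: v by rewrite scalerBl -addrA [x' *: v + _]addrC subrK.
exact: FC.
Qed.

Lemma dirlip_tame F v y : dirlip F -> tame (fun x : R => F (y + x *: v)).
Proof. by move=> /(dirlip_line v)[C H]; exact: lip_tame (H y). Qed.

Lemma dirlipD F G : dirlip F -> dirlip G -> dirlip (fun y => F y + G y).
Proof.
move=> FL GL v; have [C FC] := FL v; have [D GD] := GL v; exists (C + D) => y x.
rewrite opprD addrACA mulrDl (le_trans (ler_normD _ _))// lerD//.
Qed.

Lemma dirlipZ a F : dirlip F -> dirlip (fun y => a * F y).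
Proof.
move=> FL v; have [C FC] := FL v; exists (`|a| * C) => y x.
by rewrite -mulrBr normrM -mulrA ler_wpM2l.
Qed.

Lemma dirlip_cst a : dirlip (fun=> a).
Proof. by move=> v; exists 0 => y x; rewrite subrr normr0 mul0r. Qed.

Lemma ler_dist_max (a b c d : R) : `|Num.max a b - Num.max c d| <= `|a - c| + `|b - d|.
Proof.
have [ac1 ac2] : a - c <= `|a - c| /\ c - a <= `|a - c| by rewrite ler_norm distrC ler_norm.
have [bd1 bd2] : b - d <= `|b - d| /\ d - b <= `|b - d| by rewrite ler_norm distrC ler_norm.
have p1 := normr_ge0 (a - c); have p2 := normr_ge0 (b - d).
by rewrite ler_norml; case: (leP a b); case: (leP c d) => h1 h2; apply/andP; split; lra.
Qed.

Lemma dirlip_max F G : dirlip F -> dirlip G -> dirlip (fun y => Num.max (F y) (G y)).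
Proof.
move=> FL GL v; have [C FC] := FL v; have [D GD] := GL v; exists (C + D) => y x.
by rewrite (le_trans (ler_dist_max _ _ _ _))// mulrDl lerD.
Qed.

Lemma dirlip_shift F w : dirlip F -> dirlip (fun y => F (y + w)).
Proof.
move=> FL v; have [C FC] := FL v; exists C => y x.
by rewrite addrAC.
Qed.

(* [V] carries no sigma-algebra; this is the measurability that the iterated
   averages need. *)
Definition measV d (T : measurableType d) (Y : T -> V) :=
  forall F, dirlip F -> measurable_fun setT (F \o Y).

Lemma measV_cst d (T : measurableType d) y : measV (fun _ : T => y).
Proof. by move=> F _; exact: measurable_cst. Qed.

(** Round [t] down to a multiple of [1 / (j + 1)]: the rounded variable has countably many values,
    and on each level set [Y] is shifted by a constant vector. The rounding error vanishes in the
    limit because the Lipschitz constant along [v] does not depend on the base point. *)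
Lemma measV_add d (T : measurableType d) (Y : T -> V) (t : T -> R) v :
  measV Y -> measurable_fun setT t -> measV (fun om => Y om + t om *: v).
Proof.
move=> mY mt F FL.
have [C FC] := FL v.
have C0 : 0 <= C by have := le_trans (normr_ge0 _) (FC 0 1); rewrite normr1 mulr1.
pose k (j : nat) (om : T) := Num.floor (j.+1%:R * t om).
pose h (j : nat) om := F (Y om + ((k j om)%:~R / j.+1%:R) *: v).
have mk j (m : int) : measurable [set om | k j om = m].
  have -> : [set om | k j om = m] = (fun om => j.+1%:R * t om) @^-1` `[m%:~R, (m + 1)%:~R[%classic.
    apply/seteqP; split => om /=; rewrite in_itv/=.
      by move=> <-; rewrite /k floor_le_tmp floorD1_gt.
    by move=> h0; exact: floor_def.
  rewrite -[X in measurable X]setTI; apply: measurable_funM => //.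
apply: (@measurable_fun_cvg _ _ _ _ h) => [j|om _].
  move=> _ B mB; rewrite setTI.
  have -> : h j @^-1` B = \bigcup_(m in [set: int])
      ([set om | k j om = m] `&` (fun om => F (Y om + (m%:~R / j.+1%:R) *: v)) @^-1` B).
    apply/seteqP; split => om /=; first by move=> Bw; exists (k j om).
    by move=> [m _ [<-]].
  apply: countable_bigcupT_measurable; first exact: countableP.
  move=> m; apply: measurableI => //; rewrite -[X in measurable X]setTI.
  exact: (mY _ (dirlip_shift _ FL)).
apply/cvgrPdist_le => e e0.
near=> j; rewrite /h /=.
have -> : Y om + t om *: v = (Y om + ((k j om)%:~R / j.+1%:R) *: v)
    + (t om - (k j om)%:~R / j.+1%:R) *: v.
  by rewrite -addrA -scalerDl [X in X *: v]addrC subrK.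
rewrite (le_trans (FC _ _))//.
have jp : 0 < j.+1%:R :> R by rewrite ltr0n.
have : `|t om - (k j om)%:~R / j.+1%:R| <= j.+1%:R^-1.
  rewrite -(ler_pM2l jp) divff ?gt_eqF// -[X in X * _](ger0_norm (ltW jp)) -normrM.
  rewrite mulrBr mulrCA divff ?gt_eqF// mulr1 ler_norml; apply/andP; split.
    by rewrite (@le_trans _ _ 0)// subr_ge0 floor_le_tmp.
  by rewrite lerBlDl ltW// -intrD1 floorD1_gt.
move=> /(ler_wpM2l C0)/le_trans; apply.
rewrite ler_pdivrMr// -ler_pdivrMl//.
have : C / e <= j%:R by near: j; exact: nbhs_infty_ger.
by rewrite mulrC => h1; rewrite (le_trans h1)// ler_nat.
Unshelve. all: by end_near.
Qed.

Definition Q v F : V -> R := fun y => E1 (fun x => F (y + x *: v)).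

Lemma Q_dirlip v F : dirlip F -> dirlip (Q v F).
Proof.
move=> FL w; have [C FC] := FL w; exists C => y x.
apply: E1_dist_le => [||u]; try exact: dirlip_tame.
by rewrite addrAC.
Qed.

Lemma QD v F G : dirlip F -> dirlip G ->
  Q v (fun y => F y + G y) = (fun y => Q v F y + Q v G y).
Proof. by move=> FL GL; apply/funext => y; rewrite /Q E1D//; exact: dirlip_tame. Qed.

Lemma QZ v a F : dirlip F -> Q v (fun y => a * F y) = (fun y => a * Q v F y).
Proof. by move=> FL; apply/funext => y; rewrite /Q E1Z//; exact: dirlip_tame. Qed.

Lemma Q_cst v a : Q v (fun=> a) = (fun=> a).
Proof. by apply/funext => y; rewrite /Q E1_cst. Qed.

Lemma Q_le v F G : dirlip F -> dirlip G -> (forall y, F y <= G y) ->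
  forall y, Q v F y <= Q v G y.
Proof. by move=> FL GL FG y; apply: E1_le => // *; exact: dirlip_tame. Qed.

(** Tonelli, with joint measurability supplied by [measV_add]. *)
Lemma Q_comm_ge0 v w F : dirlip F -> (forall y, 0 <= F y) ->
  Q v (Q w F) = Q w (Q v F).
Proof.
move=> FL F0; apply/funext => y; apply: EFin_inj; rewrite /Q.
rewrite -[LHS]EFin_E1; last exact: (dirlip_tame _ _ (Q_dirlip w FL)).
rewrite -[RHS]EFin_E1; last exact: (dirlip_tame _ _ (Q_dirlip v FL)).
pose g := fun z : R * R => (F (y + z.1 *: v + z.2 *: w))%:E.
have mg : measurable_fun setT g.
  apply/measurable_EFinP.
  have m1 : measV (fun z : R * R => y + z.1 *: v).
    by apply: (@measV_add _ _ (fun=> y)) => //; exact: measV_cst.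
  have m2 : measV (fun z : R * R => y + z.1 *: v + z.2 *: w) by exact: measV_add.
  exact: m2 FL.
have g0 z : (0 <= g z)%E by rewrite lee_fin.
have := @fubini_tonelli _ _ _ _ R gamma gamma g mg g0.
rewrite /fubini_F /fubini_G => h.
transitivity (\int[gamma]_x \int[gamma]_x' g (x, x'))%E.
  by apply: eq_integral => x _; rewrite -EFin_E1//; exact: dirlip_tame.
rewrite h; apply: eq_integral => x _; rewrite -EFin_E1; last exact: dirlip_tame.
by apply: eq_integral => x' _; rewrite /g /= addrAC.
Qed.

Lemma dirlip_opp F : dirlip F -> dirlip (fun y => - F y).
Proof. by move=> /(dirlipZ (-1)); under eq_fun do rewrite mulN1r. Qed.

Definition pos F := fun y => Num.max (F y) 0.
Definition neg F := fun y => Num.max (- F y) 0.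

Lemma pos_neg F : F = fun y => pos F y + (-1) * neg F y.
Proof.
apply/funext => y; rewrite /pos /neg mulN1r.
by case: (ltP (F y) 0) => h; case: (ltP (- F y) 0) => h'; lra.
Qed.

Lemma pos_dirlip F : dirlip F -> dirlip (pos F).
Proof. by move=> FL; apply: dirlip_max => //; exact: dirlip_cst. Qed.

Lemma neg_dirlip F : dirlip F -> dirlip (neg F).
Proof. by move=> FL; apply: dirlip_max (dirlip_opp FL) (dirlip_cst _). Qed.

Lemma pos_ge0 F y : 0 <= pos F y. Proof. by rewrite le_max lexx orbT. Qed.
Lemma neg_ge0 F y : 0 <= neg F y. Proof. by rewrite le_max lexx orbT. Qed.

Lemma Q_pos_neg v F : dirlip F -> Q v F = fun y => Q v (pos F) y + (-1) * Q v (neg F) y.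
Proof.
move=> FL; have pl := pos_dirlip FL; have nl := neg_dirlip FL.
by rewrite {1}[F]pos_neg QD ?QZ//; exact: dirlipZ.
Qed.

Lemma Q_comm v w F : dirlip F -> Q v (Q w F) = Q w (Q v F).
Proof.
move=> FL; have pl := pos_dirlip FL; have nl := neg_dirlip FL.
have H u u' : Q u (Q u' F) = fun y => Q u (Q u' (pos F)) y + (-1) * Q u (Q u' (neg F)) y.
  rewrite [in LHS](Q_pos_neg u' FL) QD ?QZ//; try exact: Q_dirlip.
  by apply: dirlipZ; exact: Q_dirlip.
rewrite !H (Q_comm_ge0 v w pl); last exact: pos_ge0.
by rewrite (Q_comm_ge0 v w nl); last exact: neg_ge0.
Qed.

(** [rot_E1_ge0] for the weights [a / c] and [b / c], applied to positive and negative parts. *)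
Lemma Q_rot (a b c : R) v F : 0 < a -> 0 < c -> a ^+ 2 + b ^+ 2 = c ^+ 2 -> dirlip F ->
  Q (b *: v) (Q (a *: v) F) = Q (c *: v) F.
Proof.
move=> a0 c0 abc.
have ge0 G : dirlip G -> (forall y, 0 <= G y) -> Q (b *: v) (Q (a *: v) G) = Q (c *: v) G.
  move=> GL G0; apply/funext => y; rewrite /Q.
  have [C GC] := dirlip_line (c *: v) GL.
  have c1 : c != 0 by rewrite gt_eqF.
  have ac0 : 0 < a / c by rewrite divr_gt0.
  have ab1 : (a / c) ^+ 2 + (b / c) ^+ 2 = 1.
    by rewrite !exprMn -mulrDl abc exprVn divff// expf_neq0.
  rewrite -(rot_E1_ge0 ac0 ab1 (GC y)); last by move=> x; exact: G0.
  congr E1; apply/funext => x; congr E1; apply/funext => x'.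
  congr G; rewrite -addrA; congr (_ + _); rewrite !scalerA -scalerDl; congr (_ *: _).
  by field.
move=> FL; have pl := pos_dirlip FL; have nl := neg_dirlip FL.
rewrite (Q_pos_neg (c *: v) FL) (Q_pos_neg (a *: v) FL) QD ?QZ//; try exact: Q_dirlip.
  by rewrite !ge0//; [exact: neg_ge0|exact: pos_ge0].
by apply: dirlipZ; exact: Q_dirlip.
Qed.

Lemma iter_Q n (s : R) v F : 0 < s -> dirlip F ->
  iter n.+1 (Q (s *: v)) F = Q ((Num.sqrt n.+1%:R * s) *: v) F.
Proof.
move=> s0 FL; elim: n => [|n IHn]; first by rewrite /= sqrtr1 mul1r.
rewrite iterS IHn Q_comm//.
rewrite (@Q_rot s (Num.sqrt n.+1%:R * s) (Num.sqrt n.+2%:R * s))// ?mulr_gt0 ?sqrtr_gt0//.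
rewrite !exprMn !sqr_sqrtr//.
by rewrite -[X in X + _]mul1r -mulrDl nat1r.
Qed.

(* [Qs vs F y] is the expectation of [F (y + sum_i g_i *: v_i)] for independent
   standard Gaussians [g_i], written as an iterated one-dimensional integral so that
   no product measure is required. *)
Definition Qs vs F : V -> R := foldr Q F vs.

Lemma Qs_dirlip vs F : dirlip F -> dirlip (Qs vs F).
Proof. by move=> FL; elim: vs => //= v vs IH; exact: Q_dirlip. Qed.

Lemma QsD vs F G : dirlip F -> dirlip G ->
  Qs vs (fun y => F y + G y) = (fun y => Qs vs F y + Qs vs G y).
Proof. by move=> FL GL; elim: vs => //= v vs ->; rewrite QD//; exact: Qs_dirlip. Qed.

Lemma QsZ vs a F : dirlip F -> Qs vs (fun y => a * F y) = (fun y => a * Qs vs F y).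
Proof. by move=> FL; elim: vs => //= v vs ->; rewrite QZ//; exact: Qs_dirlip. Qed.

Lemma Qs_cst vs a : Qs vs (fun=> a) = (fun=> a).
Proof. by elim: vs => //= v vs ->; rewrite Q_cst. Qed.

Lemma Qs_le vs F G : dirlip F -> dirlip G -> (forall y, F y <= G y) ->
  forall y, Qs vs F y <= Qs vs G y.
Proof.
move=> FL GL FG; elim: vs => //= v vs IH y.
by apply: Q_le => //; exact: Qs_dirlip.
Qed.

Lemma Qs_comm1 v vs F : dirlip F -> Q v (Qs vs F) = Qs vs (Q v F).
Proof.
by move=> FL; elim: vs => //= w vs IH; rewrite Q_comm ?IH//; exact: Qs_dirlip.
Qed.

Lemma Qs_comm vs ws F : dirlip F -> Qs vs (Qs ws F) = Qs ws (Qs vs F).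
Proof.
move=> FL; elim: vs => //= v vs ->; rewrite -Qs_comm1//; exact: Qs_dirlip.
Qed.

Lemma iter_dirlip n vs F : dirlip F -> dirlip (iter n (Qs vs) F).
Proof. by move=> FL; elim: n => //= n; exact: Qs_dirlip. Qed.

(** One-dimensional averages commute, so the steps along [v] can be collected at the front. *)
Lemma iter_Qs_cons n v vs F : dirlip F ->
  iter n (Qs (v :: vs)) F = iter n (Q v) (iter n (Qs vs) F).
Proof.
move=> FL; elim: n F FL => // n IH F FL.
rewrite !iterSr IH; last by apply: Q_dirlip; exact: Qs_dirlip.
rewrite -(iterSr n (Q v)) iterSr; congr (iter n (Q v) _).
have -> : Qs (v :: vs) F = Q v (Qs vs F) by [].
elim: n {IH} (Qs vs F) (Qs_dirlip vs FL) => // n IH G GL.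
rewrite !iterSr -Qs_comm1// IH//; exact: Qs_dirlip.
Qed.

(* A Gaussian vector is the sum of [n] independent copies of itself scaled by
   [n^(-1/2)]. *)
Lemma Qs_iter n (s : R) vs F : (0 < n)%N -> s = (Num.sqrt n%:R)^-1 -> dirlip F ->
  Qs vs F = iter n (Qs [seq s *: v | v <- vs]) F.
Proof.
case: n => // n _ sE FL.
have s0 : 0 < s by rewrite sE invr_gt0 sqrtr_gt0.
elim: vs => [|v vs IH].
  by rewrite /Qs /=; elim: n {sE} => //= n <-.
rewrite [map _ _]/= iter_Qs_cons// -IH iter_Q//; last exact: Qs_dirlip.
by rewrite sE divff ?scale1r// gt_eqF// sqrtr_gt0.
Qed.

End Operators.

Lemma Qs_comp (R : realType) (U V : lmodType R) (f : {linear U -> V}) (c : V) (F : V -> R)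
    (us : seq U) (y : U) :
  Qs [seq f u | u <- us] F (c + f y) = Qs us (fun y => F (c + f y)) y.
Proof.
elim: us y => //= u us IH y; rewrite /Q; congr E1; apply/funext => x.
by rewrite -IH linearD linearZ addrA.
Qed.

(** * Comparison of Gaussian minima *)

Section Calculus.
Variable R : realType.

Lemma is_derive_sumseq (I : Type) (r : seq I) (h : I -> R -> R) (dh : I -> R) (x : R) :
  (forall a, is_derive x (1 : R) (h a) (dh a)) ->
  is_derive x (1 : R) (fun z => \sum_(a <- r) h a z) (\sum_(a <- r) dh a).
Proof.
move=> H; elim: r => [|a r IH].
  by under eq_fun do rewrite big_nil; rewrite big_nil; exact: is_derive_cst.
under eq_fun do rewrite big_cons.
by rewrite big_cons; exact: is_deriveD.
Qed.

(** Mean value theorem twice: the first-order remainder of [g1] is at most [K * |x| ^+ 2], and it is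
    the derivative of the remainder bounded here. No factorial is gained. *)
Lemma taylor2 (g g1 g2 : R -> R) (K : R) :
  (forall x, is_derive x (1 : R) g (g1 x)) -> (forall x, is_derive x (1 : R) g1 (g2 x)) ->
  lip K g2 ->
  forall x, `|g x - g 0 - x * g1 0 - x ^+ 2 / 2 * g2 0| <= K * `|x| ^+ 3.
Proof.
move=> dg dg1 g2K.
have K0 := lip_ge0 g2K.
have mvt0 (h dh : R -> R) (x B : R) : (forall z, is_derive z (1 : R) h (dh z)) -> h 0 = 0 ->
    (forall z, `|z| <= `|x| -> `|dh z| <= B) -> `|h x| <= B * `|x|.
  move=> hd h0 HB; have [x0|x0|x0] := ltgtP 0 x; last by rewrite -x0 h0 !normr0 mulr0.
    have [c /andP[c0 cx]] := mvt_real x0 hd; rewrite h0 !subr0 => ->.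
    by rewrite normrM ler_wpM2r// HB// !ger0_norm// ltW.
  have [c /andP[c0 cx]] := mvt_real x0 hd; rewrite h0 !sub0r => /eqP.
  rewrite mulrN eqr_opp => /eqP ->.
  by rewrite normrM ler_wpM2r// HB// !ler0_norm ?lerN2 ltW.
pose k (x : R) := g1 x - g1 0 - x * g2 0.
have dk (x : R) : is_derive x (1 : R) k (g2 x - g2 0).
  by have := dg1 x => ?; apply: is_derive_eq; rewrite /GRing.scale /=; ring.
have kb (x : R) : `|k x| <= K * `|x| ^+ 2.
  rewrite expr2 mulrA; apply: (mvt0 _ _ _ _ dk); first by rewrite /k subrr mul0r subr0.
  by move=> z zx; rewrite (le_trans (g2K _ _))// subr0 ler_wpM2l.
pose h (x : R) := g x - g 0 - x * g1 0 - x ^+ 2 / 2 * g2 0.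
have dh (x : R) : is_derive x (1 : R) h (k x).
  by have := dg x => ?; apply: is_derive_eq; rewrite /GRing.scale /k /=; field.
move=> x; rewrite [`|x| ^+ 3]exprSr mulrA; apply: (mvt0 h k x (K * `|x| ^+ 2) dh).
  by rewrite /h expr0n /= !mul0r subrr !subr0.
by move=> z zx; rewrite (le_trans (kb _))// ler_wpM2l// ler_sqr ?nnegrE.
Qed.

Section Gibbs.
Variables (I : finType) (i0 : I).

(** [p] is an energy: [wsum (fun=> 1) p] is the partition function and [gav u p] the Gibbs average
    of [u]. *)
Definition wsum (u p : I -> R) : R := \sum_a u a * expR (- p a).
Definition gav (u p : I -> R) : R := wsum u p / wsum (fun=> 1) p.

Lemma wsum_gt0 p : 0 < wsum (fun=> 1) p.
Proof.
by rewrite /wsum (bigD1 i0)//= mul1r ltr_pwDl ?expR_gt0// sumr_ge0.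
Qed.

Lemma gav_bound u p (U : R) : (forall a, `|u a| <= U) -> `|gav u p| <= U.
Proof.
move=> uU; have w0 := wsum_gt0 p.
rewrite /gav normrM normfV [X in _ / X]gtr0_norm// ler_pdivrMr//.
rewrite /wsum mulr_sumr (le_trans (ler_norm_sum _ _ _))// ler_sum// => a _.
by rewrite normrM mul1r (ger0_norm (expR_ge0 _)) ler_wpM2r ?expR_ge0.
Qed.

Lemma is_derive_wsum (u p q : I -> R) (x : R) :
  is_derive x (1 : R) (fun z => wsum u (fun a => p a + z * q a))
   (- wsum (fun a => u a * q a) (fun a => p a + x * q a)).
Proof.
rewrite /wsum -sumrN; apply: is_derive_sumseq => a.
apply: is_derive_eq; rewrite /GRing.scale /=; ring.
Qed.

Lemma is_derive_wsum1 (p q : I -> R) (x : R) :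
  is_derive x (1 : R) (fun z => wsum (fun=> 1) (fun a => p a + z * q a))
   (- wsum q (fun a => p a + x * q a)).
Proof.
have := is_derive_wsum (fun=> 1) p q x.
by rewrite (_ : (fun a => 1 * q a) = q)//; apply/funext => a; rewrite mul1r.
Qed.

Lemma is_derive_lnwsum (p q : I -> R) (x : R) :
  is_derive x (1 : R) (fun z => - ln (wsum (fun=> 1) (fun a => p a + z * q a)))
   (gav q (fun a => p a + x * q a)).
Proof.
have d := is_derive_wsum1 p q x.
have w0 := wsum_gt0 (fun a => p a + x * q a).
have dl := is_derive1_ln w0.
have := is_derive1_comp dl d => dd.
apply: is_derive_eq.
by rewrite /gav mulrN opprK mulrC.
Qed.

(** Quotient rule; the bracket is the covariance of [u] and [q] under the Gibbs weights. *)
Lemma is_derive_gav (u p q : I -> R) (x : R) :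
  is_derive x (1 : R) (fun z => gav u (fun a => p a + z * q a))
   (- (gav (fun a => u a * q a) (fun a => p a + x * q a) -
      gav u (fun a => p a + x * q a) * gav q (fun a => p a + x * q a))).
Proof.
have d := is_derive_wsum1 p q x.
have d1 := is_derive_wsum u p q x.
have w0 : wsum (fun=> 1) (fun a => p a + x * q a) != 0 by rewrite gt_eqF// wsum_gt0.
have dV := is_deriveV w0 d.
rewrite /gav; have := is_deriveM d1 dV => dd.
apply: is_derive_eq.
by rewrite /GRing.scale /=; field.
Qed.

Lemma gav_lip (u p q : I -> R) (U W : R) :
  (forall a, `|u a| <= U) -> (forall a, `|q a| <= W) ->
  lip (2 * (U * W)) (fun x => gav u (fun a => p a + x * q a)).
Proof.
move=> uU qW; have U0 : 0 <= U := le_trans (normr_ge0 _) (uU i0).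
apply: (mvt_lip (is_derive_gav u p q)) => x.
rewrite normrN (le_trans (ler_normB _ _))// mulr2n mulrDl mul1r lerD//.
  by apply: gav_bound => a; rewrite normrM ler_pM.
by rewrite normrM ler_pM// gav_bound.
Qed.

(** A variance is half the mean squared difference of two independent copies. *)
Lemma gav_var (q p : I -> R) : gav (fun a => q a ^+ 2) p - gav q p ^+ 2 =
  2^-1 * \sum_a \sum_b expR (- p a) / wsum (fun=> 1) p * (expR (- p b) / wsum (fun=> 1) p)
    * (q a - q b) ^+ 2.
Proof.
have w0 : wsum (fun=> 1) p != 0 by rewrite gt_eqF// wsum_gt0.
pose e a := expR (- p a) / wsum (fun=> 1) p.
have e1 : \sum_a e a = 1.
  rewrite -mulr_suml -[RHS](divff w0); congr (_ / _).
  by apply: eq_bigr => a _; rewrite mul1r.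
have ge u : gav u p = \sum_a e a * u a.
  rewrite /gav /wsum mulr_suml; apply: eq_bigr => a _.
  by rewrite /e mulrC mulrCA mulrC; congr (_ * _); rewrite mulrC.
have -> : \sum_a \sum_b e a * e b * (q a - q b) ^+ 2 =
    \sum_a \sum_b (e a * q a ^+ 2 * e b - 2 * (e a * q a * (e b * q b)) + e a * (e b * q b ^+ 2)).
  by apply: eq_bigr => a _; apply: eq_bigr => b _; ring.
under eq_bigr => a _ do rewrite big_split sumrB /= -!mulr_sumr e1 -!ge mulr1.
rewrite big_split sumrB /= -!mulr_sumr -!mulr_suml -!ge. rewrite [X in _ + X * _]mulr_suml [X in _ + X * _](_ : _ = 1); last exact: e1.
by field.
Qed.

End Gibbs.
End Calculus.

(** * Comparison of Gaussian averages by Lindeberg replacement *)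

Section Lindeberg.
Variables (R : realType) (V : lmodType R).
Implicit Types (F G : V -> R) (D : V -> V -> R) (v w y : V) (vs ws : seq V).

(* [D v] plays the role of the second derivative of [F] in the direction [v]. *)
Definition taylorQ F D := [/\ dirlip F, forall v, dirlip (D v) &
  forall v, exists K : R, forall y, exists f1 : R, forall x : R,
    `|F (y + x *: v) - F y - x * f1 - x ^+ 2 / 2 * D v y| <= K * `|x| ^+ 3].

(** The linear term averages to 0 by [E1_id], so the slope [f1], which varies with [y], drops out;
    the quadratic term is evaluated by [E1_sqr]. *)
Lemma Q_one F D v : taylorQ F D -> exists K : R, forall (s : R) y,
  `|Q (s *: v) F y - F y - s ^+ 2 / 2 * D v y| <= K * `|s| ^+ 3.
Proof.
move=> [FL DL FT]; have [K HK] := FT v.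
exists (K * E1 (fun x : R => `|x| ^+ 3)) => s y.
have [f1 Hf] := HK y.
have tid := @tame_id R; have tc := @tame_cst R.
have t1 : tame (fun x : R => s * f1 * x) by exact: tameM.
have t2 : tame (fun x : R => s ^+ 2 / 2 * D v y * x ^+ 2) by apply: tameM => //; exact: tameX.
have tF : tame (fun x : R => F (y + x *: (s *: v))) by exact: dirlip_tame.
have t3 : tame (fun x : R => F y + s * f1 * x + s ^+ 2 / 2 * D v y * x ^+ 2).
  by apply: tameD => //; apply: tameD.
have tK : tame (fun x : R => K * `|s| ^+ 3 * `|x| ^+ 3).
  by apply: tameM => //; apply: tameX; exact: tame_norm.
have tN : tame (fun x : R => F (y + x *: (s *: v)) -
    (F y + s * f1 * x + s ^+ 2 / 2 * D v y * x ^+ 2)).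
  have := tameD tF (tameM (tc (-1)) t3).
  by under eq_fun do rewrite mulN1r.
have -> : F y = E1 (fun x : R => F y + s * f1 * x + s ^+ 2 / 2 * D v y * x ^+ 2)
    - s ^+ 2 / 2 * D v y.
  rewrite E1D//; last by apply: tameD.
  rewrite E1D// E1_cst !E1Z//; last by apply: tameX.
  by rewrite E1_id E1_sqr; ring.
rewrite [X in `|X|](_ : _ = Q (s *: v) F y -
  E1 (fun x : R => F y + s * f1 * x + s ^+ 2 / 2 * D v y * x ^+ 2)); last by ring.
rewrite /Q -E1B// (le_trans (E1_norm tN))// [leRHS]mulrAC -[leRHS]E1Z; last first.
  by apply: tameX; exact: tame_norm.
apply: E1_le => //; first exact: tame_norm.
move=> x; rewrite [leRHS](_ : _ = K * `|x * s| ^+ 3); last by rewrite normrM exprMn; ring.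
rewrite scalerA;
rewrite (le_trans _ (Hf (x * s)))//.
rewrite le_eqVlt; apply/orP; left; apply/eqP; congr (`|_|).
by rewrite exprMn; ring.
Qed.

(** Adding one direction [v]: averaging along [s *: v] moves the second-order term of the other
    directions by only [O(s)], and that term already carries [s ^+ 2]. *)
Lemma Qs_one F D vs : taylorQ F D -> exists K : R, forall (s : R) y, 0 <= s -> s <= 1 ->
  `|Qs [seq s *: v | v <- vs] F y - F y - s ^+ 2 / 2 * \sum_(v <- vs) D v y| <= K * s ^+ 3.
Proof.
move=> T; have [FL DL _] := T.
elim: vs => [|v vs [K HK]].
  exists 0 => s y s0 s1; rewrite /= big_nil mulr0 subrr subr0 normr0 mul0r//.
have [K1 HK1] := Q_one v T.
have sumL : dirlip (fun y => \sum_(w <- vs) D w y).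
  elim: vs {HK} => [|w vs IH].
    by under eq_fun do rewrite big_nil; exact: dirlip_cst.
  by under eq_fun do rewrite big_cons; apply: dirlipD.
have [C HC] := sumL v.
pose m1 := E1 (fun x : R => `|x|).
exists (K + K1 + C * m1) => s y s0 s1; rewrite [map _ _]/= big_cons.
rewrite [Qs _ F]/= -/(Qs _ F); set G := Qs _ F.
pose S := fun y => \sum_(w <- vs) D w y.
pose H := fun y => F y + s ^+ 2 / 2 * S y.
have HL : dirlip H by apply: dirlipD => //; exact: dirlipZ.
have GL : dirlip G by exact: Qs_dirlip.
have e1 : `|Q (s *: v) G y - Q (s *: v) H y| <= K * s ^+ 3.
  apply: E1_dist_le => [||x]; try exact: dirlip_tame.
  by rewrite /H opprD addrA; exact: HK.
have e2 := HK1 s y; rewrite (ger0_norm s0) in e2.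
have e3 : `|Q (s *: v) S y - S y| <= C * s * m1.
  rewrite /Q -[X in _ - X](@E1_cst R) -E1B; [|exact: dirlip_tame|exact: tame_cst].
  have tn : tame (fun x : R => S (y + x *: (s *: v)) - S y).
    have := tameD (dirlip_tame (s *: v) y sumL) (@tame_cst R (- S y)).
    by [].
  rewrite (le_trans (E1_norm tn))// -E1Z; last exact: tame_norm (@tame_id R).
  apply: E1_le; first exact: tame_norm.
    by apply: tameM; [exact: tame_cst|exact: tame_norm (@tame_id R)].
  by move=> x; rewrite scalerA (le_trans (HC _ _))// normrM (ger0_norm s0) mulrAC mulrA lexx.
have QH : Q (s *: v) H y = Q (s *: v) F y + s ^+ 2 / 2 * Q (s *: v) S y.
  by rewrite /H QD ?QZ//; exact: dirlipZ.
rewrite QH in e1.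
rewrite [X in `|X|](_ : _ = (Q (s *: v) G y - (Q (s *: v) F y + s ^+ 2 / 2 * Q (s *: v) S y))
  + (Q (s *: v) F y - F y - s ^+ 2 / 2 * D v y) + s ^+ 2 / 2 * (Q (s *: v) S y - S y)); last first.
  by rewrite /S; ring.
rewrite (le_trans (ler_normD _ _))// (le_trans (lerD (ler_normD _ _) (lexx _)))//.
rewrite !mulrDl; apply: lerD; first exact: lerD.
rewrite normrM ger0_norm ?divr_ge0 ?sqr_ge0//.
have s2 : 0 <= s ^+ 2 / 2 by rewrite divr_ge0 ?sqr_ge0.
rewrite (le_trans (ler_wpM2l s2 e3))//.
have p0 : 0 <= C * s * m1 by apply: le_trans e3.
have -> : s ^+ 2 / 2 * (C * s * m1) = C * m1 * s ^+ 3 / 2 by field.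
have : 0 <= C * m1 * s ^+ 3 by rewrite (_ : _ * s ^+ 3 = C * s * m1 * s ^+ 2); [rewrite mulr_ge0// sqr_ge0|ring].
by lra.
Qed.

(* Cut both Gaussian vectors into [n] independent steps of size [n^(-1/2)] and swap
   the steps one at a time: each swap has the right sign up to [O(n^(-3/2))]. *)
Lemma lindeberg F D vs ws : taylorQ F D ->
  (forall y, \sum_(w <- ws) D w y <= \sum_(v <- vs) D v y) ->
  forall y, Qs ws F y <= Qs vs F y.
Proof.
move=> T HD y; have [FL DL _] := T.
have [K1 HK1] := Qs_one vs T; have [K2 HK2] := Qs_one ws T.
apply: (@le_of_eps _ _ _ ((K1 + K2) * 1)) => e e0 e1.
(* The [n] swaps cost [(K1 + K2) * s ^+ 3] each, in total [(K1 + K2) * s] as [n * s ^+ 2 = 1]; this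
   [n] makes [s <= e]. *)
pose n := (Num.truncn (e ^- 2)).+1.
pose s : R := (Num.sqrt n%:R)^-1.
have s0 : 0 < s by rewrite invr_gt0 sqrtr_gt0 ltr0n.
have ns2 : n%:R * s ^+ 2 = 1 :> R.
  by rewrite exprVn sqr_sqrtr ?ler0n// divff// pnatr_eq0.
have se : s <= e.
  rewrite -ler_sqr ?nnegrE ?(ltW s0) ?(ltW e0)//.
  rewrite -[e ^+ 2]invrK exprVn sqr_sqrtr ?ler0n// lef_pV2 ?posrE ?invr_gt0 ?exprn_gt0 ?ltr0n//.
  by rewrite ltW// truncnS_gt.
have s1 : s <= 1 by rewrite (le_trans se)// ltW.
rewrite (@Qs_iter R V n s ws)// (@Qs_iter R V n s vs)//.
set A := Qs [seq s *: v | v <- vs]; set B := Qs [seq s *: v | v <- ws].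
pose d := (K1 + K2) * s ^+ 3.
have AB x : B F x <= A F x + d.
  have := HK1 s x (ltW s0) s1; have := HK2 s x (ltW s0) s1.
  rewrite -/A -/B !ler_norml => /andP[_ h1] /andP[h2 _].
  have h3 := HD x; have s20 : 0 <= s ^+ 2 / 2 by rewrite divr_ge0 ?sqr_ge0.
  have := ler_wpM2l s20 h3; rewrite /d mulrDl.
  by move: h1 h2; set X := \sum_(w <- ws) _; set Y := \sum_(v <- vs) _; lra.
have itL j : dirlip (iter j A F) by exact: iter_dirlip.
have main j : forall x, iter j B F x <= iter j A F x + d *+ j.
  elim: j => [|j IH] x; first by rewrite mulr0n addr0.
  rewrite !iterS.
  have L1 : dirlip (fun y => iter j A F y + d *+ j) by apply: dirlipD => //; exact: dirlip_cst.
  have := @Qs_le _ _ [seq s *: v | v <- ws] _ _ (iter_dirlip j [seq s *: v | v <- ws] FL) L1 IH x.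
  rewrite -/B => /le_trans; apply.
  rewrite /B QsD//; last exact: dirlip_cst.
  rewrite Qs_cst mulrSr [leRHS]addrA [leRHS]addrAC lerD2r.
  (* Commuting [B] past the [A] steps lets the one-step comparison act on [F] itself, the function
     whose expansion is known. *)
  have -> : Qs [seq s *: v | v <- ws] (iter j A F) = iter j A (B F).
    elim: (j) => //= k <-; rewrite /A Qs_comm//; exact: iter_dirlip.
  have -> : A (iter j A F) = iter j A (A F) by rewrite -iterS -iterSr.
  elim: (j) x => [|k IHk] x; first exact: AB.
  rewrite !iterS.
  have BFL : dirlip (B F) by exact: Qs_dirlip.
  have AFL : dirlip (A F) by exact: Qs_dirlip.
  have L2 : dirlip (fun y => iter k A (A F) y + d).
    by apply: dirlipD; [exact: iter_dirlip|exact: dirlip_cst].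
  have := @Qs_le _ _ [seq s *: v | v <- vs] _ _ (iter_dirlip k [seq s *: v | v <- vs] BFL) L2 IHk x.
  rewrite QsD ?Qs_cst//; first exact: iter_dirlip.
  exact: dirlip_cst.
rewrite (le_trans (main n y))// lerD2l -mulr_natl /d mulr1.
rewrite [leLHS](_ : _ = (K1 + K2) * s * (n%:R * s ^+ 2)); last by ring.
rewrite ns2 mulr1 ler_wpM2l//.
have := HK1 1 y ler01 (lexx _); have := HK2 1 y ler01 (lexx _).
move=> h2 h1; rewrite !expr1n !mulr1 in h1 h2.
by rewrite addr_ge0//; [exact: le_trans h1|exact: le_trans h2].
Qed.
End Lindeberg.

(** * Minima over a finite index set and their smoothing *)

Section MinComparison.
Variables (R : realType) (I : finType) (i0 : I).

(** The fold starts at [f i0], one of the values, so it is the minimum over all of [I]. *)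
Definition minI (f : I -> R) : R := \big[Num.min/f i0]_a f a.

Lemma minI_le f a : minI f <= f a.
Proof. by rewrite /minI (bigD1 a)//= ge_min lexx. Qed.

Lemma le_minI f t : (forall a, t <= f a) -> t <= minI f.
Proof.
by move=> tf; rewrite /minI; elim/big_ind: _ => // x y tx ty; rewrite le_min tx.
Qed.

Lemma minI_ex f : exists a, minI f = f a.
Proof.
rewrite /minI; elim/big_ind: _ => [|x y [a ->] [b ->]|a _]; [by exists i0| |by exists a].
by rewrite /Num.min; case: ifP => _; [exists a|exists b].
Qed.

Lemma minI_dist f g (e : R) : (forall a, `|f a - g a| <= e) -> `|minI f - minI g| <= e.
Proof.
move=> fg.
have H (f' g' : I -> R) : (forall a, `|f' a - g' a| <= e) -> minI f' - minI g' <= e.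
  move=> h; have [a ->] := minI_ex g'.
  by rewrite (le_trans (lerB (minI_le f' a) (lexx _)))// (le_trans (ler_norm _)).
rewrite ler_norml H// andbT lerNl opprB H// => a.
by rewrite distrC.
Qed.

Lemma minI_scale (t : R) f : 0 <= t -> minI (fun a => t * f a) = t * minI f.
Proof.
move=> t0; apply/eqP; rewrite eq_le; apply/andP; split.
  by have [a ->] := minI_ex f; exact: minI_le.
by apply: le_minI => a; rewrite ler_wpM2l// minI_le.
Qed.

(* Smooth surrogate of [minI], with error at most [ln #|I|]; its second derivative
   is minus a variance under the Gibbs weights, hence depends only on squared
   increments (see [gav_var]). *)
Definition softmin (f : I -> R) : R := - ln (wsum (fun=> 1) f).

Lemma softmin_le f : softmin f <= minI f.
Proof.
apply: le_minI => a; rewrite /softmin lerNl -[leLHS]expRK ler_ln ?posrE ?expR_gt0 ?(wsum_gt0 i0)//.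
by rewrite /wsum (bigD1 a)//= mul1r lerDl sumr_ge0.
Qed.

Lemma le_softmin f : minI f <= softmin f + ln #|I|%:R.
Proof.
have c0 : 0 < #|I|%:R :> R by rewrite ltr0n; apply/card_gt0P; exists i0.
rewrite /softmin addrC lerBrDr -lerBrDl.
rewrite -[X in _ <= _ + X]expRK -lnM ?posrE ?expR_gt0// ler_ln ?posrE ?(wsum_gt0 i0) ?mulr_gt0 ?expR_gt0//.
rewrite /wsum mulr_natl -[#|I|]/(#|xpredT : {pred I}|) -sumr_const ler_sum// => a _.
by rewrite mul1r ler_expR lerN2 minI_le.
Qed.

Variable V : lmodType R.
Variables (phi l : I -> V -> R).
Hypothesis phiE : forall a y x v, phi a (y + x *: v) = phi a y + x * l a v.

Lemma minI_dirlip : dirlip (fun y => minI (phi^~ y)).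
Proof.
move=> v; exists (\sum_a `|l a v|) => y x; apply: minI_dist => a.
rewrite phiE addrAC subrr add0r normrM mulrC ler_wpM2r//.
by rewrite (bigD1 a)//= lerDl sumr_ge0.
Qed.

Let W v := \sum_a `|l a v|.
Let lW v a : `|l a v| <= W v.
Proof. by rewrite /W (bigD1 a)//= lerDl sumr_ge0. Qed.

Lemma gav_dirlip u : dirlip (fun y => gav u (phi^~ y)).
Proof.
move=> v; exists (2 * ((\sum_a `|u a|) * W v)) => y x.
have uU a : `|u a| <= \sum_a `|u a| by rewrite (bigD1 a)//= lerDl sumr_ge0.
have := @gav_lip R I i0 u (phi^~ y) (l^~ v) _ _ uU (lW v) x 0.
have e0 x' : (fun a => phi a y + x' * l a v) = phi^~ (y + x' *: v).
  by apply/funext => a; rewrite phiE.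
by rewrite subr0 !e0 scale0r addr0.
Qed.

(** Second derivative of [softmin] along [v]: minus the Gibbs variance of the slopes [l a v]. *)
Definition negvar v y := - (gav (fun a => l a v ^+ 2) (phi^~ y) - gav (l^~ v) (phi^~ y) ^+ 2).

(** A Lipschitz constant uniform in the base point survives a product when both factors are bounded,
    as Gibbs averages are. *)
Lemma dirlipM_bound (F G : V -> R) (A B : R) : (forall y, `|F y| <= A) -> (forall y, `|G y| <= B) ->
  dirlip F -> dirlip G -> dirlip (fun y => F y * G y).
Proof.
move=> FA GB FL GL v; have [C FC] := FL v; have [D GD] := GL v.
exists (B * C + A * D) => y x.
rewrite (_ : _ - _ = G (y + x *: v) * (F (y + x *: v) - F y) + F y * (G (y + x *: v) - G y)); last by ring.
rewrite (le_trans (ler_normD _ _))// !normrM mulrDl -!mulrA lerD//.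
  by rewrite ler_pM.
by rewrite ler_pM.
Qed.

Lemma negvar_dirlip v : dirlip (negvar v).
Proof.
apply: dirlip_opp; apply: dirlipD; first exact: gav_dirlip.
apply: dirlip_opp; under eq_fun do rewrite expr2.
by apply: dirlipM_bound; try exact: gav_dirlip; move=> y; exact: (gav_bound i0 _ (lW v)).
Qed.

Lemma softmin_taylor : taylorQ (fun y => softmin (phi^~ y)) negvar.
Proof.
have phil y v x : (fun a => phi a y + x * l a v) = phi^~ (y + x *: v).
  by apply/funext => a; rewrite phiE.
have d1 y v x : is_derive x (1 : R) (fun z => softmin (phi^~ (y + z *: v)))
    (gav (l^~ v) (phi^~ (y + x *: v))).
  have := is_derive_lnwsum i0 (phi^~ y) (l^~ v) x.
  by rewrite phil; under eq_fun do rewrite phil.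
have d2 y v x : is_derive x (1 : R) (fun z => gav (l^~ v) (phi^~ (y + z *: v)))
    (negvar v (y + x *: v)).
  have := is_derive_gav i0 (l^~ v) (phi^~ y) (l^~ v) x.
  by rewrite phil; under eq_fun do rewrite phil.
split.
- move=> v; exists (W v) => y x.
  have := mvt_lip (d1 y v) (K := W v) (fun x => gav_bound i0 _ (lW v)) x 0.
  by rewrite scale0r addr0 subr0.
- exact: negvar_dirlip.
move=> v; have [K HK] := dirlip_line v (negvar_dirlip v).
exists K => y; exists (gav (l^~ v) (phi^~ y)) => x.
by have := taylor2 (d1 y v) (d2 y v) (HK y) x; rewrite !scale0r !addr0.
Qed.

End MinComparison.

Section Sudakov.
Variables (R : realType) (I : finType) (i0 : I).

(** By [gav_var] both sides of the hypothesis of [lindeberg] become sums over [a], [b] of squared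
    increments with the same nonnegative Gibbs weights, which depend on [y] but not on the
    directions. *)
Lemma softmin_comparison (V : lmodType R) (phi l : I -> V -> R) (vs ws : seq V) y :
  (forall a y x v, phi a (y + x *: v) = phi a y + x * l a v) ->
  (forall a b, \sum_(v <- vs) (l a v - l b v) ^+ 2 <= \sum_(w <- ws) (l a w - l b w) ^+ 2) ->
  Qs ws (fun y => softmin (phi^~ y)) y <= Qs vs (fun y => softmin (phi^~ y)) y.
Proof.
move=> phiE H; apply: lindeberg (softmin_taylor i0 phiE) _ _ => {}y.
rewrite /negvar !sumrN lerN2.
under eq_bigr do rewrite (gav_var i0); under [leRHS]eq_bigr do rewrite (gav_var i0).
rewrite -!mulr_sumr ler_wpM2l ?invr_ge0//.
rewrite exchange_big [leRHS]exchange_big; apply: ler_sum => a _ /=.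
rewrite exchange_big [leRHS]exchange_big; apply: ler_sum => b _ /=.
rewrite -!mulr_sumr ler_wpM2l//.
by rewrite mulr_ge0// divr_ge0// ?expR_ge0// ltW// (wsum_gt0 i0).
Qed.

(** Rescaling the process by [t = e^-1] and dividing by [t] afterwards reduces the smoothing error
    [ln #|I|] to [e * ln #|I|]. *)
Lemma min_comparison (V : lmodType R) (phi l : I -> V -> R) (vs ws : seq V) y :
  (forall a y x v, phi a (y + x *: v) = phi a y + x * l a v) ->
  (forall a b, \sum_(v <- vs) (l a v - l b v) ^+ 2 <= \sum_(w <- ws) (l a w - l b w) ^+ 2) ->
  Qs ws (fun y => minI i0 (phi^~ y)) y <= Qs vs (fun y => minI i0 (phi^~ y)) y.
Proof.
move=> phiE H; apply: (@le_of_eps _ _ _ (ln #|I|%:R)) => e e0 e1.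
pose t := e^-1; have t0 : 0 < t by rewrite invr_gt0.
pose tphi a y := t * phi a y; pose tl a v := t * l a v.
have tphiE a z x v : tphi a (z + x *: v) = tphi a z + x * tl a v.
  by rewrite /tphi phiE mulrDr /tl mulrCA.
have tH a b : \sum_(v <- vs) (tl a v - tl b v) ^+ 2 <= \sum_(w <- ws) (tl a w - tl b w) ^+ 2.
  under eq_bigr do rewrite -mulrBr exprMn; under [leRHS]eq_bigr do rewrite -mulrBr exprMn.
  by rewrite -!mulr_sumr ler_wpM2l// sqr_ge0.
have := softmin_comparison y tphiE tH.
have sL : dirlip (fun y => softmin (tphi^~ y)) by have [] := softmin_taylor i0 tphiE.
have mL := minI_dirlip i0 phiE.
have tmL : dirlip (fun y => t * minI i0 (phi^~ y)) by exact: dirlipZ.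
have h1 : t * Qs ws (fun y => minI i0 (phi^~ y)) y <=
    Qs ws (fun y => softmin (tphi^~ y)) y + ln #|I|%:R.
  have cL := @dirlip_cst R V (ln #|I|%:R).
  rewrite -[X in X <= _]/((fun y => t * Qs ws _ y) y) -QsZ//.
  rewrite -[X in _ <= _ + X](congr1 (@^~ y) (Qs_cst ws (ln #|I|%:R))).
  rewrite -[leRHS]/((fun y => _ + _) y) -QsD//.
  apply: Qs_le => //; first exact: dirlipD.
  by move=> z; rewrite -minI_scale ?(ltW t0)//; exact: le_softmin.
have h2 : Qs vs (fun y => softmin (tphi^~ y)) y <= t * Qs vs (fun y => minI i0 (phi^~ y)) y.
  rewrite -[leRHS]/((fun y => t * Qs vs _ y) y) -QsZ//.
  apply: Qs_le => // z.
  by rewrite -minI_scale ?(ltW t0)//; exact: softmin_le.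
move=> h3; rewrite -(ler_pM2l t0) mulrDr (le_trans h1)//.
rewrite mulrCA /t mulVf ?gt_eqF// mulr1 lerD2r.
exact: le_trans h3 h2.
Qed.

(** Both processes are put on [V1 * V2] with the form [l1 a + l2 a]; [vs] is embedded in the first
    factor and [ws] in the second, so that they see [l1] and [l2] respectively. *)
Lemma sudakov_fernique (V1 V2 : lmodType R) (c : I -> R)
    (l1 : I -> {linear V1 -> R^o}) (l2 : I -> {linear V2 -> R^o}) (vs : seq V1) (ws : seq V2) :
  (forall a b, \sum_(v <- vs) (l1 a v - l1 b v) ^+ 2 <= \sum_(w <- ws) (l2 a w - l2 b w) ^+ 2) ->
  Qs ws (fun y => minI i0 (fun a => c a + l2 a y)) 0 <= Qs vs (fun y => minI i0 (fun a => c a + l1 a y)) 0.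
Proof.
move=> H.
pose i1 (v : V1) : V1 * V2 := (v, 0); pose i2 (v : V2) : V1 * V2 := (0, v).
have i1l : linear i1 by move=> k u v; rewrite /i1; congr (_, _); rewrite /= scaler0 addr0.
have i2l : linear i2 by move=> k u v; rewrite /i2; congr (_, _); rewrite /= scaler0 addr0.
pose f1 : {linear V1 -> (V1 * V2)%type} := HB.pack i1 (GRing.isLinear.Build _ _ _ _ i1 i1l).
pose f2 : {linear V2 -> (V1 * V2)%type} := HB.pack i2 (GRing.isLinear.Build _ _ _ _ i2 i2l).
pose l a (y : V1 * V2) : R := l1 a y.1 + l2 a y.2.
pose phi a y := c a + l a y.
have phiE a y x v : phi a (y + x *: v) = phi a y + x * l a v.
  by rewrite /phi /l /= !linearD !linearZ /= /GRing.scale /=; ring.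
have e1 : Qs vs (fun y => minI i0 (fun a => c a + l1 a y)) 0 =
    Qs [seq f1 v | v <- vs] (fun y => minI i0 (phi^~ y)) (0 + f1 0).
  rewrite Qs_comp; congr (Qs vs _ 0); apply/funext => y; congr (minI i0).
  by apply/funext => a; rewrite add0r /phi /l /= linear0 addr0.
have e2 : Qs ws (fun y => minI i0 (fun a => c a + l2 a y)) 0 =
    Qs [seq f2 v | v <- ws] (fun y => minI i0 (phi^~ y)) (0 + f2 0).
  rewrite Qs_comp; congr (Qs ws _ 0); apply/funext => y; congr (minI i0).
  by apply/funext => a; rewrite add0r /phi /l /= linear0 add0r.
rewrite e1 e2 !linear0; apply: min_comparison phiE _ => a b.
rewrite !big_map.
rewrite (eq_bigr (fun v => (l1 a v - l1 b v) ^+ 2)); last first.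
  by move=> v _; rewrite /l /= !linear0 !addr0.
rewrite [leRHS](eq_bigr (fun v => (l2 a v - l2 b v) ^+ 2))//.
by move=> v _; rewrite /l /= !linear0 !add0r.
Qed.
End Sudakov.

(** * Standard Gaussian vectors indexed by a finite type, and nets on spheres *)

Section Coordinates.
Variables (R : realType).

Section Space.
Variable X : finType.
Local Notation V := {ffun X -> R^o}.

Definition ebase (x : X) : V := [ffun z => (z == x)%:R].

Definition lform (al : X -> R) (y : V) : R^o := \sum_x al x * y x.

Lemma lform_is_linear al : linear (lform al).
Proof.
move=> k u v; rewrite /lform scaler_sumr -big_split; apply: eq_bigr => x _.
by rewrite !ffunE /GRing.scale /=; ring.
Qed.

HB.instance Definition _ al := GRing.isLinear.Build R V R^o _ (lform al) (lform_is_linear al).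

Lemma lform_base al x : lform al (ebase x) = al x.
Proof.
rewrite /lform (bigD1 x)//= ffunE eqxx mulr1 big1 ?addr0// => z zx.
by rewrite ffunE (negbTE zx) mulr0.
Qed.

(** Mean of [F] at a standard Gaussian vector of dimension [#|X|]. *)
Definition Ex (F : V -> R) : R := Qs [seq ebase x | x <- index_enum X] F 0.

Lemma Ex_le F G : dirlip F -> dirlip G -> (forall y, F y <= G y) -> Ex F <= Ex G.
Proof. by move=> FL GL FG; exact: Qs_le. Qed.

Lemma ExD F G : dirlip F -> dirlip G -> Ex (fun y => F y + G y) = Ex F + Ex G.
Proof. by move=> FL GL; rewrite /Ex QsD. Qed.

Lemma ExZ a F : dirlip F -> Ex (fun y => a * F y) = a * Ex F.
Proof. by move=> FL; rewrite /Ex QsZ. Qed.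

Lemma Ex_cst a : Ex (fun=> a) = a.
Proof. by rewrite /Ex Qs_cst. Qed.

Lemma min_lform_dirlip (I : finType) (i0 : I) (c : I -> R) (al : I -> X -> R) :
  dirlip (fun y => minI i0 (fun a => c a + lform (al a) y)).
Proof.
apply: (@minI_dirlip _ _ i0 _ (fun a y => c a + lform (al a) y) (fun a => lform (al a))).
by move=> a y x v; rewrite linearD linearZ addrA.
Qed.
End Space.

Lemma Ex_comparison (I X Y : finType) (i0 : I) (c : I -> R) (al : I -> X -> R) (be : I -> Y -> R) :
  (forall a b, \sum_x (al a x - al b x) ^+ 2 <= \sum_y (be a y - be b y) ^+ 2) ->
  Ex (fun y => minI i0 (fun a => c a + lform (be a) y)) <=
  Ex (fun x => minI i0 (fun a => c a + lform (al a) x)).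
Proof.
move=> H; apply: (sudakov_fernique i0 c (l1 := fun a => lform (al a)) (l2 := fun a => lform (be a))) => a b.
rewrite !big_map.
under eq_bigr do rewrite /= !lform_base; under [leRHS]eq_bigr do rewrite /= !lform_base.
exact: H.
Qed.

Section Euclid.
Variable X : finType.
Implicit Types (f g : X -> R).

Lemma sum_CS (P : pred X) f g :
  (\sum_(x | P x) f x * g x) ^+ 2 <= (\sum_(x | P x) f x ^+ 2) * (\sum_(x | P x) g x ^+ 2).
Proof.
set A := \sum_(x | P x) f x ^+ 2; set B := \sum_(x | P x) g x ^+ 2; set C := \sum_(x | P x) f x * g x.
have A0 : 0 <= A by apply: sumr_ge0 => x _; exact: sqr_ge0.
have key t : 0 <= A * t ^+ 2 - 2 * C * t + B.
  have -> : A * t ^+ 2 - 2 * C * t + B = \sum_(x | P x) (f x * t - g x) ^+ 2.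
    rewrite [A * _]mulr_suml [2 * C]mulr_sumr mulr_suml -sumrB -big_split.
    by apply: eq_bigr => x _ /=; ring.
  by apply: sumr_ge0 => x _; exact: sqr_ge0.
have [A1|A1] := ltP 0 A.
  have := key (C / A); rewrite (_ : _ + B = B - C ^+ 2 / A); last by field; rewrite gt_eqF.
  by rewrite subr_ge0 ler_pdivrMr// mulrC.
have {A1} Az : A = 0 by apply/eqP; rewrite eq_le A1.
have f0 x : P x -> f x = 0.
  move: Az => /eqP; rewrite psumr_eq0; last by move=> z _; exact: sqr_ge0.
  move=> /allP/(_ x (mem_index_enum _)) /implyP h /h; rewrite sqrf_eq0 => /eqP//.
have -> : C = 0 by rewrite /C big1// => x Px; rewrite f0// mul0r.
by rewrite expr0n mulr_ge0// sumr_ge0// => x _; exact: sqr_ge0.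
Qed.

Lemma sum_CS_sqrt (P : pred X) f g :
  \sum_(x | P x) f x * g x <= Num.sqrt (\sum_(x | P x) f x ^+ 2) * Num.sqrt (\sum_(x | P x) g x ^+ 2).
Proof.
have s0 h : 0 <= \sum_(x | P x) h x ^+ 2 :> R by apply: sumr_ge0 => x _; exact: sqr_ge0.
rewrite -sqrtrM// (le_trans (ler_norm _))// -sqrtr_sqr ler_sqrt ?sum_CS//.
by rewrite mulr_ge0.
Qed.

Lemma sqrt_sum_triangle (P : pred X) f g :
  Num.sqrt (\sum_(x | P x) (f x + g x) ^+ 2) <=
  Num.sqrt (\sum_(x | P x) f x ^+ 2) + Num.sqrt (\sum_(x | P x) g x ^+ 2).
Proof.
have s0 h : 0 <= \sum_(x | P x) h x ^+ 2 :> R by apply: sumr_ge0 => x _; exact: sqr_ge0.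
rewrite -ler_sqr ?nnegrE ?addr_ge0 ?sqrtr_ge0// sqr_sqrtr// sqrrD !sqr_sqrtr//.
under eq_bigr do rewrite sqrrD.
rewrite !big_split /= lerD2r lerD2l mulr2n.
by apply: lerD; exact: sum_CS_sqrt.
Qed.

(** Cut the cube containing the sphere into cells of side [1 / n] and keep one unit vector for each
    cell that meets the sphere (an arbitrary one for the other cells). Two points of a cell are at
    squared distance at most [#|X| / n ^+ 2 <= e]. The point [x0] provides a unit vector. *)
Lemma sphere_net (x0 : X) (e : R) : 0 < e -> exists (I : finType) (i0 : I) (pt : I -> X -> R),
  (forall i, \sum_x pt i x ^+ 2 = 1) /\
  forall f, \sum_x f x ^+ 2 = 1 -> exists i, \sum_x (f x - pt i x) ^+ 2 <= e.
Proof.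
move=> e0.
pose n := (Num.truncn (#|X|%:R / e)).+1.
have n0 : 0 < n%:R :> R by rewrite ltr0n.
pose grid f : {ffun X -> 'I_(2 * n).+1} := [ffun x => inord (Num.truncn ((f x + 1) * n%:R))].
have unit0 : exists f, \sum_x f x ^+ 2 = 1 :> R.
  exists (fun x => (x == x0)%:R); rewrite (bigD1 x0)//= eqxx expr1n big1 ?addr0// => x /negbTE->.
  by rewrite expr0n.
have H (i : {ffun X -> 'I_(2 * n).+1}) : exists f, \sum_x f x ^+ 2 = 1 /\
    ((exists2 g, \sum_x g x ^+ 2 = 1 & grid g = i) -> grid f = i).
  have [[g g1 gi]|N] := pselect (exists2 g, \sum_x g x ^+ 2 = 1 & grid g = i).
    by exists g.
  by case: unit0 => f f1; exists f.
have [pt Hpt] := choice H.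
exists {ffun X -> 'I_(2 * n).+1}, (grid (fun=> 0)), pt; split => [i|f f1]; first by have [] := Hpt i.
exists (grid f); have [p1 /(_ (ex_intro2 _ _ f f1 erefl)) gE] := Hpt (grid f).
have bnd g x : \sum_x g x ^+ 2 = 1 -> -1 <= g x <= 1.
  move=> g1; rewrite -ler_norml -(@ler_sqr _ _ 1) ?nnegrE// expr1n -normrX ger0_norm ?sqr_ge0//.
  by rewrite -g1 (bigD1 x)//= lerDl sumr_ge0// => z _; exact: sqr_ge0.
have D x : (f x - pt (grid f) x) ^+ 2 <= n%:R ^- 2.
  set g := pt _ in gE p1 *.
  have fx := bnd f x f1; have gx := bnd g x p1.
  have Tb (h : R) : -1 <= h <= 1 -> (Num.truncn ((h + 1) * n%:R) < (2 * n).+1)%N.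
    move=> /andP[h1 h2]; rewrite ltnS -(ler_nat R) (@le_trans _ _ ((h + 1) * n%:R))//.
      by rewrite truncn_le mulr_ge0// -lerBlDr sub0r.
    by rewrite natrM ler_pM2r// -[2%:R]/(1 + 1) lerD2r.
  have := congr1 (fun u : {ffun X -> 'I_(2 * n).+1} => nat_of_ord (u x)) gE.
  rewrite /grid !ffunE !inordK ?Tb// => E.
  have tp (h : R) : -1 <= h <= 1 -> 0 <= (h + 1) * n%:R by case/andP => h1 _; rewrite mulr_ge0// -lerBlDr sub0r.
  have tle (y : R) : 0 <= y -> (Num.truncn y)%:R <= y by rewrite truncn_le.
  have a1 := tle _ (tp _ fx); have a2 := truncnS_gt ((f x + 1) * n%:R).
  have b1 := tle _ (tp _ gx); have b2 := truncnS_gt ((g x + 1) * n%:R).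
  rewrite E in b1 b2.
  have : `|(f x - g x) * n%:R| <= 1.
    rewrite ler_norml; move: a1 a2 b1 b2; rewrite -natr1; set T := _%:R.
    rewrite !mulrDl !mul1r mulNr => ? ? ? ?; apply/andP; split; lra.
  rewrite -(@ler_sqr _ _ 1) ?nnegrE// expr1n -normrX ger0_norm ?sqr_ge0// exprMn.
  by rewrite -ler_pdivlMr ?exprn_gt0// mul1r.
rewrite (le_trans (ler_sum _ (fun x _ => D x)))// sumr_const -[leLHS]mulr_natl.
rewrite ler_pdivrMr ?exprn_gt0// -ler_pdivrMl// mulrC.
rewrite (@le_trans _ _ n%:R)//; first by rewrite ltW// truncnS_gt.
by rewrite expr2 ler_peMr// ?ler1n// ltW.
Qed.
End Euclid.
End Coordinates.

(** * The norm of a rectangular Gaussian matrix *)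

Section NormBounds.
Variables (R : realType).

Lemma tame_sqrt (f : R -> R) : tame f -> tame (fun x => Num.sqrt (f x)).
Proof.
move=> [mf [C [c fC]]]; split.
  by apply: measurableT_comp => //; apply: continuous_measurable_fun; exact: sqrt_continuous.
have [_ [D [d H]]] := tameD (@tame_cst R 1) (tame_norm (conj mf (ex_intro _ C (ex_intro _ c fC)))).
exists D, d => x; rewrite (le_trans _ (H x))// (ger0_norm (sqrtr_ge0 _)).
rewrite ger0_norm ?addr_ge0//.
have [f0|f0] := leP (f x) 0; first by rewrite ler0_sqrtr// addr_ge0.
rewrite gtr0_norm// -{2}(sqr_sqrtr (ltW f0)); set t := Num.sqrt _.
have : 0 <= (t - 1 / 2) ^+ 2 by exact: sqr_ge0.
by rewrite !expr2; lra.
Qed.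

Section SquareSums.
Variables (X : finType) (S : pred X).
Local Notation V := {ffun X -> R^o}.

Definition qS (y : V) : R := \sum_(z | S z) y z ^+ 2.

Lemma qS_ge0 y : 0 <= qS y. Proof. by apply: sumr_ge0 => z _; exact: sqr_ge0. Qed.

Lemma sqrt_qS_dist (y v : V) (x : R) :
  `|Num.sqrt (qS (y + x *: v)) - Num.sqrt (qS y)| <= Num.sqrt (qS v) * `|x|.
Proof.
have sc (t : R) : Num.sqrt (\sum_(z | S z) (t * v z) ^+ 2) = Num.sqrt (qS v) * `|t|.
  under eq_bigr do rewrite exprMn.
  by rewrite -mulr_sumr sqrtrM ?sqr_ge0// sqrtr_sqr mulrC.
have E : qS (y + x *: v) = \sum_(z | S z) (y z + x * v z) ^+ 2.
  by apply: eq_bigr => z _; rewrite !ffunE.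
rewrite ler_norml lerNl opprB; apply/andP; split; rewrite lerBlDr.
  have := sqrt_sum_triangle S (fun z => y z + x * v z) (fun z => - x * v z).
  rewrite sc normrN E addrC => h; rewrite (le_trans _ h)//.
  by rewrite /qS; under [X in _ <= Num.sqrt X]eq_bigr do rewrite mulNr addrK.
by rewrite E addrC -sc; exact: sqrt_sum_triangle.
Qed.

(** The difference of the roots is [H q - H q'] over their sum: the numerator is at most [|q - q'|]
    and, as [H q >= q], the denominator is at least [sqrt q + sqrt q']. So the map inherits the
    Lipschitz bound of the norm. *)
Lemma dirlip_sqrt (H : R -> R) :
  (forall q, 0 <= q -> q <= H q) ->
  (forall q q', 0 <= q -> 0 <= q' -> `|H q - H q'| <= `|q - q'|) ->
  dirlip (fun y => Num.sqrt (H (qS y))).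
Proof.
move=> Hq HL v; exists (Num.sqrt (qS v)) => y x; apply: le_trans (sqrt_qS_dist y v x).
set q := qS (y + _); set q' := qS y.
have q0 : 0 <= q by exact: qS_ge0. have q0' : 0 <= q' by exact: qS_ge0.
have h0 := Hq _ q0; have h0' := Hq _ q0'.
have g0 := le_trans q0 h0; have g0' := le_trans q0' h0'.
have [z|nz] := eqVneq (Num.sqrt (H q) + Num.sqrt (H q')) 0.
  move/eqP: z; rewrite paddr_eq0 ?sqrtr_ge0// => /andP[/eqP-> /eqP->].
  by rewrite subrr normr0.
have p0 : 0 < Num.sqrt (H q) + Num.sqrt (H q').
  by rewrite lt_def nz addr_ge0 ?sqrtr_ge0.
rewrite -(ler_pM2r p0) -[X in `|_| * X <= _](gtr0_norm p0) -normrM -subr_sqr !sqr_sqrtr//.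
rewrite (le_trans (HL _ _ q0 q0'))//.
rewrite -{1}(sqr_sqrtr q0) -{1}(sqr_sqrtr q0') subr_sqr normrM ler_wpM2l//.
by rewrite ger0_norm ?addr_ge0 ?sqrtr_ge0// lerD// ler_sqrt.
Qed.

(** Integrate one coordinate at a time: a coordinate in [S] adds [u ^+ 2] to [qS], because [y] still
    vanishes there, and moves [H] from [n] to [n.+1]. Jensen for the square root is the tangent
    bound [t <= t ^+ 2 / (2 * s) + s / 2]. *)
Lemma Qs_sqrt (H : nat -> R -> R) :
  (forall n q, 0 <= q -> q <= H n q) ->
  (forall n q, 0 <= q -> 0 < H n.+1 q) ->
  (forall n q q', 0 <= q -> 0 <= q' -> `|H n q - H n q'| <= `|q - q'|) ->
  (forall n q, 0 <= q -> tame (fun u => H n (q + u ^+ 2))) ->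
  (forall n q, 0 <= q -> E1 (fun u => H n (q + u ^+ 2)) <= H n.+1 q) ->
  forall (r : seq X) (y : V), uniq r -> (forall z, z \in r -> y z = 0) ->
  Qs [seq ebase R x | x <- r] (fun y => Num.sqrt (H 0 (qS y))) y <=
  Num.sqrt (H (count S r) (qS y)).
Proof.
move=> Hq Hp HL Ht HE; elim=> [|x r IH] y //= /andP[xr ur] y0.
have dl n : dirlip (fun y => Num.sqrt (H n (qS y))) by apply: dirlip_sqrt; [exact: Hq|exact: HL].
apply: (@le_trans _ _ (Q (ebase R x) (fun y => Num.sqrt (H (count S r) (qS y))) y)).
  apply: E1_le; [by apply: dirlip_tame; exact: Qs_dirlip|exact: (dirlip_tame _ _ (dl (count S r)))|].
  move=> u; apply: IH => // z zr.
  rewrite !ffunE y0 ?inE ?zr ?orbT//.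
  have -> : (z == x) = false by apply/negbTE; apply: contraNneq xr => <-.
  by rewrite scaler0 addr0.
have yx : y x = 0 by apply: y0; rewrite inE eqxx.
have qS0 := qS_ge0 y.
rewrite /Q; case Sx : (S x) => /=; last first.
  rewrite add0n [X in E1 X](_ : _ = fun=> Num.sqrt (H (count S r) (qS y))) ?E1_cst//.
  apply/funext => u; congr (Num.sqrt (H _ _)); apply: eq_bigr => z Sz; rewrite !ffunE.
  have -> : (z == x) = false by apply/negbTE/eqP => zx; rewrite zx Sx in Sz.
  by rewrite scaler0 addr0.
rewrite add1n; set n := count S r.
have -> : (fun u : R => Num.sqrt (H n (qS (y + u *: ebase R x)))) =
    (fun u => Num.sqrt (H n (qS y + u ^+ 2))).
  apply/funext => u; congr (Num.sqrt (H _ _)); rewrite /qS (bigD1 x)//= [in RHS](bigD1 x)//=.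
  rewrite yx expr0n add0r !ffunE eqxx yx add0r addrC; congr (_ + _).
    apply: eq_bigr => z /andP[_ /negbTE zx]; rewrite !ffunE zx scaler0 addr0//.
  by rewrite /GRing.scale /= mulr1.
have sp : 0 < Num.sqrt (H n.+1 (qS y)) by rewrite sqrtr_gt0 Hp.
set s := Num.sqrt (H n.+1 _) in sp *.
have s2 : s ^+ 2 = H n.+1 (qS y) by rewrite sqr_sqrtr// ltW// Hp.
have tH := Ht n (qS y) qS0.
have tc := @tame_cst R.
apply: (@le_trans _ _ (E1 (fun u => (2 * s)^-1 * H n (qS y + u ^+ 2) + s / 2))).
  apply: E1_le; first exact: tame_sqrt.
    by apply: tameD => //; exact: tameM.
  move=> u; have h0 : 0 <= H n (qS y + u ^+ 2).
    by rewrite (le_trans _ (Hq _ _ _)) ?addr_ge0 ?sqr_ge0.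
  rewrite -{2}(sqr_sqrtr h0); set t := Num.sqrt _.
  have : 0 <= (t - s) ^+ 2 / (2 * s) by rewrite divr_ge0 ?sqr_ge0 ?mulr_ge0 ?(ltW sp).
  have -> : (t - s) ^+ 2 / (2 * s) = (2 * s)^-1 * t ^+ 2 + s / 2 - t by field; rewrite gt_eqF.
  by rewrite subr_ge0.
rewrite E1D ?E1Z ?E1_cst//; last exact: tameM.
have s20 : 0 <= (2 * s)^-1 by rewrite invr_ge0 mulr_ge0// ltW.
rewrite (le_trans (lerD (ler_wpM2l s20 (HE _ _ qS0)) (lexx _)))// -s2.
by rewrite le_eqVlt; apply/orP; left; apply/eqP; field; rewrite gt_eqF.
Qed.

Lemma Ex_sqrt (H : nat -> R -> R) :
  (forall n q, 0 <= q -> q <= H n q) ->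
  (forall n q, 0 <= q -> 0 < H n.+1 q) ->
  (forall n q q', 0 <= q -> 0 <= q' -> `|H n q - H n q'| <= `|q - q'|) ->
  (forall n q, 0 <= q -> tame (fun u => H n (q + u ^+ 2))) ->
  (forall n q, 0 <= q -> E1 (fun u => H n (q + u ^+ 2)) <= H n.+1 q) ->
  Ex (fun y => Num.sqrt (H 0 (qS y))) <= Num.sqrt (H #|S| 0).
Proof.
move=> Hq Hp HL Ht HE.
have := @Qs_sqrt H Hq Hp HL Ht HE (index_enum X) 0 (index_enum_uniq X).
rewrite /Ex (_ : qS 0 = 0); last by apply: big1 => z _; rewrite ffunE expr0n.
rewrite (_ : count S _ = #|S|); last by rewrite -sum1_card -sum1_count.
by apply => z _; rewrite ffunE.
Qed.
End SquareSums.

Lemma tame_sqr : tame (fun u : R => u ^+ 2). Proof. by apply: tameX; exact: tame_id. Qed.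

(** [Ex_sqrt] with [H n q = n + q], for which the averaging inequality is an equality. *)
Lemma Ex_norm (X : finType) (S : pred X) :
  Ex (fun y : {ffun X -> R^o} => Num.sqrt (qS S y)) <= Num.sqrt #|S|%:R.
Proof.
have := @Ex_sqrt X S (fun n q => n%:R + q).
under [X in Ex X]eq_fun do rewrite add0r.
rewrite addr0; apply => n q q0.
- by rewrite lerDr.
- by rewrite ltr_pwDl.
- by move=> q' _; rewrite opprD addrACA subrr add0r.
- by do 2! apply: tameD (tame_cst _) _; exact: tame_sqr.
rewrite !E1D ?E1_cst ?E1_sqr; try exact: tame_cst; try exact: tame_sqr.
  by rewrite -natr1 addrA addrAC.
by apply: tameD (tame_cst _) _; exact: tame_sqr.
Qed.

(* [chiH M n q] dominates [E max (q + chi_n^2, M)]: it is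
   [max (a, M) = (a + M + |a - M|) / 2] at [a = n + q], with [|a - M|] smoothed. The
   constant 25 makes [chiH] a supersolution of the one-coordinate averaging, because
   [E u^4 <= 26]. *)
Definition chiH (M : R) (n : nat) (q : R) : R :=
  (n%:R + q + M + Num.sqrt ((n%:R + q - M) ^+ 2 + 25 * n%:R)) / 2.

Lemma sqrt_sqrD_dist (a b t : R) : 0 <= t ->
  `|Num.sqrt (a ^+ 2 + t) - Num.sqrt (b ^+ 2 + t)| <= `|a - b|.
Proof.
move=> t0.
have H (c d : R) : Num.sqrt (c ^+ 2 + t) - Num.sqrt (d ^+ 2 + t) <= `|c - d|.
  rewrite lerBlDr -ler_sqr ?nnegrE ?addr_ge0 ?sqrtr_ge0//.
  rewrite sqrrD !sqr_sqrtr ?addr_ge0 ?sqr_ge0// real_normK ?num_real//.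
  have : d * (c - d) <= `|c - d| * Num.sqrt (d ^+ 2 + t).
    rewrite mulrC (le_trans (ler_norm _))// normrM ler_wpM2l//.
    by rewrite -sqrtr_sqr ler_sqrt ?addr_ge0 ?sqr_ge0// lerDl.
  by rewrite !expr2; lra.
by rewrite ler_norml H andbT lerNl opprB distrC H.
Qed.

Lemma E1_sqrt_le (f : R -> R) (A : R) : tame f -> (forall u, 0 <= f u) -> 0 < A -> E1 f <= A ->
  E1 (fun u => Num.sqrt (f u)) <= Num.sqrt A.
Proof.
move=> tf f0 A0 fA; have s0 : 0 < Num.sqrt A by rewrite sqrtr_gt0.
set s := Num.sqrt A in s0 *; have s2 : s ^+ 2 = A by rewrite sqr_sqrtr// ltW.
have tc := @tame_cst R.
apply: (@le_trans _ _ (E1 (fun u => (2 * s)^-1 * f u + s / 2))).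
  apply: E1_le; first exact: tame_sqrt.
    by apply: tameD => //; exact: tameM.
  move=> u; rewrite -{2}(sqr_sqrtr (f0 u)); set t := Num.sqrt _.
  have : 0 <= (t - s) ^+ 2 / (2 * s) by rewrite divr_ge0 ?sqr_ge0 ?mulr_ge0 ?(ltW s0).
  have -> : (t - s) ^+ 2 / (2 * s) = (2 * s)^-1 * t ^+ 2 + s / 2 - t by field; rewrite gt_eqF.
  by rewrite subr_ge0.
rewrite E1D ?E1Z ?E1_cst//; last exact: tameM.
have s20 : 0 <= (2 * s)^-1 by rewrite invr_ge0 mulr_ge0// ltW.
rewrite (le_trans (lerD (ler_wpM2l s20 fA) (lexx _)))// -s2.
by rewrite le_eqVlt; apply/orP; left; apply/eqP; field; rewrite gt_eqF.
Qed.

(** [expR 2 = expR (1 / 8) ^+ 16 <= (8 / 7) ^+ 16], which is below [26 / 3]. *)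
Lemma E1_pow4_le26 : E1 (fun u : R => u ^+ 4) <= 26.
Proof.
rewrite (le_trans (@E1_pow4 R))//.
have -> : (2 : R) = 16%:R * (1 / 8) by field.
rewrite expRM_natl.
have h : expR (1 / 8 : R) <= 8 / 7.
  by apply: le_trans (expR_le_inv _) _; [lra|rewrite -div1r ler_pdivrMr; lra].
have h0 := expR_ge0 (1 / 8 : R).
rewrite (le_trans (ler_wpM2l _ (lerXn2r 16 _ _ h))) ?nnegrE//.
lra.
Qed.

Lemma chiH_dist (M : R) n (q q' : R) : `|chiH M n q - chiH M n q'| <= `|q - q'|.
Proof.
rewrite /chiH -mulrBl normrM (@gtr0_norm _ (2^-1))// ler_pdivrMr//.
have h := @sqrt_sqrD_dist (n%:R + q - M) (n%:R + q' - M) (25 * n%:R) (mulr_ge0 (ler0n _ _) (ler0n _ _)).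
rewrite (_ : _ - _ - _ = q - q') in h; last by ring.
set A := Num.sqrt _ in h *; set B := Num.sqrt _ in h *.
rewrite (_ : _ - _ = (q - q') + (A - B)); last by ring.
by rewrite (le_trans (ler_normD _ _))// mulr_natr mulr2n lerD2l.
Qed.

(** The affine part of [chiH] gains exactly 1 per coordinate. Under the root, with [b = n + q - M],
    the mean of [(b + u ^+ 2) ^+ 2] is [b ^+ 2 + 2 * b + E u ^+ 4], at most [(b + 1) ^+ 2 + 25];
    Jensen moves the mean inside the root. *)
Lemma Ex_chi (X : finType) (S : pred X) (M : R) : 0 < M ->
  Ex (fun y : {ffun X -> R^o} => Num.sqrt (chiH M 0 (qS S y))) <= Num.sqrt (chiH M #|S| 0).
Proof.
move=> M0.
have sq0 n (q : R) : 0 <= (n%:R + q - M) ^+ 2 + 25 * n%:R.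
  by rewrite addr_ge0 ?sqr_ge0// mulr_ge0.
have lb n (q : R) : n%:R + q - M <= Num.sqrt ((n%:R + q - M) ^+ 2 + 25 * n%:R).
  rewrite (le_trans (ler_norm _))// -sqrtr_sqr ler_sqrt ?sq0//.
  by rewrite lerDl mulr_ge0.
have tc := @tame_cst R; have t2 := tame_sqr.
have ts n (q : R) : tame (fun u => (n%:R + (q + u ^+ 2) - M) ^+ 2 + 25 * n%:R).
  by apply: tameD => //; apply: tameX; apply: tameD => //; do 2! apply: tameD => //.
have tn n (q : R) : tame (fun u => n%:R + (q + u ^+ 2) + M).
  by do 3! apply: tameD => //.
apply: Ex_sqrt => n q q0.
- have := lb n q; rewrite /chiH; have n0 : 0 <= n%:R :> R by []. lra.
- rewrite divr_gt0// ltr_pwDl ?sqrtr_ge0// ltr_wpDl// addr_ge0//.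
- by move=> *; exact: chiH_dist.
- apply: tameM => //; apply: tameD => //; exact: tame_sqrt.
rewrite /chiH.
have -> : (fun u : R => (n%:R + (q + u ^+ 2) + M +
    Num.sqrt ((n%:R + (q + u ^+ 2) - M) ^+ 2 + 25 * n%:R)) / 2) =
  (fun u => 2^-1 * (n%:R + (q + u ^+ 2) + M) + 2^-1 *
    Num.sqrt ((n%:R + (q + u ^+ 2) - M) ^+ 2 + 25 * n%:R)).
  by apply/funext => u; rewrite mulrC mulrDr.
have tss := tame_sqrt (ts n q).
rewrite E1D; [|exact: tameM|exact: tameM].
rewrite !E1Z//.
rewrite [leRHS]mulrDl; apply: lerD.
  rewrite !E1D ?E1_cst ?E1_sqr//; try by do ?apply: tameD => //.
  by rewrite -natr1; lra.
rewrite [leRHS]mulrC ler_wpM2l//; apply: E1_sqrt_le => //.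
  rewrite ltr_wpDl ?sqr_ge0// mulr_gt0//.
set b := n%:R + q - M.
have -> : (fun u : R => (n%:R + (q + u ^+ 2) - M) ^+ 2 + 25 * n%:R) =
    (fun u => (b ^+ 2 + 25 * n%:R) + (2 * b * u ^+ 2 + u ^+ 4)).
  by apply/funext => u; rewrite /b; ring.
have t4 : tame (fun u : R => u ^+ 4) by apply: tameX; exact: tame_id.
have t5 : tame (fun u : R => 2 * b * u ^+ 2) by exact: tameM.
rewrite E1D//; last exact: tameD.
rewrite E1_cst E1D// E1Z// E1_sqr.
have := E1_pow4_le26; rewrite -[n.+1%:R]natr1 (_ : n%:R + 1 + q - M = b + 1); last by rewrite /b; ring.
by rewrite (_ : (b + 1) ^+ 2 = b ^+ 2 + 2 * b + 1); [lra|ring].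
Qed.

(** For [M = n] the value of [chiH] is [n + 5 / 2 * sqrt n], and [25 / 16] completes the square
    [(sqrt n + 5 / 4) ^+ 2]: the origin of [5 / 4]. *)
Lemma chiH_end (M : R) (n : nat) : M = n%:R -> Num.sqrt (chiH M n 0) <= Num.sqrt M + 5 / 4.
Proof.
move=> ->; rewrite /chiH addr0 subrr expr0n add0r.
have n0 : 0 <= n%:R :> R by [].
set t := Num.sqrt n%:R.
have t0 : 0 <= t by exact: sqrtr_ge0.
have nt : n%:R = t ^+ 2 by rewrite sqr_sqrtr.
have -> : 25 * n%:R = (5 * t) ^+ 2 :> R by rewrite nt; ring.
rewrite sqrtr_sqr ger0_norm ?mulr_ge0// nt.
rewrite -ler_sqr ?nnegrE ?sqrtr_ge0 ?addr_ge0// sqr_sqrtr; last first.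
  by rewrite divr_ge0// !addr_ge0 ?sqr_ge0// mulr_ge0.
rewrite sqrrD !expr2; lra.
Qed.

(** At [n = 0] the root is [|q - M|], so [chiH M 0 q] is exactly the maximum of [q] and [M]. *)
Lemma chiH_ge (M q : R) : 0 <= M -> 0 <= q -> Num.sqrt q <= Num.sqrt (chiH M 0 q) /\ Num.sqrt M <= Num.sqrt (chiH M 0 q).
Proof.
move=> M0 q0; rewrite /chiH mulr0 addr0 sqrtr_sqr add0r.
have h : q <= (q + M + `|q - M|) / 2 /\ M <= (q + M + `|q - M|) / 2.
  have := ler_norm (q - M); have := ler_norm (M - q); rewrite distrC => a b; split; lra.
case: h => h1 h2; split; apply: ler_wsqrtr => //.
Qed.
End NormBounds.

(** * Bilinear forms on spheres and the Chevet-type bound *)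

Section OpBound.
Variables (R : realType) (X Y : finType) (x0 : X) (y0 : Y).

Definition bil (B : {ffun X * Y -> R^o}) (u : X -> R) (v : Y -> R) : R :=
  \sum_x \sum_y u x * B (x, y) * v y.

Lemma bilDl B u u' v : bil B (fun x => u x + u' x) v = bil B u v + bil B u' v.
Proof.
rewrite /bil -big_split; apply: eq_bigr => x _; rewrite -big_split; apply: eq_bigr => y _ /=.
by ring.
Qed.

Lemma bilDr B u v v' : bil B u (fun y => v y + v' y) = bil B u v + bil B u v'.
Proof.
rewrite /bil -big_split; apply: eq_bigr => x _; rewrite -big_split; apply: eq_bigr => y _ /=.
by ring.
Qed.

Lemma bilZl B a u v : bil B (fun x => a * u x) v = a * bil B u v.
Proof.
rewrite /bil mulr_sumr; apply: eq_bigr => x _; rewrite mulr_sumr; apply: eq_bigr => y _.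
by ring.
Qed.

Lemma bilZr B a u v : bil B u (fun y => a * v y) = a * bil B u v.
Proof.
rewrite /bil mulr_sumr; apply: eq_bigr => x _; rewrite mulr_sumr; apply: eq_bigr => y _.
by ring.
Qed.

Local Notation nrm u := (Num.sqrt (\sum_x u x ^+ 2)).

Lemma sqsum_ge0 (Z : finType) (u : Z -> R) : 0 <= \sum_z u z ^+ 2.
Proof. by apply: sumr_ge0 => z _; exact: sqr_ge0. Qed.

Lemma sqsum0 (Z : finType) (u : Z -> R) : nrm u = 0 -> forall z, u z = 0.
Proof.
move/eqP; rewrite sqrtr_eq0 => u0 z; apply/eqP; rewrite -sqrf_eq0 eq_le sqr_ge0 andbT.
by rewrite (le_trans _ u0)// (bigD1 z)//= lerDl sumr_ge0// => *; exact: sqr_ge0.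
Qed.

Lemma normalized (Z : finType) (u : Z -> R) : nrm u != 0 -> \sum_z ((nrm u)^-1 * u z) ^+ 2 = 1.
Proof.
move=> nz; under eq_bigr do rewrite exprMn.
by rewrite -mulr_sumr exprVn sqr_sqrtr ?sqsum_ge0// mulVf// -(sqr_sqrtr (sqsum_ge0 u)) expf_neq0.
Qed.

Lemma bil_hom B (s : R) u v :
  (forall u v, \sum_x u x ^+ 2 = 1 -> \sum_y v y ^+ 2 = 1 -> bil B u v <= s) ->
  bil B u v <= s * nrm u * nrm v.
Proof.
move=> H.
have [u0|nu] := eqVneq (nrm u) 0.
  rewrite u0 mulr0 mul0r /bil big1// => x _; rewrite big1// => y _.
  by rewrite (sqsum0 u0) !mul0r.
have [v0|nv] := eqVneq (nrm v) 0.
  rewrite v0 mulr0 /bil big1// => x _; rewrite big1// => y _.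
  by rewrite (sqsum0 v0) mulr0.
have := H _ _ (normalized nu) (normalized nv).
rewrite bilZl bilZr mulrA -invfM mulrC ler_pdivrMr; last first.
  by rewrite mulr_gt0// lt_def ?nu ?nv sqrtr_ge0.
by rewrite mulrA.
Qed.

Lemma bil_bounded B : exists K : R, forall u v, \sum_x u x ^+ 2 = 1 -> \sum_y v y ^+ 2 = 1 -> bil B u v <= K.
Proof.
exists (\sum_x \sum_y `|B (x, y)|) => u v u1 v1.
have b (Z : finType) (w : Z -> R) z : \sum_z w z ^+ 2 = 1 -> `|w z| <= 1.
  move=> w1; rewrite -(@ler_sqr _ _ 1) ?nnegrE// expr1n -normrX ger0_norm ?sqr_ge0//.
  by rewrite -w1 (bigD1 z)//= lerDl sumr_ge0// => *; exact: sqr_ge0.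
apply: ler_sum => x _; apply: ler_sum => y _.
rewrite (le_trans (ler_norm _))// !normrM mulrAC -[leRHS]mul1r ler_wpM2r//.
by rewrite -[leRHS]mul1r ler_pM// b.
Qed.

(** Replacing each unit vector by a net point costs [e] times the supremum, so the supremum is at
    most [N] plus [2 * e] times itself; [bil_bounded] makes it finite, and the term can be
    absorbed. *)
Lemma net_bound (Iu Iv : finType) (pu : Iu -> X -> R) (pv : Iv -> Y -> R) (e N : R) B :
  0 < e -> 2 * e < 1 ->
  (forall i, \sum_x pu i x ^+ 2 = 1) ->
  (forall f, \sum_x f x ^+ 2 = 1 -> exists i, \sum_x (f x - pu i x) ^+ 2 <= e ^+ 2) ->
  (forall i, \sum_y pv i y ^+ 2 = 1) ->
  (forall f, \sum_y f y ^+ 2 = 1 -> exists i, \sum_y (f y - pv i y) ^+ 2 <= e ^+ 2) ->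
  (forall i j, bil B (pu i) (pv j) <= N) ->
  forall u v, \sum_x u x ^+ 2 = 1 -> \sum_y v y ^+ 2 = 1 -> bil B u v <= (1 - 2 * e)^-1 * N.
Proof.
move=> e0 e1 pu1 pun pv1 pvn HN u v u1 v1.
pose A := [set t : R | exists u v, [/\ \sum_x u x ^+ 2 = 1, \sum_y v y ^+ 2 = 1 & t = bil B u v]].
have [K HK] := bil_bounded B.
have supA : has_sup A.
  by split; [exists (bil B u v), u, v|exists K => _ [a [b [a1 b1 ->]]]; exact: HK].
have inS a b : \sum_x a x ^+ 2 = 1 -> \sum_y b y ^+ 2 = 1 -> bil B a b <= sup A.
  by move=> a1 b1; apply: sup_upper_bound => //; exists a, b.
have S0 : 0 <= sup A.
  have h1 := inS u v u1 v1.
  have u1' : \sum_x (-1 * u x) ^+ 2 = 1 by under eq_bigr do rewrite mulN1r sqrrN.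
  have := inS _ v u1' v1; rewrite bilZl; lra.
have small (Z : finType) (w : Z -> R) : \sum_z w z ^+ 2 <= e ^+ 2 -> nrm w <= e.
  by move=> we; rewrite -[e]ger0_norm ?(ltW e0)// -sqrtr_sqr ler_sqrt// sqr_ge0.
have main : sup A <= N + 2 * e * sup A.
  apply: ge_sup; first by exists (bil B u v), u, v.
  move=> _ [a [b [a1 b1 ->]]].
  have [i ai] := pun a a1; have [j bj] := pvn b b1.
  rewrite (_ : a = fun x => pu i x + (a x - pu i x)); last by apply/funext => x; rewrite addrC subrK.
  rewrite bilDl {1}(_ : b = fun y => pv j y + (b y - pv j y)); last by apply/funext => y; rewrite addrC subrK.
  rewrite bilDr -addrA lerD// mulrC mulr_natl mulrnAr mulr2n lerD//.
    rewrite (le_trans (bil_hom _ _ inS))// pu1 sqrtr1 mulr1 ler_wpM2l//.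
    exact: small.
  rewrite (le_trans (bil_hom _ _ inS))// b1 sqrtr1 mulr1 ler_wpM2l//.
  exact: small.
rewrite (le_trans (inS u v u1 v1))// mulrC ler_pdivlMr; last lra.
by lra.
Qed.

Local Notation VB := {ffun X * Y -> R^o}.

Lemma pair_lform B (u : X -> R) (v : Y -> R) :
  lform (fun p : X * Y => - (u p.1 * v p.2)) B = - bil B u v.
Proof.
rewrite /lform /bil -sumrN [RHS](eq_bigr (fun x => \sum_y - (u x * v y) * B (x, y))).
  by rewrite pair_bigA; apply: eq_bigr => -[x y].
by move=> x _; rewrite -sumrN; apply: eq_bigr => y _; ring.
Qed.

Lemma sum_prod (f : X -> R) (g : Y -> R) :
  \sum_p f p.1 * g p.2 = (\sum_x f x) * (\sum_y g y).
Proof.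
rewrite mulr_suml -(pair_bigA _ (fun x y => f x * g y)) /=.
by apply: eq_bigr => x _; rewrite mulr_sumr.
Qed.

Lemma unit_dot (Z : finType) (f g : Z -> R) : \sum_z f z ^+ 2 = 1 -> \sum_z g z ^+ 2 = 1 ->
  \sum_z f z * g z <= 1.
Proof.
by move=> f1 g1; have := sum_CS_sqrt xpredT f g; rewrite f1 g1 sqrtr1 mulr1.
Qed.

Lemma dist_unit (Z : finType) (f g : Z -> R) : \sum_z f z ^+ 2 = 1 -> \sum_z g z ^+ 2 = 1 ->
  \sum_z (- f z - - g z) ^+ 2 = 2 - 2 * \sum_z f z * g z.
Proof.
move=> f1 g1; rewrite mulr_sumr (_ : 2 = 1 + 1)// -{1}f1 -{1}g1 -big_split -sumrB.
by apply: eq_bigr => z _ /=; ring.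
Qed.

(* Sudakov-Fernique with [<u, B v>] against [<u, h> + <v, h'>]; the extra index
   [None] of value 0 truncates [s] from below at [sqrt #|Y|]. *)
Lemma op_bound (d : R) : 0 < d -> exists s : VB -> R,
  [/\ dirlip s, forall B, Num.sqrt #|Y|%:R <= s B,
   forall (B : VB) (u : X -> R), \sum_y (\sum_x u x * B (x, y)) ^+ 2 <= s B ^+ 2 * \sum_x u x ^+ 2 &
   Ex s <= (1 + d) * (Num.sqrt #|Y|%:R + Num.sqrt #|X|%:R + 5 / 4)].
Proof.
move=> d0.
(* Chosen so that the net loses exactly the factor [(1 - 2 * e)^-1 = 1 + d]. *)
pose e := d / (2 * (1 + d)).
have d1 : 0 < 1 + d by lra.
have e0 : 0 < e by rewrite divr_gt0// mulr_gt0.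
have e2 : 1 - 2 * e = (1 + d)^-1 by rewrite /e; field; rewrite gt_eqF.
have e1 : 2 * e < 1 by rewrite -subr_gt0 e2 invr_gt0.
have e20 : 0 < e ^+ 2 by rewrite exprn_gt0.
have [Iu [iu [pu [pu1 pun]]]] := sphere_net x0 e20.
have [Iv [iv [pv [pv1 pvn]]]] := sphere_net y0 e20.
pose M : R := #|Y|%:R; pose sM := Num.sqrt M.
have sM0 : 0 <= sM by exact: sqrtr_ge0.
pose I := option (Iu * Iv)%type.
pose c (a : I) := if a is Some _ then sM else 0.
pose al (a : I) (p : X * Y) := if a is Some ij then - (pu ij.1 p.1 * pv ij.2 p.2) else 0.
pose be (a : I) (z : X + Y) := if a is Some ij then
  match z with inl x => - pu ij.1 x | inr y => - pv ij.2 y end else 0.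
pose mA B := minI None (fun a => c a + lform (al a) B).
pose mB h := minI None (fun a => c a + lform (be a) h).
have comp : Ex mB <= Ex mA.
  have e1u (Z : finType) (f : Z -> R) : \sum_z f z ^+ 2 = 1 -> \sum_z (- f z - 0) ^+ 2 = 1 /\ \sum_z (0 - - f z) ^+ 2 = 1.
    move=> f1; split; rewrite -[RHS]f1; apply: eq_bigr => z _; first by rewrite subr0 sqrrN.
    by rewrite sub0r opprK.
  have e2u i j : \sum_p (pu i p.1 * pv j p.2) ^+ 2 = 1.
    under eq_bigr do rewrite exprMn.
    by rewrite (sum_prod (fun x => pu i x ^+ 2) (fun y => pv j y ^+ 2)) pu1 pv1 mulr1.
  apply: Ex_comparison => -[[i j]|] [[i' j']|]; rewrite big_sumType /=.
  - rewrite dist_unit; [|exact: e2u|exact: e2u].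
    rewrite !dist_unit//; under eq_bigr do rewrite mulrACA.
    rewrite (sum_prod (fun x => pu i x * pu i' x) (fun y => pv j y * pv j' y)).
    have := unit_dot (pu1 i) (pu1 i'); have := unit_dot (pv1 j) (pv1 j').
    set be1 := \sum_y _; set al1 := \sum_x _ => h1 h2.
    (* The two squared distances are [2 - 2 * al1 * be1] and [4 - 2 * al1 - 2 * be1]; their
       difference is twice this product. *)
    have : 0 <= (1 - al1) * (1 - be1) by rewrite mulr_ge0 ?subr_ge0.
    by rewrite mulrBr mulr1 mulrBl mul1r; lra.
  - have [-> _] := e1u _ _ (e2u i j); have [-> _] := e1u _ _ (pu1 i); have [-> _] := e1u _ _ (pv1 j).
    by lra.
  - have [_ ->] := e1u _ _ (e2u i' j'); have [_ ->] := e1u _ _ (pu1 i'); have [_ ->] := e1u _ _ (pv1 j').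
    by lra.
  - by rewrite !big1 ?addr0// => *; rewrite subrr expr0n.
have mAL : dirlip mA by exact: min_lform_dirlip.
have mBL : dirlip mB by exact: min_lform_dirlip.
have mA0 B : mA B <= 0.
  by rewrite (le_trans (minI_le _ _ None))// /lform big1 ?addr0// => x _; rewrite mul0r.
(* [sM - mA B] is the maximum of [sM] and the values of [bil B] on the net; the factor [1 + d] pays
   for the net. *)
exists (fun B => (1 + d) * (sM + (-1) * mA B)).
have sL : dirlip (fun B => sM + (-1) * mA B) by apply: dirlipD; [exact: dirlip_cst|exact: dirlipZ].
have lb B : sM <= (1 + d) * (sM + (-1) * mA B).
  have := mA0 B => h; rewrite -[leLHS]mul1r ler_pM//; lra.
split.
- exact: dirlipZ.
- exact: lb.
- move=> B u; set s := (1 + d) * _.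
  have s0 : 0 <= s by exact: le_trans (lb B).
  have H (a : X -> R) (b : Y -> R) : \sum_x a x ^+ 2 = 1 -> \sum_y b y ^+ 2 = 1 -> bil B a b <= s.
    rewrite /s -[X in X * _]invrK -e2.
    apply: (net_bound e0 e1 pu1 pun pv1 pvn) => i j.
    have := minI_le None (fun a => c a + lform (al a) B) (Some (i, j)).
    by rewrite -/(mA B) /= pair_lform /=; lra.
  (* Testing the bilinear bound on the image of [u] itself bounds the norm of that image. *)
  pose v y := \sum_x u x * B (x, y).
  have bv : bil B u v = \sum_y v y ^+ 2.
    rewrite /bil exchange_big; apply: eq_bigr => y _.
    by rewrite expr2 {2}/v mulr_suml.
  have := bil_hom u v H; rewrite bv -/v.
  set q := \sum_y v y ^+ 2; have q0 : 0 <= q by exact: sqsum_ge0.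
  set p := \sum_x u x ^+ 2; have p0 : 0 <= p by exact: sqsum_ge0.
  rewrite -{1}(sqr_sqrtr q0) expr2.
  have [z|nz] := eqVneq (Num.sqrt q) 0.
    by move=> _; rewrite -(sqr_sqrtr q0) z expr0n mulr_ge0// sqr_ge0.
  rewrite ler_pM2r; last by rewrite lt_def nz sqrtr_ge0.
  rewrite -ler_sqr ?nnegrE ?sqrtr_ge0 ?(mulr_ge0 s0 (sqrtr_ge0 _))//.
  by rewrite exprMn !sqr_sqrtr.
have -> : Ex (fun B => (1 + d) * (sM + (-1) * mA B)) = (1 + d) * (sM + -1 * Ex mA).
  transitivity ((1 + d) * Ex (fun B => sM + -1 * mA B)); first exact: (ExZ (1 + d) sL).
  congr (_ * _); transitivity (Ex (fun B : VB => sM) + Ex (fun B => -1 * mA B)).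
    exact: (ExD (dirlip_cst _) (dirlipZ (-1) mAL)).
  by rewrite Ex_cst; congr (_ + _); exact: (ExZ (-1) mAL).
apply: ler_wpM2l; first exact: ltW.
rewrite -addrA lerD2l mulN1r.
suff : - Ex mB <= Num.sqrt #|X|%:R + 5 / 4 by lra.
pose SX (z : X + Y) := if z is inl _ then true else false.
pose SY (z : X + Y) := if z is inr _ then true else false.
have cX : #|SX| = #|X|.
  by rewrite -!sum1_card big_sumType /= [X in (_ + X)%N]big_pred0// addn0.
have cY : #|SY| = #|Y|.
  by rewrite -!sum1_card big_sumType /= [X in (X + _)%N]big_pred0.
have M0 : 0 < M by rewrite ltr0n; apply/card_gt0P; exists y0.
have L1 : dirlip (fun h : {ffun X + Y -> R^o} => Num.sqrt (qS SX h)).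
  by apply: (@dirlip_sqrt _ _ SX (fun q => q)).
have L2 : dirlip (fun h : {ffun X + Y -> R^o} => Num.sqrt (chiH M 0 (qS SY h))).
  apply: (@dirlip_sqrt _ _ SY (chiH M 0)) => [q q0|q q' q0 q0'].
    have [] := chiH_ge (ltW M0) q0; rewrite ler_sqrt// /chiH divr_ge0// !addr_ge0// ltW//.
  exact: chiH_dist.
(* The maximum of 0 and [|h_X| + |h_Y| - sM] is at most [|h_X|] plus [max (|h_Y|, sM) - sM]; the
   root of [chiH M 0] is this last maximum, whose mean [Ex_chi] controls. *)
have step h : -1 * mB h <= Num.sqrt (qS SX h) + (Num.sqrt (chiH M 0 (qS SY h)) + - sM).
  have [a ma] := minI_ex None (fun a => c a + lform (be a) h); rewrite /mB ma.
  have [c1 c2] := chiH_ge (ltW M0) (qS_ge0 SY h).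
  have p1 : 0 <= Num.sqrt (qS SX h) by exact: sqrtr_ge0.
  case: a ma => [[i j]|] _ /=; last first.
    rewrite add0r /lform big1 ?mulr0 => [|z _]; last by rewrite mul0r.
    by rewrite addr_ge0// subr_ge0.
  have qX : qS SX h = \sum_x h (inl x) ^+ 2 by rewrite /qS big_sumType /= [X in _ + X]big_pred0// addr0.
  have qY : qS SY h = \sum_y h (inr y) ^+ 2 by rewrite /qS big_sumType /= [X in X + _]big_pred0// add0r.
  have hX := sum_CS_sqrt xpredT (pu i) (fun x => h (inl x)).
  have hY := sum_CS_sqrt xpredT (pv j) (fun y => h (inr y)).
  rewrite pu1 sqrtr1 mul1r -qX in hX; rewrite pv1 sqrtr1 mul1r -qY in hY.
  rewrite /lform big_sumType /=.
  have -> : \sum_x - pu i x * h (inl x) = - \sum_x pu i x * h (inl x).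
    by rewrite -sumrN; apply: eq_bigr => x _; rewrite mulNr.
  have -> : \sum_y - pv j y * h (inr y) = - \sum_y pv j y * h (inr y).
    by rewrite -sumrN; apply: eq_bigr => y _; rewrite mulNr.
  lra.
have L3 : dirlip (fun h : {ffun X + Y -> R^o} => Num.sqrt (chiH M 0 (qS SY h)) + - sM).
  by apply: dirlipD => //; exact: dirlip_cst.
have eB : Ex (fun h => -1 * mB h) = -1 * Ex mB by exact: (ExZ (-1) mBL).
have -> : - Ex mB = Ex (fun h => -1 * mB h) by rewrite eB mulN1r.
apply: le_trans (Ex_le (dirlipZ _ mBL) (dirlipD L1 L3) step) _.
rewrite (_ : Ex _ = Ex (fun h : {ffun X + Y -> R^o} => Num.sqrt (qS SX h)) +
  (Ex (fun h : {ffun X + Y -> R^o} => Num.sqrt (chiH M 0 (qS SY h))) + - sM)); last first.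
  transitivity (Ex (fun h : {ffun X + Y -> R^o} => Num.sqrt (qS SX h)) +
    Ex (fun h : {ffun X + Y -> R^o} => Num.sqrt (chiH M 0 (qS SY h)) + - sM)); first exact: (ExD L1 L3).
  congr (_ + _); transitivity (Ex (fun h : {ffun X + Y -> R^o} => Num.sqrt (chiH M 0 (qS SY h))) +
    Ex (fun h : {ffun X + Y -> R^o} => - sM)); first exact: (ExD L2 (dirlip_cst _)).
  by rewrite Ex_cst.
apply: lerD; first by rewrite -cX; exact: Ex_norm.
rewrite lerBlDr [leRHS]addrC; apply: le_trans (Ex_chi SY M0) _.
by apply: chiH_end; rewrite cY.
Qed.
End OpBound.

(** * From independent variables to iterated averages *)

Section Independence.
Local Open Scope ereal_scope.
Context d (T : measurableType d) (R : realType) (P : probability T R) (X : finType) (g : X -> T -> R) (sig : X -> R).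
Local Notation gamma := (@normal_prob R 0 1).
Local Notation L x := (@normal_prob R 0 (sig x)).
Hypothesis sig0 : forall x, (0 < sig x)%R.
Hypothesis mg : forall x, measurable_fun setT (g x).
Hypothesis ind : forall B : X -> set R, (forall x, measurable (B x)) ->
  P (\bigcap_x (g x @^-1` B x)) = \prod_x L x (B x).

(* The pi-system of the events that do not involve the coordinate [x]. *)
Definition othersG (x : X) : set_system T :=
  [set A | exists B : X -> set R, [/\ forall z, measurable (B z), B x = setT &
     A = \bigcap_z (g z @^-1` B z)]].

Lemma mg_preim x (B : set R) : measurable B -> measurable (g x @^-1` B).
Proof. by move=> mB; rewrite -[X in measurable X]setTI; exact: mg. Qed.

Lemma othersG_meas x : othersG x `<=` measurable.
Proof.
move=> A [B [mB _ ->]]; apply: fin_bigcap_measurable => // z _.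
exact: mg_preim.
Qed.

Lemma othersG_setI x : setI_closed (othersG x).
Proof.
move=> A A' [B [mB Bx ->]] [B' [mB' Bx' ->]].
exists (fun z => B z `&` B' z); split.
- by move=> z; exact: measurableI.
- by rewrite Bx Bx' setTI.
- by rewrite -bigcapI; apply: eq_bigcapr => z _; rewrite preimage_setI.
Qed.

Lemma othersG_setT x : othersG x setT.
Proof.
by exists (fun=> setT); split => //; apply/seteqP; split => // w _ z _.
Qed.

(** Both sides are finite measures in [A] that agree on the pi-system [othersG x], hence on the
    sigma-algebra it generates. *)
Lemma othersG_indep x A (B0 : set R) : <<s othersG x >> A -> measurable B0 ->
  P (A `&` g x @^-1` B0) = P A * L x B0.
Proof.
move=> sA mB0.
have mB : measurable (g x @^-1` B0) by exact: mg_preim.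
have c0 : (0 <= fine (L x B0))%R by exact: fine_ge0.
pose m1 : {measure set T -> \bar R} := mrestr P mB.
pose m2 : {measure set T -> \bar R} := mscale (NngNum c0) P.
have fB : L x B0 \is a fin_num by exact: fin_num_measure.
have e1 C : m1 C = P (C `&` g x @^-1` B0) by [].
have e2 C : m2 C = L x B0 * P C by rewrite -[X in X * _]fineK.
suff : m1 A = m2 A by rewrite e1 e2 muleC.
apply: (g_sigma_algebra_measure_unique (othersG x) _ (fun=> setT)) => //.
- exact: othersG_meas.
- by move=> _; exact: othersG_setT.
- by rewrite bigcup_const//; exists 0%N.
- exact: othersG_setI.
- move=> C [B [mBz Bx ->]]; rewrite e1 e2.
  pose B' z := if z == x then B0 else B z.
  have -> : \bigcap_z (g z @^-1` B z) `&` g x @^-1` B0 = \bigcap_z (g z @^-1` B' z).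
    apply/seteqP; split => w /=.
      move=> [H1 H2] z _; rewrite /B' /=; case: eqP => [->//|_]; exact: H1.
    move=> H; split.
      move=> z _; have := H z I; rewrite /B' /=; case: eqP => [->|//].
      by rewrite Bx.
    by have := H x I; rewrite /B' /= eqxx.
  rewrite !ind//; last by move=> z; rewrite /B'; case: ifP.
  rewrite (bigD1 x)//= [in RHS](bigD1 x)//= Bx [X in _ * (X * _)]probability_setT mul1e /B' eqxx.
  by congr (_ * _); apply: eq_bigr => z /negbTE ->.
- by move=> _; rewrite e1 setTI; apply: le_lt_trans (probability_le1 _ _) (ltry _).
Qed.

Local Notation T' x := (g_sigma_algebraType (othersG x)).

Lemma measurable_id_others x : measurable_fun setT (fun w : T => w : T' x).
Proof.
move=> _ B mB; rewrite setTI; change (measurable (B : set T)).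
exact: (smallest_sub (@sigma_algebra_measurable _ T) (@othersG_meas x)).
Qed.

Definition idX x : {mfun T >-> T' x} := HB.pack (fun w : T => w : T' x)
  (isMeasurableFun.Build _ _ _ _ _ (@measurable_id_others x)).

Lemma measurable_other x z : z != x -> measurable_fun setT (g z : T' x -> R).
Proof.
move=> zx _ B mB; rewrite setTI; apply: sub_sigma_algebra.
exists (fun y => if y == z then B else setT); split.
- by move=> y; case: ifP.
- by rewrite eq_sym (negbTE zx).
- apply/seteqP; split => w /=.
    by move=> Bw y _ /=; case: eqP => [->|].
  by move=> H; have := H z I; rewrite /= eqxx.
Qed.

Definition joint x (w : T) : T' x * measurableTypeR R := (w : T' x, g x w).

Lemma measurable_joint x : measurable_fun setT (joint x).
Proof. by apply: measurable_fun_pair; [exact: measurable_id_others|exact: mg]. Qed.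

(** By [othersG_indep] the law of [(w, g x w)] is a product measure once [T] carries the
    sigma-algebra of the other coordinates; then Tonelli. With [T] itself as first factor, the other
    coordinates remain functions of [w]. *)
Lemma joint_law x (f : T' x * measurableTypeR R -> \bar R) : measurable_fun setT f -> (forall z, 0 <= f z) ->
  \int[P]_w f (w : T' x, g x w) = \int[P]_w \int[L x]_u f (w : T' x, u).
Proof.
move=> mf f0.
pose jX : {mfun T >-> (T' x * measurableTypeR R)%type} := HB.pack (joint x)
  (isMeasurableFun.Build _ _ _ _ _ (@measurable_joint x)).
pose P' := distribution P (idX x).
have HE (A : set (T' x)) (B : set (measurableTypeR R)) : measurable A -> measurable B ->
    distribution P jX (A `*` B) = P' A * L x B.
  move=> mA mB; rewrite /distribution /pushforward /=.
  have -> : joint x @^-1` (A `*` B) = A `&` g x @^-1` B by apply/seteqP; split.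
  by rewrite othersG_indep.
have H := @product_measure_unique _ _ _ _ R P' (L x) (distribution P jX) HE.
transitivity (\int[distribution P jX]_z f z).
  by rewrite ge0_integral_distribution.
transitivity (\int[(P' \x L x)]_z f z).
  by apply: eq_measure_integral => A mA _; apply: esym; exact: H.
rewrite fubini_tonelli1//.
by rewrite ge0_integral_distribution//; [exact: measurable_fun_fubini_tonelli_F|
  move=> w; exact: integral_ge0].
Qed.

(** [joint_law] freezes the other coordinates, and [integral_affine_normal] rescales the law of
    [g x] to the standard one that defines [Q]. *)
Lemma integral_peel x (F : {ffun X -> R^o} -> R) (r : seq X) (y : {ffun X -> R^o}) :
  dirlip F -> (forall y, (0 <= F y)%R) -> x \notin r ->
  \int[P]_w (F (y + ((g x w / sig x) *: ebase R x + \sum_(z <- r) (g z w / sig z) *: ebase R z)))%:E =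
  \int[P]_w (Q (ebase R x) F (y + \sum_(z <- r) (g z w / sig z) *: ebase R z))%:E.
Proof.
move=> FL F0 xr.
pose f (p : T' x * R) : \bar R := (F (y + \sum_(z <- r) (g z p.1 / sig z) *: ebase R z + (p.2 / sig x) *: ebase R x))%:E.
have mV : measV (fun p : T' x * R => y + \sum_(z <- r) (g z p.1 / sig z) *: ebase R z)%R.
  elim: r xr {f} => [|z r IH] xr.
    by under eq_fun do rewrite big_nil; exact: measV_cst.
  rewrite inE negb_or in xr; case/andP: xr => xz xr.
  under eq_fun do rewrite big_cons addrCA addrC.
  apply: measV_add; first exact: IH.
  apply: measurable_funM; last exact: measurable_cst.
  by apply: measurableT_comp; [apply: measurable_other; rewrite eq_sym|exact: measurable_fst].
have mf : measurable_fun setT f.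
  apply/measurable_EFinP.
  have m2 : measV (fun p : T' x * R => y + \sum_(z <- r) (g z p.1 / sig z) *: ebase R z + (p.2 / sig x) *: ebase R x)%R.
    by apply: measV_add => //; apply: measurable_funM; [exact: measurable_snd|exact: measurable_cst].
  exact: m2 FL.
have f0 p : 0 <= f p by rewrite lee_fin.
transitivity (\int[P]_w f (w : T' x, g x w)).
  by apply: eq_integral => w _; rewrite /f /= [((_ / _) *: ebase R x + _)%R]addrC addrA.
rewrite joint_law//; apply: eq_integral => w _.
set y' := (y + _)%R.
have [C FC] := dirlip_line ((sig x)^-1 *: ebase R x) FL.
have fl : lip C (fun u => F (y' + (u / sig x) *: ebase R x)%R).
  by move=> u u'; have := FC y' u u'; rewrite !scalerA.
have fge u : (0 <= F (y' + (u / sig x) *: ebase R x)%R)%R by [].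
have sn0 : sig x != 0%R by rewrite gt_eqF.
have e1 := integral_affine_normal 0 (sig0 x) fl fge.
have mfl : measurable_fun setT (fun u : R => (F (y' + (u / sig x) *: ebase R x)%R)%:E).
  by apply/measurable_EFinP; exact: (continuous_measurable_fun (lip_continuous fl)).
have e2 := @ge0_integral_normal_prob R 0 (sig x) (fun u => (F (y' + (u / sig x) *: ebase R x)%R)%:E) sn0 mfl fge.
rewrite /f /= e2.
transitivity (\int[gamma]_u (F (y' + u *: ebase R x)%R)%:E); last first.
  by rewrite /Q -EFin_E1//; exact: dirlip_tame.
rewrite -[LHS]e1; apply: eq_integral => u _.
by have -> : ((sig x * u + 0) / sig x = u)%R by field.
Qed.

(** Coordinates are peeled off in the order opposite to the nesting of [Qs]; [Qs_comm1] repairs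
    this. *)
Lemma integral_Ex_ge0 (F : {ffun X -> R^o} -> R) : dirlip F -> (forall y, (0 <= F y)%R) ->
  \int[P]_w (F [ffun x => g x w / sig x])%:E = (Ex F)%:E.
Proof.
move=> FL F0.
have main (r : seq X) : uniq r -> forall F y, dirlip F -> (forall y, (0 <= F y)%R) ->
    \int[P]_w (F (y + \sum_(z <- r) (g z w / sig z) *: ebase R z)%R)%:E = (Qs [seq ebase R x | x <- r] F y)%:E.
  elim: r => [_ G y GL G0|x r IH /= /andP[xr ur] G y GL G0].
    under eq_integral do rewrite big_nil addr0.
    by rewrite integral_cst// [X in _ * X]probability_setT mule1.
  under eq_integral do rewrite big_cons.
  rewrite integral_peel// IH//; [|exact: Q_dirlip|].
    by rewrite Qs_comm1.
  by move=> z; exact: Rintegral_ge0.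
rewrite -(main _ (index_enum_uniq X) F (0 : {ffun X -> R^o})%R FL F0).
apply: eq_integral => w _; congr (F _)%:E; apply/ffunP => x.
rewrite ffunE add0r sum_ffunE (bigD1 x)//= !ffunE eqxx big1 ?addr0.
  by rewrite /GRing.scale /= mulr1.
by move=> z zx; rewrite !ffunE eq_sym (negbTE zx) scaler0.
Qed.

End Independence.

(** * Hermitian matrices *)

Local Open Scope sesquilinear_scope.

Section MatrixAlgebra.
Variable C : numClosedFieldType.

Lemma tcM m n p (A : 'M[C]_(m, n)) (B : 'M[C]_(n, p)) : (A *m B)^t* = B^t* *m A^t*.
Proof. by rewrite trmx_mul map_mxM. Qed.

Lemma tcD m n (A B : 'M[C]_(m, n)) : (A + B)^t* = A^t* + B^t*.
Proof. by apply/matrixP => i j; rewrite !mxE rmorphD. Qed.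

Lemma tcN m n (A : 'M[C]_(m, n)) : (- A)^t* = - A^t*.
Proof. by apply/matrixP => i j; rewrite !mxE rmorphN. Qed.

Lemma tcB m n (A B : 'M[C]_(m, n)) : (A - B)^t* = A^t* - B^t*.
Proof. by rewrite tcD tcN. Qed.

Lemma tcZ m n c (A : 'M[C]_(m, n)) : (c *: A)^t* = c^* *: A^t*.
Proof. by apply/matrixP => i j; rewrite !mxE rmorphM. Qed.

Lemma tc_sum m n (I : finType) (F : I -> 'M[C]_(m, n)) : (\sum_i F i)^t* = \sum_i (F i)^t*.
Proof.
by elim/big_rec2: _ => [|i A B _ <-]; [apply/matrixP => i j; rewrite !mxE rmorph0|rewrite tcD].
Qed.

Lemma tr_tc n (A : 'M[C]_n) : \tr (A^t*) = (\tr A)^*.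
Proof. by rewrite /mxtrace rmorph_sum; apply: eq_bigr => i _; rewrite !mxE. Qed.

Lemma hermP n (A : 'M[C]_n) : A \is hermsymmx <-> A^t* = A.
Proof.
split=> [/is_hermitianmxP|AE]; first by rewrite expr0 scale1r => <-.
by apply/is_hermitianmxP; rewrite expr0 scale1r AE.
Qed.

Definition frob m n (A : 'M[C]_(m, n)) : C := \tr (A^t* *m A).

Lemma frobE m n (A : 'M[C]_(m, n)) : frob A = \sum_i \sum_j `|A i j| ^+ 2.
Proof.
rewrite /frob /mxtrace exchange_big; apply: eq_bigr => j _; rewrite !mxE.
by apply: eq_bigr => i _; rewrite !mxE normCKC.
Qed.

Lemma frob_ge0 m n (A : 'M[C]_(m, n)) : 0 <= frob A.
Proof. by rewrite frobE !sumr_ge0// => i _; rewrite sumr_ge0// => j _; rewrite exprn_ge0. Qed.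

Lemma frobB m n (A B : 'M[C]_(m, n)) :
  frob (A - B) = frob A + frob B - (\tr (A^t* *m B) + (\tr (A^t* *m B))^*).
Proof.
rewrite -tr_tc tcM trmxCK /frob tcB mulmxBl !mulmxBr !mxtraceD !linearN /= mxtraceD linearN /=.
by ring.
Qed.

Lemma frobZ m n c (A : 'M[C]_(m, n)) : frob (c *: A) = c^* * c * frob A.
Proof. by rewrite /frob tcZ -scalemxAl -scalemxAr !mxtraceZ mulrA. Qed.

(** Expand the squared norm of [c *: P - Q^t*] and divide by [c]. *)
Lemma frob_AMGM m n (P : 'M[C]_(m, n)) (Q : 'M[C]_(n, m)) (c : C) : 0 < c ->
  \tr (P *m Q) + (\tr (P *m Q))^* <= c * frob P + c^-1 * frob Q.
Proof.
move=> c0; have cR : c^* = c by apply: CrealP; exact: gtr0_real.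
have fQ : frob (Q^t*) = frob Q by rewrite /frob trmxCK mxtrace_mulC.
have := frob_ge0 (c *: P - Q^t*); rewrite frobB frobZ cR fQ.
have -> : \tr ((c *: P)^t* *m Q^t*) = c * (\tr (P *m Q))^*.
  by rewrite tcZ cR -scalemxAl mxtraceZ -tcM tr_tc mxtrace_mulC.
rewrite rmorphM /= cR conjCK -mulrDr subr_ge0 => h.
rewrite -(ler_pM2l c0) addrC (le_trans h)// mulrDr !mulrA.
by rewrite divff ?gt_eqF// mul1r.
Qed.

(** Under the hypotheses [L^t* *m P], [P^t* *m P] and [L^t* *m L] have the same Frobenius norm, and
    cyclicity of the trace matches the cross terms; the difference of the two sides is then a sum of
    squared norms. *)
Lemma kernel_ineq m n (P P' : 'M[C]_(m, n)) (L L' : 'M[C]_m) :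
  P *m P^t* = L *m L^t* -> P' *m P'^t* = L' *m L'^t* ->
  frob (P^t* *m P - P'^t* *m P') <= 2 * frob (L^t* *m P - L'^t* *m P').
Proof.
move=> PL PL'.
have e1 (A : 'M[C]_(m, n)) (B : 'M[C]_m) : A *m A^t* = B *m B^t* ->
    frob (B^t* *m A) = frob (A^t* *m A).
  by move=> AB; rewrite /frob !tcM !trmxCK !mulmxA -(mulmxA _ B) -AB mulmxA.
have e2 (A : 'M[C]_(m, n)) (B : 'M[C]_m) : A *m A^t* = B *m B^t* ->
    frob (B^t* *m B) = frob (A^t* *m A).
  have h k l (M : 'M[C]_(k, l)) : frob (M^t* *m M) = \tr (M *m M^t* *m (M *m M^t*)).
    by rewrite /frob tcM trmxCK -mulmxA mxtrace_mulC !mulmxA.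
  by move=> AB; rewrite !h AB.
rewrite -subr_ge0.
have -> : 2 * frob (L^t* *m P - L'^t* *m P') - frob (P^t* *m P - P'^t* *m P') =
   frob (L^t* *m L - L'^t* *m L') + 2 * frob (L *m L'^t* - P *m P'^t*).
  rewrite !frobB (e1 _ _ PL) (e1 _ _ PL') (e2 _ _ PL) (e2 _ _ PL').
  have z1 : \tr ((L^t* *m P)^t* *m (L'^t* *m P')) = (\tr ((L *m L'^t*)^t* *m (P *m P'^t*)))^*.
    by rewrite -tr_tc !tcM !trmxCK -[in RHS]mulmxA [RHS]mxtrace_mulC !mulmxA.
  have w1 : \tr ((P^t* *m P)^t* *m (P'^t* *m P')) = frob (P *m P'^t*).
    by rewrite /frob !tcM !trmxCK -[in RHS]mulmxA [RHS]mxtrace_mulC !mulmxA.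
  have u1 : \tr ((L^t* *m L)^t* *m (L'^t* *m L')) = frob (L *m L'^t*).
    by rewrite /frob !tcM !trmxCK -[in RHS]mulmxA [RHS]mxtrace_mulC !mulmxA.
  have rr m' n' (A : 'M[C]_(m', n')) : (frob A)^* = frob A.
    by apply: CrealP; rewrite ger0_real ?frob_ge0.
  rewrite z1 w1 u1 !rr conjCK; ring.
by rewrite addr_ge0 ?frob_ge0// mulr_ge0 ?frob_ge0.
Qed.

Lemma hermitian_diag n (A : 'M[C]_n) : A \is hermsymmx ->
  exists (P : 'M[C]_n) (d : 'rV[C]_n), [/\ P \is unitarymx, forall i, d 0 i \is Num.real &
    A = P^t* *m diag_mx d *m P].
Proof.
move=> hA; exists (spectralmx A), (spectral_diag A).
have uP := spectral_unitarymx A.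
split => //; first by move=> i; have /mxOverP/(_ 0 i) := hermitian_spectral_diag_real hA.
by have /orthomx_spectralP {1}-> := hermitian_normalmx hA; rewrite invmx_unitary.
Qed.

(** Testing on eigenvectors shows that the eigenvalues are nonnegative; their roots scale the rows
    of the diagonalizing unitary. *)
Lemma psd_factor n (A : 'M[C]_n) : A \is hermsymmx ->
  (forall v : 'cV[C]_n, 0 <= (v^t* *m A *m v) 0 0) -> exists B : 'M[C]_n, A = B^t* *m B.
Proof.
move=> /hermitian_diag[P [d [uP dR AE]]] Apos.
have PP : P *m P^t* = 1%:M by exact/unitarymxP.
have d0 i : 0 <= d 0 i.
  have := Apos (P^t* *m delta_mx i 0); rewrite AE tcM trmxCK.
  rewrite !mulmxA -(mulmxA _ P) PP mulmx1 -(mulmxA _ P) PP mulmx1.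
  by rewrite trmx_delta map_delta_mx -rowE -colE !mxE eqxx mulr1n.
exists (diag_mx (map_mx sqrtC d) *m P).
rewrite AE tcM !mulmxA; congr (_ *m _); rewrite -mulmxA; congr (_ *m _).
apply/matrixP => i j; rewrite !mxE (bigD1 i)//= big1 ?addr0.
  rewrite !mxE eqxx mulr1n; have [->|ij] := eqVneq i j; last by rewrite mulr0n mulr0.
  by rewrite mulr1n (CrealP _) ?ger0_real ?sqrtC_ge0// -expr2 sqrtCK.
by move=> k /negbTE ki; rewrite !mxE ki mulr0n rmorph0 mul0r.
Qed.
End MatrixAlgebra.

Local Open Scope complex_scope.
Local Open Scope sesquilinear_scope.

Section ComplexMatrices.
Variable R : realType.
Local Notation C := R[i].

Lemma ReD (x y : C) : complex.Re (x + y) = complex.Re x + complex.Re y.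
Proof. by case: x; case: y. Qed.
Lemma ImD (x y : C) : complex.Im (x + y) = complex.Im x + complex.Im y.
Proof. by case: x; case: y. Qed.
Lemma ReN (x : C) : complex.Re (- x) = - complex.Re x. Proof. by case: x. Qed.
Lemma ImN (x : C) : complex.Im (- x) = - complex.Im x. Proof. by case: x. Qed.
Lemma ReJ (x : C) : complex.Re x^* = complex.Re x. Proof. by case: x. Qed.
Lemma ImJ (x : C) : complex.Im x^* = - complex.Im x. Proof. by case: x. Qed.
Lemma ReM (x y : C) : complex.Re (x * y) = complex.Re x * complex.Re y - complex.Im x * complex.Im y.
Proof. by case: x; case: y. Qed.
Lemma ImM (x y : C) : complex.Im (x * y) = complex.Re x * complex.Im y + complex.Im x * complex.Re y.
Proof. by case: x; case: y. Qed.
Lemma Re_sum (I : Type) (r : seq I) (P : pred I) (F : I -> C) :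
  complex.Re (\sum_(i <- r | P i) F i) = \sum_(i <- r | P i) complex.Re (F i).
Proof. by apply: (big_morph (@complex.Re R)) => // x y; exact: ReD. Qed.
Lemma Im_sum (I : Type) (r : seq I) (P : pred I) (F : I -> C) :
  complex.Im (\sum_(i <- r | P i) F i) = \sum_(i <- r | P i) complex.Im (F i).
Proof. by apply: (big_morph (@complex.Im R)) => // x y; exact: ImD. Qed.
Lemma ReMr (a : R) (x : C) : complex.Re (a%:C * x) = a * complex.Re x.
Proof. by rewrite ReM /= mul0r subr0. Qed.
Lemma realE (x : C) : x^* = x -> x = (complex.Re x)%:C.
Proof. by case: x => a b [/eqP]; rewrite eqNr => /eqP ->. Qed.
Lemma leRe (x y : C) : x <= y -> complex.Re x <= complex.Re y.
Proof. by rewrite lecE => /andP[]. Qed.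
Lemma addJ (x : C) : x + x^* = (2 * complex.Re x)%:C.
Proof. by case: x => a b; congr (_ +i* _) => /=; [rewrite mulr_natl mulr2n|rewrite subrr]. Qed.
Lemma sum_C (I : Type) (r : seq I) (P : pred I) (F : I -> R) :
  (\sum_(i <- r | P i) F i)%:C = \sum_(i <- r | P i) (F i)%:C :> C.
Proof. exact: rmorph_sum. Qed.

Definition sqmod (z : C) : R := complex.Re z ^+ 2 + complex.Im z ^+ 2.
Definition sqnorm m n (A : 'M[C]_(m, n)) : R := \sum_i \sum_j sqmod (A i j).

Lemma sqmod_ge0 z : 0 <= sqmod z. Proof. by rewrite addr_ge0 ?sqr_ge0. Qed.
Lemma sqnorm_ge0 m n (A : 'M[C]_(m, n)) : 0 <= sqnorm A.
Proof. by rewrite sumr_ge0// => i _; rewrite sumr_ge0// => j _; exact: sqmod_ge0. Qed.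

Lemma sqnormC m n (A : 'M[C]_(m, n)) : (sqnorm A)%:C = frob A.
Proof.
rewrite frobE sum_C; apply: eq_bigr => i _; rewrite sum_C; apply: eq_bigr => j _.
exact: add_Re2_Im2.
Qed.

Lemma sqnorm_Re m n (A : 'M[C]_(m, n)) : sqnorm A = complex.Re (frob A).
Proof. by rewrite -sqnormC. Qed.

Lemma l2normE n (v : 'cV[C]_n) : l2norm v = Num.sqrt (sqnorm v).
Proof. by rewrite /l2norm /sqnorm; congr Num.sqrt; apply: eq_bigr => i _; rewrite big_ord1. Qed.

(** [w i] is the squared norm of the [i]-th row of [Y] in an eigenbasis; [d] is fixed before [Y], so
    all quadratic forms are diagonalized at once. [eigenvalue] refers to row vectors, whence the
    separate clause on column eigenvectors. *)
Lemma herm_quad m (A : 'M[C]_m) : A \is hermsymmx -> exists d : 'I_m -> R,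
  (forall i, exists2 u : 'cV[C]_m, sqnorm u = 1 & A *m u = (d i)%:C *: u) /\
  (forall i, eigenvalue A (d i)%:C) /\
  forall k (Y : 'M[C]_(m, k)), exists w : 'I_m -> R, [/\ forall i, 0 <= w i,
    \sum_i w i = sqnorm Y & \tr (Y^t* *m A *m Y) = (\sum_i d i * w i)%:C].
Proof.
move=> /hermitian_diag[P [d [uP dR AE]]].
have PP : P *m P^t* = 1%:M by exact/unitarymxP.
have PP' : P^t* *m P = 1%:M by exact: mulmx1C.
exists (fun i => complex.Re (d 0 i)).
have dE i : (complex.Re (d 0 i))%:C = d 0 i by rewrite -realE//; exact/CrealP.
split=> [i|]; last split=> [i|k Y].
- exists (P^t* *m delta_mx i 0).
    rewrite sqnorm_Re /frob tcM trmxCK -mulmxA (mulmxA P) PP mul1mx trmx_delta map_delta_mx.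
    by rewrite mul_delta_mx /mxtrace big_ord1 !mxE eqxx.
  rewrite AE -!mulmxA (mulmxA P) PP mul1mx scalemxAr; congr (_ *m _); rewrite dE.
  by apply/matrixP => a b; rewrite mul_diag_mx !mxE; case: eqVneq => [->//|_]; rewrite !mulr0.
- apply/eigenvalueP; exists (delta_mx 0 i *m P).
    rewrite AE !mulmxA -(mulmxA _ P) PP mulmx1 scalemxAl; congr (_ *m _); rewrite dE.
    by apply/matrixP => a b; rewrite mul_mx_diag !mxE andbC; case: eqVneq => [->|_]; rewrite ?mulr0 ?mul0r// mulrC.
  apply/eqP => /(congr1 (mulmx^~ (P^t*))); rewrite -mulmxA PP mulmx1 mul0mx.
  by move=> /matrixP/(_ 0 i)/eqP; rewrite !mxE !eqxx oner_eq0.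
pose W := P *m Y.
exists (fun i => \sum_j sqmod (W i j)); split.
- by move=> i; rewrite sumr_ge0// => j _; exact: sqmod_ge0.
- rewrite -/(sqnorm W) !sqnorm_Re /frob /W tcM -mulmxA (mulmxA (P^t*)) PP' mul1mx//.
rewrite AE !mulmxA -mulmxA -/W (_ : Y^t* *m P^t* = W^t*); last by rewrite tcM.
have -> : \tr (W^t* *m diag_mx d *m W) = \sum_j \sum_i (W i j)^* * (d 0 i * W i j).
  apply: eq_bigr => j _; rewrite -mulmxA mxE; apply: eq_bigr => i _.
  by rewrite mul_diag_mx !mxE.
rewrite exchange_big sum_C; apply: eq_bigr => i _ /=.
rewrite rmorphM /= dE sum_C mulr_sumr; apply: eq_bigr => j _.
by rewrite mulrCA -normCKC; congr (_ * _); rewrite -add_Re2_Im2.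
Qed.

Definition qform m k (A : 'M[C]_m) (Y : 'M[C]_(m, k)) : R := complex.Re (\tr (Y^t* *m A *m Y)).

Lemma qformE m k (A : 'M[C]_m) (Y : 'M[C]_(m, k)) : A \is hermsymmx -> exists d w : 'I_m -> R,
  [/\ forall i, eigenvalue A (d i)%:C, forall i, 0 <= w i, \sum_i w i = sqnorm Y & qform A Y = \sum_i d i * w i].
Proof.
move=> /herm_quad[d [_ [E H]]]; have [w [w0 w1 w2]] := H k Y.
by exists d, w; split => //; rewrite /qform w2.
Qed.

Lemma eigen_qform m (A : 'M[C]_m) (x : R) : eigenvalue A x%:C ->
  exists2 v : 'cV[C]_m, 0 < sqnorm v & qform A v = x * sqnorm v.
Proof.
move=> /eigenvalueP[v vA v0]; exists (v^t*).
  have n0 : v^t* != 0 by apply: contra v0 => /eqP v0; rewrite -(trmxCK v) v0; apply/eqP/matrixP => i j; rewrite !mxE rmorph0.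
  rewrite lt_def sqnorm_ge0 andbT; apply: contra n0 => /eqP f0; apply/eqP/matrixP => i j.
  have sq0 : sqmod ((v^t*) i j) = 0.
    apply/eqP; rewrite eq_le sqmod_ge0 andbT -f0 /sqnorm (bigD1 i)//= (bigD1 j)//= -addrA lerDl.
    by rewrite addr_ge0// ?sumr_ge0// => [a _|a _]; rewrite ?sqmod_ge0// sumr_ge0// => b _; exact: sqmod_ge0.
  rewrite [RHS]mxE; move: sq0; case: ((v^t*) i j) => a b /eqP.
  by rewrite paddr_eq0 ?sqr_ge0// !sqrf_eq0 /= => /andP[/eqP -> /eqP ->].
rewrite /qform trmxCK vA -scalemxAl mxtraceZ ReMr; congr (_ * _).
by rewrite sqnorm_Re /frob trmxCK.
Qed.

(** Every eigenvalue is a Rayleigh quotient. Positive dimension keeps [inf] away from its default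
    value on the empty set. *)
Lemma lambda_min_ge m (A : 'M[C]_m) (c : R) : (0 < m)%N -> A \is hermsymmx ->
  (forall v : 'cV[C]_m, c * sqnorm v <= qform A v) -> c <= lambda_min A.
Proof.
move=> m0 hA H; apply: lb_le_inf.
  have [d [w [E _ _ _]]] := qformE (0 : 'cV[C]_m) hA.
  by exists (d (Ordinal m0)); exact: E.
move=> x /= Ex; have [v v0 vE] := eigen_qform Ex.
by have := H v; rewrite vE ler_pM2r.
Qed.

Lemma lambda_min_le m k (A : 'M[C]_m) (Y : 'M[C]_(m, k)) : A \is hermsymmx ->
  lambda_min A * sqnorm Y <= qform A Y.
Proof.
move=> hA; have [d [w [E w0 <- ->]]] := qformE Y hA.
rewrite mulr_sumr ler_sum// => i _; rewrite ler_wpM2r//.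
apply: ge_inf; last exact: E.
have [d' [w' _]] := qformE (0 : 'cV[C]_m) hA.
pose m0 := minI i (fun i => d i).
have [D [_ [_ HD]]] := herm_quad hA.
(* [ge_inf] asks for a lower bound of the eigenvalues: each is a Rayleigh quotient, hence at least
   the smallest [D j]. *)
exists (minI i D) => x /= Ex; have [v v0 vE] := eigen_qform Ex.
have [u [u0 u1 u2]] := HD _ v.
rewrite -(ler_pM2r v0) -vE /qform u2 /= -u1 mulr_sumr ler_sum// => j _.
by rewrite ler_wpM2r// minI_le.
Qed.

Lemma sqnorm_mul m n k (A : 'M[C]_(m, n)) : exists2 K : R, 0 <= K & forall v : 'M[C]_(n, k), sqnorm (A *m v) <= K * sqnorm v.
Proof.
have hA : A^t* *m A \is hermsymmx by apply/hermP; rewrite tcM trmxCK.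
have [d [_ [_ H]]] := herm_quad hA.
exists (\sum_i `|d i|) => [|v]; first exact: sumr_ge0.
have [w [w0 w1 w2]] := H k v.
have -> : sqnorm (A *m v) = \sum_i d i * w i.
  by rewrite sqnorm_Re /frob tcM mulmxA -(mulmxA (v^t*)) w2.
rewrite -w1 mulr_sumr ler_sum// => i _; rewrite ler_wpM2r// (le_trans (ler_norm _))//.
by rewrite (bigD1 i)//= lerDl sumr_ge0.
Qed.

(** Each eigenvalue is at most [|d i|], the norm of the image of a unit eigenvector; [sqnorm_mul]
    bounds the set whose supremum is [opnorm]. *)
Lemma opnorm_qform m k (A : 'M[C]_m) (Y : 'M[C]_(m, k)) : A \is hermsymmx ->
  qform A Y <= opnorm A * sqnorm Y.
Proof.
move=> hA; have [d [Eu [_ H]]] := herm_quad hA.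
have [w [w0 <- wE]] := H k Y; rewrite /qform wE /= mulr_sumr ler_sum// => i _.
rewrite ler_wpM2r//; have [u u1 Au] := Eu i.
have -> : d i = Num.sg (d i) * `|d i| by rewrite -numEsg.
rewrite (@le_trans _ _ `|d i|)//.
  by rewrite -numEsg ler_norm.
apply: ub_le_sup.
  have [K K0 HK] := sqnorm_mul 1 A.
  exists (Num.sqrt K) => _ [v /= v1 <-]; rewrite l2normE ler_wsqrtr// (le_trans (HK v))//.
  rewrite l2normE -sqrtr1 ler_sqrt in v1; last exact: ler01.
  by rewrite -[leRHS]mulr1 ler_wpM2l.
exists u; first by rewrite /= l2normE u1 sqrtr1.
rewrite l2normE Au.
have -> : sqnorm ((d i)%:C *: u) = d i ^+ 2 * sqnorm u.
  rewrite /sqnorm mulr_sumr; apply: eq_bigr => a _; rewrite mulr_sumr; apply: eq_bigr => b _.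
  by rewrite mxE /sqmod ReMr ImM /= mul0r addr0 !exprMn mulrDr.
by rewrite u1 mulr1 sqrtr_sqr.
Qed.

Lemma opnorm_ge0 m (A : 'M[C]_m) : 0 <= opnorm A.
Proof.
apply: ub_le_sup.
  have [K K0 HK] := sqnorm_mul 1 A.
  exists (Num.sqrt K) => _ [v /= v1 <-]; rewrite l2normE ler_wsqrtr// (le_trans (HK v))//.
  rewrite l2normE -sqrtr1 ler_sqrt in v1; last exact: ler01.
  by rewrite -[leRHS]mulr1 ler_wpM2l.
have f0 : sqnorm (0 : 'cV[C]_m) = 0.
  by rewrite /sqnorm big1// => a _; rewrite big1// => b _; rewrite mxE /sqmod /= !expr0n addr0.
by exists 0; rewrite /= ?mulmx0 l2normE f0 sqrtr0//.
Qed.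

Lemma qformD m k (A B : 'M[C]_m) (Y : 'M[C]_(m, k)) : qform (A + B) Y = qform A Y + qform B Y.
Proof. by rewrite /qform mulmxDr mulmxDl mxtraceD ReD. Qed.

Lemma qformN m k (A : 'M[C]_m) (Y : 'M[C]_(m, k)) : qform (- A) Y = - qform A Y.
Proof. by rewrite /qform mulmxN mulNmx linearN /= ReN. Qed.

Lemma qform_sum m k (I : finType) (A : I -> 'M[C]_m) (Y : 'M[C]_(m, k)) :
  qform (\sum_i A i) Y = \sum_i qform (A i) Y.
Proof.
apply: (big_morph (fun B => qform B Y)) => [B B'|]; first exact: qformD.
by rewrite /qform mulmx0 mul0mx mxtrace0.
Qed.

Lemma qform_gram m k l (B : 'M[C]_(l, m)) (Y : 'M[C]_(m, k)) : qform (B^t* *m B) Y = sqnorm (B *m Y).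
Proof. by rewrite /qform sqnorm_Re /frob tcM !mulmxA. Qed.

End ComplexMatrices.

(** * Deterministic lower bound for the comparison process *)

Section Pointwise.
Variable R : realType.
Local Notation C := R[i].

Lemma unitmx_inj n (B : 'M[C]_n) : (forall v : 'cV[C]_n, B *m v = 0 -> v = 0) -> B \in unitmx.
Proof.
move=> H; rewrite -unitmx_tr unitmxE unitfE; apply/negP => /det0P[v v0 vB].
move: v0; rewrite -[v]trmxK (H v^T) ?trmx0 ?eqxx//.
by rewrite -[B]trmxK -trmx_mul vB trmx0.
Qed.

Lemma negdef_factor n (Z : 'M[C]_n) : negdefmx Z -> exists2 B : 'M[C]_n, B \in unitmx &
  - Z = B^t* *m B.
Proof.
move=> [hZ nZ].
have hT : - Z \is hermsymmx by apply/hermP; rewrite tcN; congr (- _); exact/hermP.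
have [v|B TB] := psd_factor hT.
  rewrite mulmxN mulNmx mxE oppr_ge0.
  have [->|v0] := eqVneq v 0; last exact/ltW/nZ.
  by rewrite mulmx0 mxE.
exists B => //; apply: unitmx_inj => v Bv; apply/eqP; apply/negPn/negP => v0.
have := nZ v v0; rewrite -[Z]opprK TB mulmxN mulNmx mulmxA -mulmxA Bv mulmx0 oppr0 mxE ltxx//.
Qed.

Lemma invmxN n (A : 'M[C]_n) : A \in unitmx -> invmx (- A) = - invmx A.
Proof.
move=> uA; have uN : - A \in unitmx by rewrite -scaleN1r unitmxZ ?unitrN1.
by rewrite -[LHS]mulmx1 -(mulmxV uA) mulmxA -[X in _ *m X *m _]opprK mulmxN mulVmx// mulNmx mul1mx.
Qed.

Lemma sqnormN m n (A : 'M[C]_(m, n)) : sqnorm (- A) = sqnorm A.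
Proof.
apply: eq_bigr => i _; apply: eq_bigr => j _.
by rewrite mxE /sqmod ReN ImN !sqrrN.
Qed.

Lemma Retr_sum m (I : finType) (F : I -> 'M[C]_m) :
  complex.Re (\tr (\sum_i F i)) = \sum_i complex.Re (\tr (F i)).
Proof.
apply: (big_morph (fun B => complex.Re (\tr B))) => [B B'|]; last by rewrite mxtrace0.
by rewrite mxtraceD ReD.
Qed.

Variables (n N M : nat) (A : 'I_n -> 'M[C]_N) (X : 'M[C]_(N, M)) (S : 'M[C]_N)
  (W : 'I_n -> 'M[C]_(N, M)) (s : R).
Hypothesis hA : forall i, A i \is hermsymmx.
Hypothesis SX : S *m S^t* = X *m X^t*.
Hypothesis Ws : forall k (Q : 'I_n -> 'M[C]_(N, k)),
  sqnorm (\sum_i (W i)^t* *m Q i) <= s ^+ 2 * \sum_i sqnorm (Q i).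
Hypothesis s0 : 0 < s.

Definition etaform := \sum_i complex.Re (\tr ((W i)^t* *m (S^t* *m A i *m X))).

(** Cyclicity writes [etaform] as the real part of the trace of [B *m X] times [L *m invmx B], and
    [frob_AMGM] separates the factors. [Ws] then removes the [W i], and [SX] turns the remaining
    [S *m S^t*] into [X *m X^t*]. *)
Lemma etaform_bound (B : 'M[C]_N) (c : R) : B \in unitmx -> 0 < c ->
  - 2 * etaform <= c * qform (B^t* *m B) X +
    s ^+ 2 / c * \sum_i qform (A i *m invmx (B^t* *m B) *m A i) X.
Proof.
move=> uB c0.
have uBt : B^t* \in unitmx.
  by rewrite map_unitmx unitmx_tr.
pose L := \sum_i (W i)^t* *m (S^t* *m A i).
have eE : etaform = complex.Re (\tr (B *m X *m (L *m invmx B))).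
  rewrite mxtrace_mulC mulmxA -(mulmxA L) mulVmx// mulmx1 /L mulmx_suml.
  by rewrite Retr_sum; apply: eq_bigr => i _; rewrite !mulmxA.
have c0' : 0 < c%:C :> C by rewrite ltcR.
have := frob_AMGM (- (B *m X)) (L *m invmx B) c0'.
rewrite addJ mulNmx linearN /= ReN -eE -!sqnormC sqnormN -rmorphV ?unitfE ?gt_eqF//.
rewrite -!rmorphM -rmorphD lecR mulrN -mulNr => /le_trans; apply.
rewrite qform_gram lerD2l -mulrA [leRHS]mulrCA ler_wpM2l ?invr_ge0 ?(ltW c0)//.
rewrite /L mulmx_suml; under [X in sqnorm X]eq_bigr do rewrite -mulmxA.
apply: le_trans (Ws _) _; rewrite ler_wpM2l ?sqr_ge0//.
rewrite ler_sum// => i _; rewrite le_eqVlt; apply/orP; left; apply/eqP.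
rewrite sqnorm_Re /frob /qform; congr complex.Re.
have hAi := (hermP _).1 (hA i).
rewrite !tcM trmxCK hAi.
have -> : invmx (B^t* *m B) = invmx B *m (invmx B)^t*.
  have iBt : (invmx B)^t* = invmx (B^t*) by rewrite trmx_inv map_invmx.
  have uu : B^t* *m B \in unitmx by rewrite unitmx_mul uBt.
  apply: (can_inj (mulKmx uu)); rewrite mulmxV//.
  by rewrite mulmxA -(mulmxA (B^t*)) mulmxV// mulmx1 iBt mulmxV.
rewrite !mulmxA -(mulmxA _ S) SX !mulmxA.
transitivity (\tr (((invmx B)^t* *m A i *m X) *m (X^t* *m A i *m invmx B))); first by rewrite !mulmxA.
by rewrite mxtrace_mulC !mulmxA.
Qed.

Lemma pointwise_bound (A0 Z : 'M[C]_N) (m : R) : A0 \is hermsymmx -> negdefmx Z ->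
  sqnorm X = 1 -> 0 < m -> m <= s ->
  lambda_min (A0 + Z + \sum_i A i *m invmx Z *m A i)
    - 2 * Num.sqrt (opnorm (\sum_i A i *m A i)) / m * (s - m) <= qform A0 X + 2 / m * etaform.
Proof.
move=> hA0 hZ X1 m0 ms.
have [B uB ZB] := negdef_factor hZ.
set a := Num.sqrt _; have a0 : 0 <= a by exact: sqrtr_ge0.
have uT : B^t* *m B \in unitmx by rewrite unitmx_mul map_unitmx unitmx_tr uB.
have iZ : invmx Z = - invmx (B^t* *m B).
  by rewrite -(invmxN uT) -ZB opprK.
have hAt i : (A i)^t* = A i by exact/hermP.
have hZt : Z^t* = Z by apply/hermP; case: hZ.
have hH : A0 + Z + \sum_i A i *m invmx Z *m A i \is hermsymmx.
  apply/hermP; rewrite !tcD hZt ((hermP _).1 hA0) tc_sum; congr (_ + _).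
  apply: eq_bigr => i _; rewrite !tcM hAt mulmxA; congr (_ *m _ *m _).
  by rewrite trmx_inv map_invmx hZt.
have := lambda_min_le X hH; rewrite X1 mulr1; set r := lambda_min _.
have trZ : qform Z X = - qform (B^t* *m B) X by rewrite -ZB qformN opprK.
rewrite !qformD trZ qform_sum.
have -> : \sum_i qform (A i *m invmx Z *m A i) X = - \sum_i qform (A i *m invmx (B^t* *m B) *m A i) X.
  rewrite -sumrN; apply: eq_bigr => i _; rewrite iZ mulmxN mulNmx; exact: qformN.
have p1 := etaform_bound uB s0.
set E1 := qform (B^t* *m B) X in p1 *; set E2 := \sum_i qform _ _ in p1 *.
have u1 : (1%:M : 'M[C]_N) \in unitmx by exact: unitmx1.
have one : (1%:M : 'M[C]_N)^t* *m 1%:M = 1%:M by rewrite mulmx1 trmx1 map_mx1.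
have p2 (c : R) : 0 < c -> - 2 * etaform <= c + s ^+ 2 / c * a ^+ 2.
  move=> c0; have := etaform_bound u1 c0; rewrite one.
  have -> : qform 1%:M X = 1 by rewrite -one qform_gram mul1mx.
  rewrite mulr1 => /le_trans; apply; rewrite lerD2l ler_wpM2l//.
    by rewrite mulr_ge0 ?sqr_ge0// invr_ge0 ltW.
  rewrite sqr_sqrtr ?opnorm_ge0// -qform_sum invmx1.
  under eq_bigr do rewrite mulmx1.
  rewrite -[leRHS]mulr1 -X1; apply: opnorm_qform.
  by apply/hermP; rewrite tc_sum; apply: eq_bigr => i _; rewrite tcM hAt.
have p3 : - 2 * etaform <= 2 * a * s.
  have [a1|a1] := ltP 0 a.
    (* [c = s * a] minimizes the right-hand side of [p2]; for [a = 0], [c] tends to 0 instead. *)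
    have := p2 (s * a) (mulr_gt0 s0 a1).
    by rewrite (_ : _ + _ = 2 * a * s)//; field; rewrite !gt_eqF.
  have {a1} az : a = 0 by apply/eqP; rewrite eq_le a1.
  rewrite az mulr0 mul0r; apply/ler_addgt0Pr => e e0.
  by have := p2 e e0; rewrite az expr0n mulr0 addr0 add0r.
rewrite -subr_ge0 => rE.
have {}p1 : - 2 * etaform <= s * (E1 + E2).
  by rewrite (le_trans p1)// mulrDr lerD2l expr2 mulfK// gt_eqF.
set q := - 2 * etaform in p1 p3.
have -> : 2 / m * etaform = - (q / m) by rewrite /q; field; rewrite gt_eqF.
(* The part [q / s] is absorbed by the matrix with [Z], since [c = s] gave [E1] and [E2] the same
   weight; the excess [s - m] is charged to the bound with the identity. *)
have -> : q / m = q / s + q / s * (s - m) / m by field; rewrite !gt_eqF.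
have q1 : q / s <= E1 + E2 by rewrite ler_pdivrMr// mulrC.
have q2 : q / s <= 2 * a by rewrite ler_pdivrMr.
have q3 : q / s * (s - m) / m <= 2 * a / m * (s - m).
  by rewrite [leRHS]mulrAC ler_wpM2r ?invr_ge0 ?(ltW m0)// ler_wpM2r// subr_ge0.
by lra.
Qed.
End Pointwise.

(** * The GUE quadratic form in real coordinates *)

(** Each off-diagonal position is paired with its transpose, the form in which Hermitian symmetry is
    used. *)
Lemma big_tri (V : Type) (idx : V) (op : Monoid.com_law idx) M (F : 'I_M -> 'I_M -> V) :
  \big[op/idx]_j \big[op/idx]_j' F j j' =
  op (\big[op/idx]_j F j j)
     (\big[op/idx]_(j : 'I_M) \big[op/idx]_(j' : 'I_M | (j < j')%N) op (F j j') (F j' j)).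
Proof.
have -> : \big[op/idx]_(j : 'I_M) \big[op/idx]_(j' : 'I_M | (j < j')%N) op (F j j') (F j' j) =
    op (\big[op/idx]_(j : 'I_M) \big[op/idx]_(j' : 'I_M | (j < j')%N) F j j')
       (\big[op/idx]_(j : 'I_M) \big[op/idx]_(j' : 'I_M | (j' < j)%N) F j j').
  rewrite [X in _ = op _ X](exchange_big_dep xpredT)//= -big_split; apply: eq_bigr => j _.
  by rewrite big_split.
rewrite -!big_split; apply: eq_bigr => j _ /=.
rewrite (bigD1 j)//=; congr (op _ _).
rewrite (bigID (fun j' : 'I_M => (j < j')%N)) /=; congr (op _ _); apply: eq_bigl => j'.
  by case: ltnP; rewrite ?andbT ?andbF// => h; rewrite -val_eqE /= gtn_eqF.
by rewrite -val_eqE /= -leqNgt ltn_neqAle.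
Qed.

Section Coordinates2.
Variable R : realType.
Local Notation C := R[i].
Variables (n N M : nat).
Hypothesis M0 : (0 < M)%N.
Let sM : R := Num.sqrt M%:R.
Let s2 : R := Num.sqrt 2.

Lemma sqr_sqrt2 : s2 ^+ 2 = 2. Proof. by rewrite sqr_sqrtr. Qed.
Lemma sqrt2_gt0 : 0 < s2. Proof. by rewrite sqrtr_gt0. Qed.
Lemma sqr_sqrtM : sM ^+ 2 = M%:R. Proof. by rewrite sqr_sqrtr. Qed.
Lemma sM0 : 0 < sM. Proof. by rewrite sqrtr_gt0 ltr0n. Qed.

Local Notation Xidx := ('I_n * 'I_N * bool)%type.
Local Notation VB := {ffun Xidx * 'I_M -> R^o}.

Lemma sum_pair (V : nmodType) (I J : finType) (F : I * J -> V) :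
  \sum_z F z = \sum_i \sum_j F (i, j).
Proof. by rewrite pair_bigA; apply: eq_bigr => -[]. Qed.

Lemma sumX (V : nmodType) (F : Xidx -> V) :
  \sum_z F z = \sum_i \sum_p (F (i, p, true) + F (i, p, false)).
Proof.
rewrite !sum_pair; apply: eq_bigr => i _; apply: eq_bigr => p _.
by rewrite big_bool.
Qed.

Lemma sumXM (V : nmodType) (F : Xidx * 'I_M -> V) :
  \sum_z F z = \sum_i \sum_p \sum_q (F (i, p, true, q) + F (i, p, false, q)).
Proof.
rewrite sum_pair sumX.
by apply: eq_bigr => i _; apply: eq_bigr => p _; rewrite -big_split.
Qed.

(* The real matrix [B] has variance 1, so each entry of [gauss_mx B i] is a standard
   complex Gaussian: real and imaginary parts of variance 1/2. *)
Definition gauss_mx (B : VB) (i : 'I_n) : 'M[C]_(N, M) :=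
  \matrix_(p, q) ((B (i, p, true, q) / s2) +i* (B (i, p, false, q) / s2)).

(** Column by column, the real and imaginary parts of the result come from two real vectors [u1] and
    [u2], both with the norm of the column of [Q]; the [1 / s2] in [gauss_mx] halves the two
    contributions. *)
Lemma gauss_mx_bound (B : VB) (s : R) :
  (forall u : Xidx -> R, \sum_q (\sum_x u x * B (x, q)) ^+ 2 <= s ^+ 2 * \sum_x u x ^+ 2) ->
  forall k (Q : 'I_n -> 'M[C]_(N, k)),
  sqnorm (\sum_i (gauss_mx B i)^t* *m Q i) <= s ^+ 2 * \sum_i sqnorm (Q i).
Proof.
move=> H k Q.
have -> : \sum_i sqnorm (Q i) = \sum_c \sum_i \sum_p sqmod (Q i p c).
  symmetry.
  by rewrite exchange_big; apply: eq_bigr => i _; rewrite exchange_big.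
rewrite /sqnorm exchange_big mulr_sumr; apply: ler_sum => c _ /=.
pose u1 (x : Xidx) := if x.2 then complex.Re (Q x.1.1 x.1.2 c) else complex.Im (Q x.1.1 x.1.2 c).
pose u2 (x : Xidx) := if x.2 then complex.Im (Q x.1.1 x.1.2 c) else - complex.Re (Q x.1.1 x.1.2 c).
have nu1 : \sum_x u1 x ^+ 2 = \sum_i \sum_p sqmod (Q i p c).
  by rewrite sumX; apply: eq_bigr => i _; apply: eq_bigr.
have nu2 : \sum_x u2 x ^+ 2 = \sum_i \sum_p sqmod (Q i p c).
  by rewrite sumX; apply: eq_bigr => i _; apply: eq_bigr => p _; rewrite /u2 /= sqrrN addrC.
have entry q : (\sum_i (gauss_mx B i)^t* *m Q i) q c =
    (s2^-1 * \sum_x u1 x * B (x, q)) +i* (s2^-1 * \sum_x u2 x * B (x, q)).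
  rewrite summxE; apply/eqP; rewrite eq_complex Re_sum Im_sum /=.
  rewrite !sumX !mulr_sumr; apply/andP; split; apply/eqP; apply: eq_bigr => i _.
    rewrite mxE Re_sum mulr_sumr; apply: eq_bigr => p _.
    by rewrite !mxE ReM /u1 /=; ring.
  rewrite mxE Im_sum mulr_sumr; apply: eq_bigr => p _.
  by rewrite !mxE ImM /u2 /=; ring.
under eq_bigr => q _ do rewrite entry /sqmod /= !exprMn exprVn sqr_sqrt2.
rewrite big_split /= -!mulr_sumr.
have := H u1; have := H u2; rewrite nu1 nu2; lra.
Qed.

(** The factor [s2 / sM] is the [2 / sM] of the comparison process times the [1 / s2] of
    [gauss_mx]. *)
Definition bilin_coef (Y : 'I_n -> 'M[C]_(N, M)) (z : Xidx * 'I_M) : R :=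
  s2 / sM * (if z.1.2 then complex.Re (Y z.1.1.1 z.1.1.2 z.2) else complex.Im (Y z.1.1.1 z.1.1.2 z.2)).

Lemma bilin_coef_form Y (B : VB) :
  lform (bilin_coef Y) B = 2 / sM * \sum_i complex.Re (\tr ((gauss_mx B i)^t* *m Y i)).
Proof.
rewrite /lform sumXM mulr_sumr; apply: eq_bigr => i _.
rewrite /mxtrace Re_sum mulr_sumr exchange_big; apply: eq_bigr => q _ /=.
rewrite mxE Re_sum mulr_sumr; apply: eq_bigr => p _.
rewrite !mxE ReM /bilin_coef /= -sqr_sqrt2; field.
by rewrite !gt_eqF ?sM0 ?sqrt2_gt0.
Qed.

Lemma bilin_coef_dist Y Y' :
  \sum_z (bilin_coef Y z - bilin_coef Y' z) ^+ 2 = 2 / M%:R * \sum_i sqnorm (Y i - Y' i).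
Proof.
rewrite sumXM mulr_sumr; apply: eq_bigr => i _.
rewrite /sqnorm mulr_sumr; apply: eq_bigr => p _; rewrite mulr_sumr; apply: eq_bigr => q _.
rewrite /bilin_coef /= -!mulrBr !exprMn exprVn sqr_sqrt2 sqr_sqrtM -mulrDr !mxE /sqmod ReD ImD ReN ImN//.
Qed.

(* Coordinates of a Hermitian matrix in an orthonormal real basis: the upper triangle
   holds real parts and the lower triangle imaginary parts. [gue_coord] below uses the
   same indexing for the matrices [G_i]. *)
Definition herm_coord (D : 'M[C]_M) (j j' : 'I_M) : R :=
  if j == j' then complex.Re (D j j')
  else if (j < j')%N then s2 * complex.Re (D j j') else s2 * complex.Im (D j j').

Lemma hermE (D : 'M[C]_M) j j' : D^t* = D -> D j' j = (D j j')^*.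
Proof. by move=> h; rewrite -{1}h !mxE. Qed.

Lemma herm_Im0 (D : 'M[C]_M) j : D^t* = D -> complex.Im (D j j) = 0.
Proof.
move=> hD; have /eqP : complex.Im (D j j) = - complex.Im (D j j) by rewrite {1}(hermE j j hD) ImJ.
by rewrite -addr_eq0 -mulr2n mulrn_eq0 /= => /eqP.
Qed.

Lemma herm_coord_sqnorm (D : 'M[C]_M) : D^t* = D -> \sum_j \sum_j' herm_coord D j j' ^+ 2 = sqnorm D.
Proof.
move=> hD; rewrite /sqnorm !big_tri /=; congr (_ + _).
  apply: eq_bigr => j _; rewrite /herm_coord eqxx /sqmod.
  by rewrite (herm_Im0 j hD) expr0n addr0.
apply: eq_bigr => j _; apply: eq_bigr => j' jj'.
have ne : (j == j') = false by rewrite -val_eqE /= ltn_eqF.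
rewrite /herm_coord ne (eq_sym j') ne jj' ltnNge (ltnW jj') /= (hermE j j' hD) /sqmod ReJ ImJ.
by rewrite !exprMn !sqrrN sqr_sqrt2; ring.
Qed.

Lemma herm_coordB (D D' : 'M[C]_M) j j' : herm_coord (D - D') j j' = herm_coord D j j' - herm_coord D' j j'.
Proof.
rewrite /herm_coord; case: ifP => _; first by rewrite !mxE ReD ReN.
by case: ifP => _; rewrite !mxE -mulrBr ?ReD ?ReN ?ImD ?ImN.
Qed.

Local Notation Kidx := ('I_n * ('I_M * 'I_M))%type.

Lemma sumK (F : Kidx -> R) : \sum_k F k = \sum_i \sum_j \sum_j' F (i, (j, j')).
Proof.
by rewrite sum_pair; apply: eq_bigr => i _; rewrite sum_pair.
Qed.

Definition gue_coef (D : 'I_n -> 'M[C]_M) (k : Kidx) : R := sM^-1 * herm_coord (D k.1) k.2.1 k.2.2.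

Lemma gue_coef_dist D D' : (forall i, (D i)^t* = D i) -> (forall i, (D' i)^t* = D' i) ->
  \sum_k (gue_coef D k - gue_coef D' k) ^+ 2 = M%:R^-1 * \sum_i sqnorm (D i - D' i).
Proof.
move=> hD hD'; rewrite sumK mulr_sumr; apply: eq_bigr => i _.
rewrite -herm_coord_sqnorm; last by rewrite tcB hD hD'.
rewrite mulr_sumr; apply: eq_bigr => j _; rewrite mulr_sumr; apply: eq_bigr => j' _.
by rewrite /gue_coef /= -mulrBr exprMn exprVn sqr_sqrtM herm_coordB.
Qed.

Definition gue_coord (G : 'I_n -> 'M[C]_M) (k : Kidx) : R :=
  if k.2.1 == k.2.2 then complex.Re (G k.1 k.2.1 k.2.2)
  else if (k.2.1 < k.2.2)%N then complex.Re (G k.1 k.2.1 k.2.2)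
  else complex.Im (G k.1 k.2.2 k.2.1).

Definition gue_std (k : Kidx) : R := if k.2.1 == k.2.2 then 1 else Num.sqrt 2^-1.

(** Off the diagonal [1 / gue_std] and [herm_coord] contribute a factor [s2] each; their product 2
    accounts for the positions [(j, j')] and [(j', j)]. The minus sign of the imaginary parts comes
    from reading [D] below the diagonal and [G] above it. *)
Lemma gue_coef_form (D G : 'I_n -> 'M[C]_M) : (forall i, (D i)^t* = D i) -> (forall i, (G i)^t* = G i) ->
  lform (gue_coef D) [ffun k => gue_coord G k / gue_std k] =
  sM^-1 * \sum_i complex.Re (\sum_j \sum_j' G i j j' * D i j j').
Proof.
move=> hD hG; rewrite /lform sumK mulr_sumr; apply: eq_bigr => i _.
have -> : complex.Re (\sum_j \sum_j' G i j j' * D i j j') = \sum_j \sum_j' complex.Re (G i j j' * D i j j').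
  by rewrite Re_sum; apply: eq_bigr => j _; rewrite Re_sum.
rewrite (eq_bigr (fun j => \sum_j' sM^-1 * (herm_coord (D i) j j' *
    (gue_coord G (i, (j, j')) / gue_std (i, (j, j')))))); last first.
  by move=> j _; apply: eq_bigr => j' _; rewrite ffunE /gue_coef /= -mulrA.
rewrite (eq_bigr (fun j => sM^-1 * \sum_j' (herm_coord (D i) j j' *
    (gue_coord G (i, (j, j')) / gue_std (i, (j, j')))))); last by move=> j _; rewrite mulr_sumr.
rewrite -mulr_sumr; congr (_ * _); rewrite !big_tri /=; congr (_ + _).
  apply: eq_bigr => j _; rewrite /herm_coord /gue_coord /gue_std /= !eqxx divr1 ReM mulrC.
  by rewrite (herm_Im0 j (hD i)) mulr0 subr0.
apply: eq_bigr => j _; apply: eq_bigr => j' jj'.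
have ne : (j == j') = false by rewrite -val_eqE /= ltn_eqF.
rewrite /herm_coord /gue_coord /gue_std /= ne (eq_sym j') ne jj' ltnNge (ltnW jj') /=.
rewrite (hermE j j' (hD i)) (hermE j j' (hG i)) sqrtrV ?ler0n// invrK -/s2.
rewrite !ReM !ReJ !ImJ.
rewrite [LHS](_ : _ = s2 ^+ 2 * (complex.Re (D i j j') * complex.Re (G i j j') -
  complex.Im (D i j j') * complex.Im (G i j j'))); last by ring.
by rewrite sqr_sqrt2; ring.
Qed.

Definition unvec (x : 'cV[C]_(N * M)) : 'M[C]_(N, M) := \matrix_(i, j) x (mxtens_index (i, j)) 0.

Lemma sum_tens (V : nmodType) (F : 'I_(N * M) -> V) :
  \sum_k F k = \sum_i \sum_j F (mxtens_index (i, j)).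
Proof.
rewrite pair_bigA /= (reindex (@mxtens_index N M)) /=; last first.
  by exists (@mxtens_unindex N M) => ? _; rewrite ?mxtens_indexK ?mxtens_unindexK.
by apply: eq_bigr => -[].
Qed.

Lemma sqnorm_unvec x : sqnorm (unvec x) = sqnorm x.
Proof.
rewrite {2}/sqnorm sum_tens; apply: eq_bigr => i _; apply: eq_bigr => j _.
by rewrite big_ord1 mxE.
Qed.

Lemma qform_cv m (A : 'M[C]_m) (x : 'cV[C]_m) :
  qform A x = complex.Re (\sum_p \sum_q (x p 0)^* * A p q * x q 0).
Proof.
rewrite /qform /mxtrace big_ord1 mxE exchange_big; congr complex.Re; apply: eq_bigr => q _.
by rewrite mxE mulr_suml; apply: eq_bigr => p _; rewrite !mxE.
Qed.

(** [G] is paired entrywise, not by a matrix product: this is where the transpose of [G_i] in the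
    process comes from. *)
Lemma qform_tens (A : 'M[C]_N) (G : 'M[C]_M) x :
  qform (tensmx A G) x =
  complex.Re (\sum_j \sum_j' G j j' * ((unvec x)^t* *m A *m unvec x) j j').
Proof.
rewrite qform_cv sum_tens; congr complex.Re.
under eq_bigr => i _ do under eq_bigr => j _ do rewrite sum_tens.
rewrite exchange_big /=; apply: eq_bigr => j _.
rewrite (eq_bigr (fun i => \sum_j' \sum_i' (x (mxtens_index (i, j)) 0)^* * (A i i' * G j j') * x (mxtens_index (i', j')) 0)); last first.
  move=> i _; rewrite exchange_big; apply: eq_bigr => j' _; apply: eq_bigr => i' _.
  by rewrite tensmxE.
rewrite exchange_big; apply: eq_bigr => j' _ /=.
rewrite mxE mulr_sumr exchange_big; apply: eq_bigr => i' _.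
rewrite mxE mulr_suml mulr_sumr; apply: eq_bigr => i _.
by rewrite !mxE; ring.
Qed.

Lemma qformZ m k (c : R) (A : 'M[C]_m) (Y : 'M[C]_(m, k)) : qform (c%:C *: A) Y = c * qform A Y.
Proof. by rewrite /qform -scalemxAr -scalemxAl mxtraceZ ReMr. Qed.

Lemma qform_tens1 (A : 'M[C]_N) x : qform (tensmx A (1%:M : 'M[C]_M)) x = qform A (unvec x).
Proof.
rewrite qform_tens /qform; congr complex.Re; apply: eq_bigr => j _.
rewrite (bigD1 j)//= big1 ?addr0 => [|j' /negbTE jj']; first by rewrite mxE eqxx mul1r.
by rewrite mxE eq_sym jj' mul0r.
Qed.

Lemma HM_qform (A0 : 'M[C]_N) (A : 'I_n -> 'M[C]_N) (d : measure_display) (T : measurableType d) (G : 'I_n -> T -> 'M[C]_M) (w : T) x :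
  (forall i, (A i)^t* = A i) -> (forall i, (G i w)^t* = G i w) ->
  qform (HM A0 A G w) x = qform A0 (unvec x) +
   lform (gue_coef (fun i => (unvec x)^t* *m A i *m unvec x)) [ffun k => gue_coord (G ^~ w) k / gue_std k].
Proof.
move=> hA hG; rewrite gue_coef_form//; last first.
  by move=> i; rewrite !tcM trmxCK hA mulmxA.
rewrite /HM qformD qform_tens1 qformZ qform_sum; congr (_ + _ * _).
by apply: eq_bigr => i _; rewrite qform_tens.
Qed.

Lemma tens_tc (A : 'M[C]_N) (G : 'M[C]_M) : (tensmx A G)^t* = tensmx (A^t*) (G^t*).
Proof. by apply/matrixP => i j; rewrite !mxE rmorphM. Qed.

Lemma HM_herm (A0 : 'M[C]_N) (A : 'I_n -> 'M[C]_N) (d : measure_display) (T : measurableType d) (G : 'I_n -> T -> 'M[C]_M) (w : T) :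
  A0^t* = A0 -> (forall i, (A i)^t* = A i) -> (forall i, (G i w)^t* = G i w) ->
  HM A0 A G w \is hermsymmx.
Proof.
move=> hA0 hA hG; apply/hermP; rewrite /HM tcD tcZ tc_sum tens_tc hA0 trmx1 map_mx1.
congr (_ + _).
rewrite [X in X *: _](_ : _ = (sM^-1)%:C); last by apply/eqP; rewrite eq_complex ReJ ImJ /= oppr0 !eqxx.
by congr (_ *: _); apply: eq_bigr => i _; rewrite tens_tc hA hG.
Qed.

End Coordinates2.

(** * Independence of the real coordinates of the GUE matrices *)

Section GUEFlatten.
Local Open Scope ereal_scope.
Context d (T : measurableType d) (R : realType) (P : probability T R).
Variables (n M : nat) (G : 'I_n -> T -> 'M[R[i]]_M).
Hypothesis hG : forall i, is_GUE P (G i).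
Hypothesis hGind : independent P (fun i => sigma_matrix (G i)).

Local Notation Kidx := ('I_n * ('I_M * 'I_M))%type.
Local Notation g := (fun (k : Kidx) (w : T) => gue_coord (G ^~ w) k).

Variant ord_spec (j j' : 'I_M) : bool -> bool -> Prop :=
| OrdEq of j = j' : ord_spec j j' true false
| OrdLt of (j < j')%N : ord_spec j j' false true
| OrdGt of (j' < j)%N : ord_spec j j' false false.

Lemma ordP j j' : ord_spec j j' (j == j') (j < j')%N.
Proof.
case: (ltngtP j j') => h.
- by rewrite -val_eqE /= ltn_eqF//; constructor.
- by rewrite -val_eqE /= gtn_eqF//; constructor.
- by rewrite (val_inj h) eqxx; constructor.
Qed.

Lemma gue_coord_law k : normal_law P (g k) 0 (gue_std R k).
Proof.
case: k => i [j j']; rewrite /gue_coord /gue_std /=; case: (ordP j j') => [->|h|h].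
- exact: GUE_diagonal.
- exact: GUE_off_diagonal_Re.
- exact: GUE_off_diagonal_Im.
Qed.

Lemma gue_std_gt0 (k : Kidx) : (0 < gue_std R k)%R.
Proof. by rewrite /gue_std; case: ifP; rewrite // sqrtr_gt0 invr_gt0. Qed.

Section Entries.
Variables (i : 'I_n) (B : 'I_M * 'I_M -> set R).
Hypothesis mB : forall jj, measurable (B jj).

(** The constraint on one entry on or above the diagonal. In line with [gue_coord], its imaginary
    part is governed by the set at the transposed index. *)
Definition entry_event (p : 'I_M * 'I_M) : set T :=
  if p.1 == p.2 then (fun w => complex.Re (G i w p.1 p.2)) @^-1` B p
  else (fun w => complex.Re (G i w p.1 p.2)) @^-1` B p `&`
       (fun w => complex.Im (G i w p.1 p.2)) @^-1` B (p.2, p.1).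

Lemma sigma_complex_Re (Z : T -> R[i]) (A : set R) : measurable A ->
  sigma_complex Z ((fun w => complex.Re (Z w)) @^-1` A).
Proof.
by move=> mA; apply: sub_sigma_algebra; left; exists A => //; rewrite setTI.
Qed.

Lemma sigma_complex_Im (Z : T -> R[i]) (A : set R) : measurable A ->
  sigma_complex Z ((fun w => complex.Im (Z w)) @^-1` A).
Proof.
by move=> mA; apply: sub_sigma_algebra; right; exists A => //; rewrite setTI.
Qed.

Lemma entry_event_sigma p : sigma_complex (fun w => G i w p.1 p.2) (entry_event p).
Proof.
rewrite /entry_event; case: ifP => _; first exact: sigma_complex_Re.
apply: (@measurableI _ (g_sigma_algebraType
  (sigma_real (fun w => complex.Re (G i w p.1 p.2)) `|` sigma_real (fun w => complex.Im (G i w p.1 p.2))))).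
- exact: sigma_complex_Re.
- exact: sigma_complex_Im.
Qed.

Lemma entry_event_prob (p : 'I_M * 'I_M) : (p.1 <= p.2)%N ->
  P (entry_event p) = if p.1 == p.2 then normal_prob 0 (gue_std R (i, p)) (B p)
    else normal_prob 0 (gue_std R (i, p)) (B p) * normal_prob 0 (gue_std R (i, (p.2, p.1))) (B (p.2, p.1)).
Proof.
case: p => j j' /=; rewrite /entry_event /gue_std /=.
case: (ordP j j') => [<-|h|h] le; last by rewrite leqNgt h in le.
  by rewrite (GUE_diagonal (hG i) j).2.
rewrite eq_sym -val_eqE /= ltn_eqF//.
have := GUE_off_diagonal_independent (hG i) h.
move=> /(_ [set: bool]%SET (fun b => if b then (fun w => complex.Re (G i w j j')) @^-1` B (j, j')
   else (fun w => complex.Im (G i w j j')) @^-1` B (j', j))).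
move=> /(_ _)/wrap[|].
  by case=> _; [exists (B (j, j'))|exists (B (j', j))] => //; rewrite setTI.
have -> : \bigcap_(b in [set` [set: bool]%SET]) (if b then (fun w => complex.Re (G i w j j')) @^-1` B (j, j')
   else (fun w => complex.Im (G i w j j')) @^-1` B (j', j)) = (fun w => complex.Re (G i w j j')) @^-1` B (j, j')
   `&` (fun w => complex.Im (G i w j j')) @^-1` B (j', j).
  apply/seteqP; split=> w /= H; last by move=> [] _; case: H.
  by split; [apply: (H true)|apply: (H false)] => /=; rewrite inE.
move=> ->; rewrite (eq_bigl xpredT) ?big_bool => [|b]; last by rewrite finset.in_setT.
by rewrite (GUE_off_diagonal_Re (hG i) h).2// (GUE_off_diagonal_Im (hG i) h).2.
Qed.

Lemma bigcap_entry : \bigcap_jj (g (i, jj) @^-1` B jj) =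
  \bigcap_(p in [set` [set: {p : 'I_M * 'I_M | (p.1 <= p.2)%N}]%SET]) entry_event (val p).
Proof.
apply/seteqP; split=> w /= H.
  move=> [[j j'] /= le] _; rewrite /entry_event /=.
  have := H (j, j') I; have := H (j', j) I; rewrite /gue_coord /= (eq_sym j').
  case: (ordP j j') le => [<-|h|h] /= le; last by rewrite leqNgt h in le.
    by [].
  by rewrite ltnNge (ltnW h).
move=> [j j'] _; rewrite /gue_coord /=.
case: (ordP j j') => [->|h|h].
- have := H (exist _ (j', j') (leqnn _)); rewrite /entry_event /= eqxx; apply; exact: finset.in_setT.
- have := H (exist _ (j, j') (ltnW h)); rewrite /entry_event /= -val_eqE /= ltn_eqF//.
  by move=> /(_ (finset.in_setT _))[].
- have := H (exist _ (j', j) (ltnW h)); rewrite /entry_event /= -val_eqE /= ltn_eqF//.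
  by move=> /(_ (finset.in_setT _))[].
Qed.

(** Independence across entries, then of real and imaginary part within an entry; [big_tri] matches
    the product over the upper triangle with the one over all index pairs. *)
Lemma prob_entries : P (\bigcap_jj (g (i, jj) @^-1` B jj)) =
  \prod_jj normal_prob 0 (gue_std R (i, jj)) (B jj).
Proof.
rewrite bigcap_entry.
rewrite (GUE_independent_entries (hG i)); last by move=> p _; exact: entry_event_sigma.
rewrite (eq_bigl xpredT); last by move=> p; rewrite finset.in_setT.
rewrite -(big_sub (fun p : 'I_M * 'I_M => (p.1 <= p.2)%N) (fun p => P (entry_event p))).
rewrite [RHS](eq_bigr (fun p => normal_prob 0 (gue_std R (i, (p.1, p.2))) (B (p.1, p.2)))); last by case.
rewrite -(pair_bigA _ (fun j j' => normal_prob 0 (gue_std R (i, (j, j'))) (B (j, j')))) big_tri /=.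
rewrite (eq_bigr (fun p : 'I_M * 'I_M => P (entry_event (p.1, p.2)))); last by case.
rewrite -(pair_big_dep xpredT (fun j j' : 'I_M => (j <= j')%N) (fun j j' => P (entry_event (j, j')))) /=.
rewrite -big_split; apply: eq_bigr => j _.
rewrite (bigD1 j)//= entry_event_prob//= eqxx; congr (_ * _).
rewrite (eq_bigl (fun j' : 'I_M => (j < j')%N)); last first.
  by move=> j'; rewrite -val_eqE /= andbC eq_sym -ltn_neqAle.
apply: eq_bigr => j' jj'; rewrite entry_event_prob ?(ltnW jj')//=.
by rewrite -val_eqE /= ltn_eqF.
Qed.

Lemma sigma_matrix_entries : sigma_matrix (G i) (\bigcap_jj (g (i, jj) @^-1` B jj)).
Proof.
rewrite bigcap_entry.
apply: (@fin_bigcap_measurable _ (g_sigma_algebraType (\bigcup_(p in [set: 'I_M * 'I_M])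
        sigma_complex (fun w => G i w p.1 p.2)))) => //.
move=> p _; apply: sub_sigma_algebra; exists (val p) => //.
exact: entry_event_sigma.
Qed.

End Entries.

Lemma gue_coord_independent (B : Kidx -> set R) : (forall k, measurable (B k)) ->
  P (\bigcap_k (g k @^-1` B k)) = \prod_k normal_prob 0 (gue_std R k) (B k).
Proof.
move=> mB.
have -> : \bigcap_k (g k @^-1` B k) =
    \bigcap_(i in [set` [set: 'I_n]%SET]) \bigcap_jj (g (i, jj) @^-1` B (i, jj)).
  apply/seteqP; split=> w /= H; first by move=> i _ jj _; apply: H.
  by move=> [i jj] _; apply: (H i) => //=; rewrite finset.in_setT.
rewrite hGind; last by move=> i _; exact: (sigma_matrix_entries (fun jj => mB (i, jj))).
rewrite (eq_bigl xpredT); last by move=> p; rewrite finset.in_setT.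
rewrite (eq_bigr (fun i => \prod_jj normal_prob 0 (gue_std R (i, jj)) (B (i, jj)))); last first.
  by move=> i _; exact: (prob_entries i (fun jj => mB (i, jj))).
by rewrite pair_bigA; apply: eq_bigr => -[].
Qed.

End GUEFlatten.

(** * From Gaussian means to expectations on the probability space *)

Section Expectation.
Local Open Scope ereal_scope.
Context d (T : measurableType d) (R : realType) (P : probability T R).

(** The integral of a nonnegative function is a supremum over the simple functions below it, so it
    is monotone for arbitrary functions; this is what allows the smallest eigenvalue as
    integrand. *)
Lemma le_nnint (f g : T -> \bar R) : (forall w, 0 <= f w) -> (forall w, f w <= g w) ->
  \int[P]_w f w <= \int[P]_w g w.
Proof.
move=> f0 fg; have g0 w : 0 <= g w by exact: le_trans (f0 w) (fg w).
rewrite !ge0_integralE//; apply: le_ereal_sup => _ [h hf <-]; exists h => //= x.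
by apply: le_trans (hf x) _; rewrite !patch_setT.
Qed.

(** Positive and negative parts are compared separately, since the expectation of [L] is the
    difference of their integrals in the extended reals. *)
Lemma Ex_le_expectation (X : finType) (g : X -> T -> R) (sig : X -> R) (F : {ffun X -> R^o} -> R)
  (L : T -> R) :
  (forall x, (0 < sig x)%R) -> (forall x, measurable_fun setT (g x)) ->
  (forall B : X -> set R, (forall x, measurable (B x)) ->
    P (\bigcap_x (g x @^-1` B x)) = \prod_x normal_prob 0 (sig x) (B x)) ->
  dirlip F -> (forall w, (F [ffun x => (g x w / sig x)%R] <= L w)%R) -> (Ex F)%:E <= 'E_P[L].
Proof.
move=> sig0 mg ind FL FleL; rewrite unlock integralE.
have FpL := dirlip_max FL (dirlip_cst 0%R).
have FnL := dirlip_max (dirlip_opp FL) (dirlip_cst 0%R).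
have -> : Ex F = (Ex (fun y => Num.max (F y) 0) - Ex (fun y => Num.max (- F y) 0))%R.
  rewrite -mulN1r -ExZ// -ExD//; last exact: dirlipZ.
  by congr Ex; apply/funext => y; rewrite mulN1r /Num.max; case: (ltP (F y) 0%R) => ?; case: (ltP (- F y)%R 0%R) => ?; lra.
rewrite EFinB; apply: leeB.
  rewrite -(integral_Ex_ge0 sig0 mg ind FpL); last by move=> y; rewrite le_max lexx orbT.
  apply: le_nnint => w; first by rewrite lee_fin le_max lexx orbT.
  by rewrite funeposE -EFin_max lee_fin ge_max !le_max lexx FleL orbT.
rewrite -(integral_Ex_ge0 sig0 mg ind FnL); last by move=> y; rewrite le_max lexx orbT.
apply: le_nnint => w; first by rewrite funenegE le_max lexx orbT.
by rewrite funenegE -EFinN -EFin_max lee_fin ge_max !le_max lexx lerN2 FleL orbT.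
Qed.

End Expectation.

(** * Entrywise norms and perturbation of quadratic forms *)

Section Entrywise.
Variable R : realType.
Local Notation C := R[i].

(** An [l^1] modulus with values in [R]: submultiplicative and free of square roots, at the price of
    constant factors. *)
Definition abs1 (z : C) : R := `|complex.Re z| + `|complex.Im z|.

Lemma abs1_ge0 z : 0 <= abs1 z. Proof. by rewrite addr_ge0. Qed.

Lemma abs1D z w : abs1 (z + w) <= abs1 z + abs1 w.
Proof. by rewrite /abs1 ReD ImD addrACA lerD// ler_normD. Qed.

Lemma abs1J (z : C) : abs1 z^* = abs1 z. Proof. by rewrite /abs1 ReJ ImJ normrN. Qed.

Lemma abs1M z w : abs1 (z * w) <= abs1 z * abs1 w.
Proof.
rewrite /abs1 ReM ImM.
apply: (le_trans (lerD (ler_normB _ _) (ler_normD _ _))); rewrite !normrM.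
by rewrite le_eqVlt; apply/orP; left; apply/eqP; ring.
Qed.

Lemma abs1_sum (I : finType) (F : I -> C) : abs1 (\sum_i F i) <= \sum_i abs1 (F i).
Proof.
elim/big_ind2 : _ => //; first by rewrite /abs1 !normr0 addr0.
by move=> x a y b xa yb; exact: le_trans (abs1D _ _) (lerD xa yb).
Qed.

Lemma Re_abs1 z : `|complex.Re z| <= abs1 z. Proof. by rewrite lerDl. Qed.

Lemma abs1_sqmod z t : 0 <= t -> sqmod z <= t ^+ 2 -> abs1 z <= 2 * t.
Proof.
move=> t0; rewrite /sqmod /abs1 => h.
have H (x y : R) : x ^+ 2 + y ^+ 2 <= t ^+ 2 -> `|x| <= t.
  move=> {}h; rewrite -(ler_pXn2r (n := 2))// ?nnegrE//.
  by rewrite real_normK ?num_real//; apply: le_trans h; rewrite lerDl sqr_ge0.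
have := H _ _ h; have := H _ _ (le_trans (_ : _ <= _) h).
move=> /(_ (complex.Im z) (complex.Re z)).
by rewrite addrC lexx => /(_ isT); lra.
Qed.

Lemma sqmod_le_sqnorm m k (A : 'M[C]_(m, k)) i j : sqmod (A i j) <= sqnorm A.
Proof.
have s0 (z : C) : 0 <= sqmod z by rewrite addr_ge0 ?sqr_ge0.
rewrite /sqnorm (bigD1 i)//= (bigD1 j)//= -addrA lerDl addr_ge0 ?sumr_ge0// => i' _.
by rewrite sumr_ge0.
Qed.

Definition entry_norm m k (A : 'M[C]_(m, k)) : R := \sum_i \sum_j abs1 (A i j).

Lemma entry_norm_ge0 m k (A : 'M[C]_(m, k)) : 0 <= entry_norm A.
Proof. by rewrite sumr_ge0// => i _; rewrite sumr_ge0// => j _; exact: abs1_ge0. Qed.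

Lemma entry_normD m k (A B : 'M[C]_(m, k)) : entry_norm (A + B) <= entry_norm A + entry_norm B.
Proof.
rewrite -big_split; apply: ler_sum => i _; rewrite -big_split; apply: ler_sum => j _.
by rewrite mxE abs1D.
Qed.

Lemma entry_norm_sum m k (I : finType) (F : I -> 'M[C]_(m, k)) : entry_norm (\sum_i F i) <= \sum_i entry_norm (F i).
Proof.
elim/big_ind2 : _ => //; last by move=> x a y b xa yb; exact: le_trans (entry_normD _ _) (lerD xa yb).
by rewrite /entry_norm big1// => i _; rewrite big1// => j _; rewrite mxE /abs1 !normr0 addr0.
Qed.

Lemma entry_normZ m k (c : R) (A : 'M[C]_(m, k)) : 0 <= c -> entry_norm (c%:C *: A) <= c * entry_norm A.
Proof.
move=> c0; rewrite mulr_sumr; apply: ler_sum => i _; rewrite mulr_sumr; apply: ler_sum => j _.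
by rewrite mxE (le_trans (abs1M _ _))// {1}/abs1 /= normr0 addr0 ger0_norm.
Qed.

Lemma entry_norm_tens m k (A : 'M[C]_m) (B : 'M[C]_k) : entry_norm (tensmx A B) <= entry_norm A * entry_norm B.
Proof.
rewrite /entry_norm sum_tens.
rewrite (eq_bigr (fun i => \sum_j \sum_i' \sum_j' abs1 (tensmx A B (mxtens_index (i, j)) (mxtens_index (i', j')))));
  last by move=> i _; apply: eq_bigr => j _; rewrite sum_tens.
rewrite mulr_suml; apply: ler_sum => i _; rewrite mulr_sumr; apply: ler_sum => j _.
rewrite mulr_suml; apply: ler_sum => i' _; rewrite mulr_sumr; apply: ler_sum => j' _.
by rewrite tensmxE abs1M.
Qed.

(** Split the difference as [v^* H (v - x) + (v - x)^* H x]. In [abs1] the entries of unit vectors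
    are at most 2 and those of [v - x] at most [2 * e], so each term costs [4 * e] per entry of
    [H]. *)
Lemma qform_perturb m (H : 'M[C]_m) (v x : 'cV[C]_m) (e : R) : 0 <= e -> sqnorm v = 1 -> sqnorm x = 1 ->
  sqnorm (v - x) <= e ^+ 2 -> qform H x - 8 * e * entry_norm H <= qform H v.
Proof.
move=> e0 v1 x1 vx.
have abx p : abs1 (x p 0) <= 2 by rewrite -[2]mulr1 abs1_sqmod// expr1n -x1 sqmod_le_sqnorm.
have abv p : abs1 (v p 0) <= 2 by rewrite -[2]mulr1 abs1_sqmod// expr1n -v1 sqmod_le_sqnorm.
have abd p : abs1 (v p 0 - x p 0) <= 2 * e.
  rewrite abs1_sqmod//; apply: le_trans vx.
  by have := sqmod_le_sqnorm (v - x) p 0; rewrite !mxE.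
suff : `|qform H v - qform H x| <= 8 * e * entry_norm H by rewrite ler_norml; lra.
rewrite !qform_cv -ReN -ReD.
have -> : \sum_p \sum_q (v p 0)^* * H p q * v q 0 - \sum_p \sum_q (x p 0)^* * H p q * x q 0 =
   \sum_p \sum_q ((v p 0)^* * H p q * (v q 0 - x q 0) + (v p 0 - x p 0)^* * H p q * x q 0).
  rewrite -sumrB; apply: eq_bigr => p _; rewrite -sumrB; apply: eq_bigr => q _.
  by rewrite rmorphB /=; ring.
apply: le_trans (Re_abs1 _) _; apply: le_trans (abs1_sum _) _.
rewrite mulr_sumr; apply: ler_sum => p _; apply: le_trans (abs1_sum _) _.
rewrite mulr_sumr; apply: ler_sum => q _; apply: le_trans (abs1D _ _) _.
have h0 := abs1_ge0 (H p q).
have -> : 8 * e * abs1 (H p q) = 2 * abs1 (H p q) * (2 * e) + 2 * e * abs1 (H p q) * 2 by ring.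
apply: lerD; apply: le_trans (abs1M _ _) _; apply: ler_pM; rewrite ?abs1_ge0//;
  by apply: le_trans (abs1M _ _) _; rewrite abs1J ler_wpM2r.
Qed.

Lemma qform0 m (A : 'M[C]_m) (v : 'cV[C]_m) : sqnorm v = 0 -> qform A v = 0.
Proof.
move=> v0; have -> : v = 0; last by rewrite /qform mulmx0 mxtrace0.
apply/matrixP => i j; rewrite mxE.
have := sqmod_le_sqnorm v i j; rewrite v0 /sqmod.
case: (v i j) => a b /= h; have := sqr_ge0 a; have := sqr_ge0 b => hb ha.
have /eqP : a ^+ 2 = 0 by lra.
have /eqP : b ^+ 2 = 0 by lra.
by rewrite !sqrf_eq0 => /eqP-> /eqP->.
Qed.

Lemma sqnormZ m k (c : R) (A : 'M[C]_(m, k)) : sqnorm (c%:C *: A) = c ^+ 2 * sqnorm A.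
Proof.
rewrite /sqnorm mulr_sumr; apply: eq_bigr => i _; rewrite mulr_sumr; apply: eq_bigr => j _.
by rewrite mxE /sqmod ReM ImM /=; ring.
Qed.

Lemma qform_scale m k (c : R) (A : 'M[C]_m) (Y : 'M[C]_(m, k)) : qform A (c%:C *: Y) = c ^+ 2 * qform A Y.
Proof.
rewrite /qform tcZ -scalemxAr -!scalemxAl !mxtraceZ !ReM ?ReJ ?ImJ /=; ring.
Qed.

Lemma lambda_min_ge1 m (A : 'M[C]_m) (c : R) : (0 < m)%N -> A \is hermsymmx ->
  (forall v : 'cV[C]_m, sqnorm v = 1 -> c <= qform A v) -> c <= lambda_min A.
Proof.
move=> m0 hA H; apply: lambda_min_ge => // v.
have := sqnorm_ge0 v; rewrite le_eqVlt => /orP[/eqP v0|v0].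
  by rewrite -v0 mulr0 qform0.
have t0 : 0 < Num.sqrt (sqnorm v) by rewrite sqrtr_gt0.
have t2 : Num.sqrt (sqnorm v) ^+ 2 = sqnorm v by rewrite sqr_sqrtr// ltW.
have := H ((Num.sqrt (sqnorm v))^-1%:C *: v); rewrite sqnormZ qform_scale exprVn t2.
by rewrite mulVf ?gt_eqF// => /(_ erefl); rewrite mulrC ler_pdivlMr.
Qed.

Lemma dirlip_lform_norm (X : finType) (al : X -> R) : dirlip (fun y => `|lform al y|).
Proof.
move=> v; exists `|lform al v| => y x; rewrite linearD linearZ.
apply: le_trans (ler_dist_dist _ _) _.
by rewrite addrAC subrr add0r normrM mulrC.
Qed.

End Entrywise.

(** * The lower bound *)

Section Assembly.
Variable R : realType.
Local Notation C := R[i].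
Variables (n N M : nat).
Hypotheses (hn : (0 < n)%N) (hN : (0 < N)%N) (hM : (0 < M)%N).
Variables (A0 : 'M[C]_N) (A : 'I_n -> 'M[C]_N).
Hypothesis hA0 : A0 \is hermsymmx.
Hypothesis hA : forall i, possemidefmx (A i).
Let sM : R := Num.sqrt M%:R.
Local Notation Kidx := ('I_n * ('I_M * 'I_M))%type.
Local Notation VK := {ffun Kidx -> R^o}.

(* Controls the error made by restricting the sphere to a net. *)
Definition entry_bound (y : VK) : R :=
  entry_norm (tensmx A0 (1%:M : 'M[C]_M)) +
  sM^-1 * (2 * \sum_i entry_norm (A i)) * \sum_k `|y k|.

Lemma entry_bound_dirlip : dirlip entry_bound.
Proof.
apply: dirlipD; first exact: dirlip_cst.
apply: dirlipZ.
suff H (r : seq Kidx) : dirlip (fun y : VK => \sum_(k <- r) `|y k|) by exact: H.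
elim: r => [|k r IH].
  by rewrite (_ : (fun _ => _) = fun=> 0); [exact: dirlip_cst|apply/funext => y; rewrite big_nil].
rewrite (_ : (fun _ => _) = fun y : VK => `|lform (fun z => (z == k)%:R) y| + \sum_(j <- r) `|y j|).
  by apply: dirlipD => //; exact: dirlip_lform_norm.
apply/funext => y; rewrite big_cons; congr (`|_| + _).
rewrite /lform (bigD1 k)//= eqxx mul1r big1 ?addr0// => j /negbTE->.
by rewrite mul0r.
Qed.

Lemma entry_norm_herm (G : 'I_n -> 'M[C]_M) i : (G i)^t* = G i ->
  entry_norm (G i) <= 2 * \sum_j \sum_j' `|gue_coord G (i, (j, j'))|.
Proof.
move=> hG; rewrite /entry_norm !big_tri /= mulrDr; apply: lerD.
  rewrite mulr_sumr; apply: ler_sum => j _; rewrite /gue_coord /= eqxx /abs1 (herm_Im0 _ hG) normr0 addr0.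
  by rewrite ler_peMl// ler1n.
rewrite mulr_sumr; apply: ler_sum => j _; rewrite mulr_sumr; apply: ler_sum => j' jj'.
rewrite (hermE j j' hG) abs1J /gue_coord /= -!val_eqE /= ltn_eqF// gtn_eqF// jj' ltnNge (ltnW jj') /= /abs1.
lra.
Qed.

Lemma entry_norm_HM d (T : measurableType d) (G : 'I_n -> T -> 'M[C]_M) w :
  (forall i, (G i w)^t* = G i w) ->
  entry_norm (HM A0 A G w) <= entry_bound [ffun k => gue_coord (G ^~ w) k / gue_std R k].
Proof.
move=> hG; apply: le_trans (entry_normD _ _) _; rewrite lerD2l.
have sM0 : 0 <= sM^-1 by rewrite invr_ge0 sqrtr_ge0.
apply: le_trans (entry_normZ _ sM0) _; rewrite -mulrA ler_wpM2l//.
set S := \sum_k `|_|.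
have E (t : R) : 2 * (\sum_i entry_norm (A i)) * t = \sum_i 2 * entry_norm (A i) * t by rewrite mulr_sumr mulr_suml.
rewrite E.
apply: le_trans (entry_norm_sum _) _; apply: ler_sum => i _.
apply: le_trans (entry_norm_tens _ _) _; rewrite [2 * _]mulrC -mulrA ler_wpM2l ?entry_norm_ge0//.
apply: le_trans (entry_norm_herm (G := G ^~ w) (hG i)) _; rewrite ler_wpM2l//.
rewrite [leRHS]sum_pair (bigD1 i)//= sum_pair -[leLHS]addr0; apply: lerD; last first.
  by rewrite sumr_ge0// => i' _; rewrite sumr_ge0.
apply: ler_sum => j _; apply: ler_sum => j' _; rewrite ffunE normrM ler_peMr//.
(* [gue_std] is at most 1, so dividing by it only increases the coordinate. *)
have g0 := gue_std_gt0 R (i, (j, j')).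
rewrite normfV gtr0_norm// invf_ge1// /gue_std; case: ifP => // _.
by rewrite -[leRHS]sqrtr1 ler_wsqrtr// invf_le1// ler1n.
Qed.

Definition cvec (f : 'I_(N * M) * bool -> R) : 'cV[C]_(N * M) :=
  \col_p (f (p, true) +i* f (p, false)).

Lemma sqnorm_cvec f : sqnorm (cvec f) = \sum_x f x ^+ 2.
Proof.
by rewrite sum_pair; apply: eq_bigr => p _; rewrite big_ord1 mxE /sqmod big_bool.
Qed.

Lemma cvecB f f' : cvec f - cvec f' = cvec (fun x => f x - f' x).
Proof. by apply/matrixP => p q; rewrite !mxE; apply/eqP; rewrite eq_complex /= !eqxx. Qed.

Lemma cvec_surj (v : 'cV[C]_(N * M)) : exists f, v = cvec f.
Proof.
exists (fun x => if x.2 then complex.Re (v x.1 0) else complex.Im (v x.1 0)).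
by apply/matrixP => p q; rewrite !mxE ord1 /=; case: (v p 0).
Qed.

(** [S] is [m] by [m] whatever [k] is: this keeps the matrices [W_i] at [N] rows. *)
Lemma gram_factor m k (X : 'M[C]_(m, k)) : exists S : 'M[C]_m, S *m S^t* = X *m X^t*.
Proof.
have hX : X *m X^t* \is hermsymmx by apply/hermP; rewrite tcM trmxCK.
have [v|B ->] := psd_factor hX; last by exists (B^t*); rewrite trmxCK.
have -> : (v^t* *m (X *m X^t*) *m v) 0 0 = frob (X^t* *m v).
  by rewrite /frob tcM trmxCK !mulmxA /mxtrace big_ord1.
exact: frob_ge0.
Qed.

Lemma kernel_ineq_sqnorm (B : 'M[C]_N) (X X' : 'M[C]_(N, M)) (S S' : 'M[C]_N) :
  S *m S^t* = X *m X^t* -> S' *m S'^t* = X' *m X'^t* ->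
  sqnorm (X^t* *m (B^t* *m B) *m X - X'^t* *m (B^t* *m B) *m X') <=
  2 * sqnorm (S^t* *m (B^t* *m B) *m X - S'^t* *m (B^t* *m B) *m X').
Proof.
move=> SX SX'; have := @kernel_ineq _ _ _ (B *m X) (B *m X') (B *m S) (B *m S').
rewrite !tcM !mulmxA -!(mulmxA B) SX SX' => /(_ erefl erefl).
by rewrite -!sqnormC => /leRe; rewrite ReM /= mulr0 subr0.
Qed.

(** [F] is a minorant of the smallest eigenvalue that depends only on the standardized coordinates
    and lies in the class where [Ex] can be manipulated. The parameter [e] is both the net radius on
    the sphere and the slack in [op_bound]. *)
Lemma lower_model (Z : 'M[C]_N) (e : R) : negdefmx Z -> 0 < e ->
  exists F : VK -> R, [/\ dirlip F,
   forall d (T : measurableType d) (G : 'I_n -> T -> 'M[C]_M) w,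
     (forall i, (G i w)^t* = G i w) ->
     F [ffun k => gue_coord (G ^~ w) k / gue_std R k] <= lambda_min (HM A0 A G w) &
   lambda_min (A0 + Z + \sum_i A i *m invmx Z *m A i)
     - 2 * Num.sqrt (opnorm (\sum_i A i *m A i)) / sM *
        ((1 + e) * (sM + Num.sqrt (n * N * 2)%:R + 5 / 4) - sM) - 8 * e * Ex entry_bound <= Ex F].
Proof.
move=> hZ e0.
have hAt i : (A i)^t* = A i by apply/hermP; case: (hA i).
have p0 : (0 < N * M)%N by rewrite muln_gt0 hN.
have [I [i0 [pt [pt1 net]]]] := sphere_net (Ordinal p0, true) (exprn_gt0 2 e0).
pose X a := unvec (cvec (pt a)).
have X1 a : sqnorm (X a) = 1 by rewrite sqnorm_unvec sqnorm_cvec pt1.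
have /choice[S SX] := fun a => gram_factor (X a).
have /choice[B AB] := fun i => psd_factor (hA i).1 (hA i).2.
pose Phi (y : VK) := minI i0 (fun a => qform A0 (X a) + lform (gue_coef (fun i => (X a)^t* *m A i *m X a)) y).
have PhiL : dirlip Phi by exact: min_lform_dirlip.
exists (fun y => Phi y + (- (8 * e)) * entry_bound y); split.
- by apply: dirlipD => //; apply: dirlipZ; exact: entry_bound_dirlip.
- move=> d T G w hG; apply: lambda_min_ge1 => //.
    by apply: HM_herm => //; exact/hermP.
  move=> v v1; have [f vf] := cvec_surj v.
  have [|a fa] := net f; first by rewrite -sqnorm_cvec -vf.
  have cv1 : sqnorm (cvec (pt a)) = 1 by rewrite sqnorm_cvec pt1.
  apply: le_trans (qform_perturb (HM A0 A G w) (ltW e0) v1 cv1 _); last by rewrite vf cvecB sqnorm_cvec.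
  apply: lerD; first by rewrite (HM_qform A0 _ hAt hG) minI_le.
  by rewrite mulNr lerN2 ler_wpM2l ?entry_norm_HM// mulr_ge0// ltW.
have QL : dirlip (fun y => - (8 * e) * entry_bound y) by apply: dirlipZ; exact: entry_bound_dirlip.
have -> : Ex (fun y => Phi y + - (8 * e) * entry_bound y) = Ex Phi - 8 * e * Ex entry_bound.
  by rewrite (ExD PhiL QL) ExZ ?mulNr//; exact: entry_bound_dirlip.
rewrite lerD2r.
pose be a := bilin_coef (fun i => (S a)^t* *m A i *m X a).
apply: le_trans (@Ex_comparison _ _ _ _ i0 _ _ be _); last first.
  move=> a b; rewrite gue_coef_dist; first last.
  - by move=> i; rewrite !tcM trmxCK hAt mulmxA.
  - by move=> i; rewrite !tcM trmxCK hAt mulmxA.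
  (* The factor 2 of [kernel_ineq] is matched by [2 / M] in [bilin_coef_dist] against [1 / M] in
     [gue_coef_dist]. *)
  rewrite bilin_coef_dist// mulrAC mulrC mulr_sumr; apply: ler_wpM2r; first by rewrite invr_ge0.
  by apply: ler_sum => i _; rewrite AB kernel_ineq_sqnorm.
have [s [sL sm sb sE]] := op_bound (Ordinal hn, Ordinal hN, true) (Ordinal hM) e0.
rewrite !card_prod card_bool !card_ord in sE sm.
set a := Num.sqrt (opnorm _); set r := lambda_min _.
have sM0 : 0 < sM by rewrite sqrtr_gt0 ltr0n.
(* The pointwise bound is affine in [s y], so only the mean of [s] matters. *)
apply: (@le_trans _ _ (Ex (fun y => (r + 2 * a / sM * sM) + (- (2 * a / sM)) * s y))).
  rewrite ExD; [|exact: dirlip_cst|exact: dirlipZ].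
  rewrite Ex_cst ExZ//.
  have c0 : 0 <= 2 * a / sM by rewrite divr_ge0 ?(ltW sM0)// mulr_ge0 ?sqrtr_ge0.
  by have := ler_wpM2l c0 sE; rewrite -/sM; set c := 2 * a / sM; lra.
apply: Ex_le.
- by apply: dirlipD; [exact: dirlip_cst|exact: dirlipZ].
- exact: min_lform_dirlip.
move=> y; apply: le_minI => k; rewrite bilin_coef_form//.
have s0 : 0 < s y by apply: lt_le_trans (sm y).
have := @pointwise_bound _ _ _ _ A (X k) (S k) (gauss_mx y) (s y) (fun i => (hA i).1) (SX k) _ s0 A0 Z sM hA0 hZ (X1 k) sM0 (sm y).
rewrite -/r -/a /etaform => /(_ (gauss_mx_bound (sb y))); lra.
Qed.

End Assembly.

Section Main.
Context (R : realType) (d : measure_display)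
    (T : measurableType d) (P : probability T R) (n N M : nat)
    (hn : (1 <= n)%N) (hN : (1 <= N)%N) (hM : (1 <= M)%N)
    (A0 : 'M[R[i]]_N) (A : 'I_n -> 'M[R[i]]_N)
    (hA0 : A0 \is hermsymmx) (hA : forall i, possemidefmx (A i))
    (G : 'I_n -> T -> 'M[R[i]]_M)
    (hG : forall i, is_GUE P (G i))
    (hGind : independent P (fun i => sigma_matrix (G i))).

(** [sqrt 2 <= 3 / 2] and [1 <= sqrt k] bound the bracket by [(3 / 2 + 5 / 4) * sqrt k], less than
    [3 * sqrt k]; the factor 2 in front makes it 6. *)
Lemma chevet_constant (k m : R) : 1 <= k -> 0 < m ->
  2 / Num.sqrt m * (Num.sqrt (k * 2) + 5 / 4) <= 6 * Num.sqrt (k / m).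
Proof.
move=> k1 m0.
have k0 : 0 <= k by lra.
rewrite !sqrtrM// sqrtrV ?(ltW m0)//.
have sm : 0 < (Num.sqrt m)^-1 by rewrite invr_gt0 sqrtr_gt0.
have sk : 1 <= Num.sqrt k by rewrite -[leLHS]sqrtr1 ler_wsqrtr.
have s2 : Num.sqrt 2 <= 3 / 2 :> R.
  by rewrite -(ler_pXn2r (n := 2)) ?nnegrE ?sqrtr_ge0 ?sqr_sqrtr//; lra.
have -> : 6 * (Num.sqrt k / Num.sqrt m) = 2 / Num.sqrt m * (3 * Num.sqrt k) by ring.
rewrite ler_wpM2l ?mulr_ge0 ?(ltW sm)//.
nra.
Qed.

Lemma expectation_bound (Z : 'M[R[i]]_N) : negdefmx Z ->
  ((lambda_min (A0 + Z + \sum_i A i *m invmx Z *m A i))%:E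
     - (6 * Num.sqrt ((n * N)%:R / M%:R)
          * Num.sqrt (opnorm (\sum_(i < n) A i *m A i)))%:E
   <= 'E_P[fun w => lambda_min (HM A0 A G w)])%E.
Proof.
move=> hZ; set r := lambda_min _; set a := Num.sqrt (opnorm _).
set sM : R := Num.sqrt M%:R; set q : R := Num.sqrt (n * N * 2)%:R.
(* Everything proportional to the parameter [e] of [lower_model]; it may depend on [M], since [e]
   tends to 0 with all dimensions fixed. *)
pose K := 2 * a / sM * (sM + q + 5 / 4) + 8 * Ex (@entry_bound R n N M A0 A).
have a0 : 0 <= a by exact: sqrtr_ge0.
have sM0 : 0 < sM by rewrite sqrtr_gt0 ltr0n.
have H (e : R) : 0 < e -> ((r - 2 * a / sM * (q + 5 / 4) - K * e)%:E <=
    'E_P[fun w => lambda_min (HM A0 A G w)])%E.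
  move=> e0.
  have [F [FL FH FE]] := lower_model hn hN hM hA0 hA hZ e0.
  apply: le_trans (Ex_le_expectation (g := fun k w => gue_coord (G ^~ w) k) (sig := @gue_std R n M) _ _ _ FL _).
  - rewrite lee_fin; apply: le_trans FE; rewrite -/sM -/a -/r -/q /K.
    by rewrite le_eqVlt; apply/orP; left; apply/eqP; ring.
  - exact: gue_std_gt0.
  - by move=> k; exact: (gue_coord_law hG k).1.
  - by move=> B mB; exact: gue_coord_independent.
  - move=> w; apply: FH => i; exact/hermP/(GUE_hermitian (hG i)).
have L : 2 * a / sM * (q + 5 / 4) <= 6 * Num.sqrt ((n * N)%:R / M%:R) * a.
  have := @chevet_constant (n * N)%:R M%:R; rewrite ler1n ltr0n muln_gt0 hn hN => /(_ isT hM).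
  rewrite -natrM -/q -/sM => h.
  have := ler_wpM2l a0 h; rewrite mulrC [X in _ <= X]mulrC; lra.
rewrite -EFinB.
(* The expectation is an extended real; the value [-oo] is excluded by the lower bound at
   [e = 1]. *)
move: ('E_P[_])%E H => [x| |] H.
- rewrite lee_fin; apply: (@le_trans _ _ (r - 2 * a / sM * (q + 5 / 4))); first lra.
  by apply: (@le_of_eps _ _ _ K) => e e0 _; have := H e e0; rewrite lee_fin; lra.
- exact: leey.
- by have := H 1 ltr01; rewrite leNgt ltNyr.
Qed.

End Main.

Theorem proposition6p1 (R : realType) (d : measure_display)
    (T : measurableType d) (P : probability T R) (n N M : nat)
    (hn : (1 <= n)%N) (hN : (1 <= N)%N) (hM : (1 <= M)%N) (hNM : (N <= M)%N)
    (A0 : 'M[R[i]]_N) (A : 'I_n -> 'M[R[i]]_N)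
    (hA0 : A0 \is hermsymmx) (hA : forall i, possemidefmx (A i))
    (G : 'I_n -> T -> 'M[R[i]]_M)
    (hG : forall i, is_GUE P (G i))
    (hGind : independent P (fun i => sigma_matrix (G i))) :
  (rho_minus A0 A
     - (6 * Num.sqrt ((n * N)%:R / M%:R)
          * Num.sqrt (opnorm (\sum_(i < n) A i *m A i)))%:E
   <= 'E_P[fun w => lambda_min (HM A0 A G w)])%E.
Proof.
(* The error term does not depend on [Z], so the supremum can be taken at the end. *)
rewrite leeBlDr//; apply: ge_ereal_sup => _ [Z hZ <-].
by rewrite -leeBlDr//; exact: expectation_bound.
Qed.
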